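(* Let $d\ge 1$, $k\in\{0,1,\ldots,d\}$, and consider a great hypersphere tessellation of $\mathbb{S}^d$ with non-degenerate directional distribution $\kappa$ and intensity $n\ge d-k$. For every non-negative measurable function $h:\mathbb{K}_s(d)\to\mathbb{R}$ one has $$\mathbf{E}\,h(W_{n,d}^{(k)})=\frac{1}{\mathbf{E}\,\mathcal{H}^k(Z_{n,d}^{(k)})}\,\mathbf{E}\big[h(Z_{n,d}^{(k)})\,\mathcal{H}^k(Z_{n,d}^{(k)})\big].$$
   Context: $\mathbb{S}^d$ is the unit sphere of $\mathbb{R}^{d+1}$. For $k\in\{0,\ldots,d\}$, $\mathbb{G}_s(d,k)$ is the set of $k$-dimensional great subspheres of $\mathbb{S}^d$ (intersections of $\mathbb{S}^d$ with $(k+1)$-dimensional linear subspaces); elements of $\mathbb{G}_s(d,d-1)$ are great hyperspheres. $\mathcal{H}^k$ is $k$-dimensional Hausdorff measure. $\mathbb{K}_s(d)$ is the set of all $C\cap\mathbb{S}^d$ with $C\subset\mathbb{R}^{d+1}$ a closed convex cone different from $\{0\}$, with the Borel $\sigma$-field of the spherical Hausdorff distance. A spherical polytope is $P=C\cap\mathbb{S}^d$ with $C\ne\{0\}$ a polyhedral cone; its $\ell$-dimensional faces are the intersections of $\mathbb{S}^d$ with the $(\ell+1)$-dimensional faces of $C$; $\mathcal{F}_\ell(P)$ is the set of these. Tessellation: let $\kappa^\circ$ be an even Borel probability measure on $\mathbb{S}^d$ with $\kappa^\circ(S)=0$ for every $S\in\mathbb{G}_s(d,d-1)$, and let $\kappa$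 be its image under $u\mapsto u^\perp\cap\mathbb{S}^d$; such a $\kappa$ is what is meant here by a non-degenerate directional distribution. For $n\ge1$ let $S_1,\ldots,S_n$ be independent random great hyperspheres with distribution $\kappa$. The great hypersphere tessellation $T_{n,d}=T_d(S_1,\ldots,S_n)$ of intensity $n$ and directional distribution $\kappa$ is the random finite collection of spherical polytopes (cells) that are the closures of the connected components of $\mathbb{S}^d\setminus(S_1\cup\cdots\cup S_n)$. Put $\mathcal{F}_k(T_{n,d})=\bigcup_{P\in T_{n,d}}\mathcal{F}_k(P)$ and ${\rm skel}_k(T_{n,d})=\bigcup_{F\in\mathcal{F}_k(T_{n,d})}F$. Typical spherical $k$-face: given $T_{n,d}$, $Z_{n,d}^{(k)}$ is chosen uniformly at random from the almost surely finite set $\mathcal{F}_k(T_{n,d})$. Weighted typical spherical $k$-face: $W_{n,d}^{(k)}$ is the almost surely unique $F\in\mathcal{F}_k(T_{n,d})$ containing in its relative interior a random point $v$ which, given $T_{n,d}$, is distributed on ${\rm skel}_k(T_{n,d})$ according to normalized $\mathcal{H}^k$. *)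

(* Defs.v *)
From HB Require Import structures.
From mathcomp Require Import all_boot all_order all_algebra.
From mathcomp Require Import all_classical all_reals all_analysis.
From mathcomp Require Import measurable_realfun.

Set Implicit Arguments.
Unset Strict Implicit.
Unset Printing Implicit Defensive.

Import Order.TTheory GRing.Theory Num.Theory.
Import numFieldNormedType.Exports.

Local Open Scope classical_set_scope.
Local Open Scope ring_scope.

Section Euclidean.
Variables (R : realType) (n : nat).
Implicit Types (x y : 'rV[R]_n) (A : set 'rV[R]_n).

Definition dot x y : R := \sum_i x 0 i * y 0 i.

(* The norm carried by 'rV[R]_n in the library is the sup norm; its topology,
   used below for closures, components and Borel sets, is the Euclidean one. *)
Definition enorm x : R := Num.sqrt (dot x x).

Definition lin_hull A : set 'rV[R]_n :=
  [set x | forall U : {vspace 'rV[R]_n}, A `<=` [set y | y \in U] -> x \in U].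

Definition has_lin_dim A (m : nat) : Prop :=
  exists2 U : {vspace 'rV[R]_n}, \dim U = m & lin_hull A = [set y | y \in U].

Definition convex_cone (C : set 'rV[R]_n) : Prop :=
  C 0 /\ forall a b x y, 0 <= a -> 0 <= b -> C x -> C y -> C (a *: x + b *: y).

Definition polyhedral_cone (C : set 'rV[R]_n) : Prop :=
  exists (m : nat) (a : 'I_m -> 'rV[R]_n), C = [set x | forall i, 0 <= dot (a i) x].

Definition cone_face (C G : set 'rV[R]_n) : Prop :=
  [/\ G `<=` C, convex_set G
    & forall x y t, C x -> C y -> 0 < t < 1 ->
        G (t *: x + (1 - t) *: y) -> G x /\ G y].

Definition borel_rV := g_sigma_algebraType (@open 'rV[R]_n).
HB.instance Definition _ := Measurable.on borel_rV.

End Euclidean.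

Section HausdorffMeasure.
Variables (R : realType) (n : nat).
Implicit Types A U : set 'rV[R]_n.
Local Open Scope ereal_scope.

(* Volume of the k-dimensional Euclidean unit ball. *)
Fixpoint ball_volume (k : nat) : R :=
  match k with
  | 0 => 1
  | 1 => 2
  | j.+2 => 2 * pi / j.+2%:R * ball_volume j
  end%R.

Definition ediam U : \bar R :=
  ereal_sup [set (enorm (x - y)%R)%:E | x in U & y in U].

(* The empty set is singled out because of k = 0, where a singleton must have
   gauge 1 and the empty set gauge 0. *)
Definition hausdorff_gauge (k : nat) U : \bar R :=
  if `[< U = set0 >] then 0
  else (ball_volume k / 2 ^+ k)%:E * ediam U ^+ k.

Definition hausdorff_premeasure (k : nat) (delta : R) A : \bar R :=
  ereal_inf [set \sum_(0 <= i <oo) hausdorff_gauge k (U i) |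
    U in [set U : nat -> set 'rV[R]_n |
      A `<=` \bigcup_i U i /\ forall i, ediam (U i) <= delta%:E]].

Definition hausdorff_measure (k : nat) A : \bar R :=
  ereal_sup [set hausdorff_premeasure k delta A | delta in [set delta | 0 < delta]%R].

End HausdorffMeasure.

Section SphericalGeometry.
Variables (R : realType) (d : nat).
Local Notation V := 'rV[R]_d.+1.
Implicit Types A P F : set V.

Definition sphere : set V := [set x | enorm x = 1].

Definition great_subsphere (k : nat) A : Prop :=
  exists2 U : {vspace V}, \dim U = k.+1 & A = sphere `&` [set x | x \in U].

Definition polar_sphere (u : V) : set V := sphere `&` [set x | dot u x = 0].

Definition spherical_body_set : set (set V) :=
  [set K | exists C : set V,
    [/\ closed C, convex_cone C, C <> [set 0] & K = C `&` sphere]].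

Lemma sphere_spherical_body : sphere \in spherical_body_set.
Proof.
apply/mem_set; exists setT; split.
- exact: closedT.
- by [].
- move=> /seteqP[/(_ (const_mx 1) I) /= /rowP /(_ 0)].
  by rewrite !mxE => /eqP; rewrite oner_eq0.
- by rewrite setTI.
Qed.

Definition raw_spherical_body : Type := set_type spherical_body_set.
HB.instance Definition _ := Choice.on raw_spherical_body.
HB.instance Definition _ :=
  isPointed.Build raw_spherical_body (exist _ sphere sphere_spherical_body).

Definition raw_body (K : raw_spherical_body) : set V := val K.

Definition sphere_dist (x y : V) : R := acos (dot x y).

Definition spherical_hausdorff_dist (K L : raw_spherical_body) : R :=
  let excess A B := sup [set inf [set sphere_dist x y | y in B] | x in A] in
  Num.max (excess (raw_body K) (raw_body L)) (excess (raw_body L) (raw_body K)).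

Definition spherical_body_open (O : set raw_spherical_body) : Prop :=
  forall K, O K ->
    exists2 e : R, 0 < e & forall L, spherical_hausdorff_dist K L < e -> O L.

Definition spherical_body := g_sigma_algebraType spherical_body_open.
HB.instance Definition _ := Measurable.on spherical_body.

Definition body (K : spherical_body) : set V := raw_body K.

(* The default value [point] is returned only when polar_sphere u is empty, which
   requires d = 0; see polar_sphere_spherical_body. *)
Definition great_hypersphere (u : borel_rV R d.+1) : spherical_body :=
  insubd (point : raw_spherical_body) (polar_sphere u).

Lemma polar_sphere_spherical_body (u : V) :
  (0 < d)%N -> polar_sphere u \in spherical_body_set.
Proof.
move=> d_gt0; apply/mem_set; exists [set x | dot u x = 0]; split.
- have cu : continuous (dot u : V -> R).
    apply: (@continuous_big R _ +%R 0 xpredT add_continuous V (index_enum 'I_d.+1)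
              (fun i x => u 0 i * x 0 i)) => i _ x.
    exact: (cvgM (cvg_cst _) (coord_continuous (x := x))).
  exact: (preimage_closed (fun x _ => cu x) (@closed_eq R 0)).
- split=> [|a b x y _ _ /= ux uy].
    by rewrite /dot /= big1 // => i _; rewrite mxE mulr0.
  rewrite /dot in ux uy *.
  transitivity (a * (\sum_i u 0 i * x 0 i) + b * (\sum_i u 0 i * y 0 i)).
    rewrite !mulr_sumr -big_split; apply: eq_bigr => i _ /=.
    by rewrite !mxE mulrDr !(mulrCA (u _ _)).
  by rewrite ux uy !mulr0 addr0.
- move=> C0; have: kermx u^T != 0.
    rewrite -mxrank_eq0 mxrank_ker subn_eq0 -ltnNge.
    by apply: leq_ltn_trans (rank_leq_col _) _.
  case/eqP; apply/row_matrixP => i; rewrite row0.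
  suff : [set x | dot u x = 0] (row i (kermx u^T)) by rewrite C0.
  have /(congr1 (fun M : 'rV[R]_1 => M 0 0)) :
    row i (kermx u^T) *m u^T = 0.
    by rewrite -row_mul mulmx_ker row0.
  rewrite !mxE /dot /= => uk; rewrite -[RHS]uk; apply: eq_bigr => j _.
  by rewrite !mxE mulrC.
- by rewrite setIC.
Qed.

Definition spherical_face (l : nat) P F : Prop :=
  exists C G : set V,
    [/\ polyhedral_cone C, C <> [set 0], P = C `&` sphere,
        cone_face C G /\ has_lin_dim G l.+1 & F = G `&` sphere].

(* Interior of F relative to the smallest great subsphere containing F. *)
Definition sphere_relint F : set V :=
  [set x | F x /\ exists2 e : R, 0 < e &
    forall y, sphere y -> lin_hull F y -> enorm (y - x) < e -> F y].

End SphericalGeometry.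

Section Tessellation.
Variables (R : realType) (d n : nat).
Implicit Types (H : 'I_n -> spherical_body R d) (k : nat).

Definition tessellation H : set (spherical_body R d) :=
  let D := @sphere R d `\` \bigcup_i body (H i) in
  [set K | exists2 x, D x & body K = closure (connected_component D x)].

Definition tess_faces H k : set (spherical_body R d) :=
  [set F | exists2 P, tessellation H P & spherical_face k (body P) (body F)].

Definition skel H k : set 'rV[R]_d.+1 := \bigcup_(F in tess_faces H k) body F.

End Tessellation.

Section Randomness.
Context {R : realType} {dOm : measure_display} {Om : measurableType dOm}.
Variable P : probability Om R.
Local Open Scope ereal_scope.

Definition mutually_independent d (E : measurableType d) n (X : 'I_n -> Om -> E) :=
  forall (J : {set 'I_n}) (B : 'I_n -> set E), (forall i, measurable (B i)) ->
    P (\bigcap_(i in [set i | i \in J]) (X i @^-1` B i)) =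
    \prod_(i in J) P (X i @^-1` B i).

(* The sigma-field generated by a random finite subset T of E, that is, by the
   numbers of its elements in the measurable subsets of E. *)
Definition sigma_of_random_set d (E : measurableType d) (T : Om -> set E) :
    set (set Om) :=
  <<s \bigcup_(B in @measurable _ E)
        preimage_set_system setT
          (fun om => counting (T om `&` B) : \bar R) measurable >>.

(* mu om is the conditional distribution of X given the sub-sigma-field G. *)
Definition has_cond_law (G : set (set Om)) d (E : measurableType d)
    (X : Om -> E) (mu : Om -> set E -> \bar R) : Prop :=
  G `<=` measurable /\
  forall B, measurable B ->
    preimage_set_system setT (mu ^~ B) measurable `<=` G /\
    forall A, G A -> P (A `&` X @^-1` B) = \int[P]_(om in A) mu om B.

End Randomness.

Section TypicalFaces.
Variables (R : realType) (d : nat).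
Local Open Scope ereal_scope.

Definition nondegenerate_directional_distribution
    (kappa : probability (spherical_body R d) R) : Prop :=
  exists kappa0 : probability (borel_rV R d.+1) R,
    [/\ kappa0 (@sphere R d) = 1,
        forall A : set (borel_rV R d.+1), measurable A ->
          kappa0 [set x : 'rV[R]_d.+1 | A (- x)%R] = kappa0 A,
        forall A, great_subsphere d.-1 A -> kappa0 A = 0
      & forall B, measurable B ->
          kappa B = pushforward kappa0 (@great_hypersphere R d) B].

Variables (dOm : measure_display) (Om : measurableType dOm) (P : probability Om R).
Variable n : nat.
Implicit Types (S : 'I_n -> {RV P >-> spherical_body R d}) (k : nat).

Definition iid_great_hyperspheres (kappa : probability (spherical_body R d) R) S :=
  [/\ forall i om, great_subsphere d.-1 (body (S i om)),
      forall i B, measurable B -> distribution P (S i) B = kappa B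
    & mutually_independent P (fun i => S i : Om -> spherical_body R d)].

Definition random_tessellation S (om : Om) : set (spherical_body R d) :=
  tessellation (fun i => S i om).

Definition random_faces S k (om : Om) : set (spherical_body R d) :=
  tess_faces (fun i => S i om) k.

Definition random_skel S k (om : Om) : set 'rV[R]_d.+1 :=
  skel (fun i => S i om) k.

Definition typical_face S k (Z : {RV P >-> spherical_body R d}) : Prop :=
  has_cond_law P (sigma_of_random_set (R := R) (random_tessellation S)) Z
    (fun om B => counting (random_faces S k om `&` B)
                 / counting (random_faces S k om)).

Definition weighted_typical_face S k (W : {RV P >-> spherical_body R d}) : Prop :=
  exists v : {RV P >-> borel_rV R d.+1},
    has_cond_law P (sigma_of_random_set (R := R) (random_tessellation S)) v
      (fun om B => hausdorff_measure k (random_skel S k om `&` B)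
                   / hausdorff_measure k (random_skel S k om)) /\
    {ae P, forall om, random_faces S k om (W om) /\
                      sphere_relint (body (W om)) (v om)}.

End TypicalFaces.

(* Main.v *)
(* Almost surely the great hyperspheres are in general position. Then the number
   of k-faces is a constant N, by deletion and restriction, and the volume of the
   k-skeleton is a constant L: the skeleton is a union of binomial(n, d - k)
   congruent great k-subspheres that meet in null sets. Given the tessellation,
   the face of W is F with probability H^k(F) / L and the face of Z is F with
   probability 1 / N, hence P(W in B) = (N / L) E[1_B(Z) H^k(Z)].
   Since neither H^k(Z) nor the map sending a tessellation to its faces is known to
   be measurable, both sides are computed from countable families of events: v lies
   in a small cell, and a face meets a small ball. The sums over the cells of the
   products of the conditional probabilities agree at every scale, and they converge
   as the scale tends to 0. *)
Require Import Defs.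
From HB Require Import structures.
From mathcomp Require Import finmap all_boot all_order all_algebra.
From mathcomp Require Import all_classical all_reals all_analysis.
From mathcomp Require Import measurable_realfun zify ring lra.

Set Implicit Arguments.
Unset Strict Implicit.
Unset Printing Implicit Defensive.

Import Order.TTheory GRing.Theory Num.Theory.
Import numFieldNormedType.Exports.

Local Open Scope classical_set_scope.
Local Open Scope ring_scope.

(** * Hausdorff measure *)

Section EuclideanFacts.
Variables (R : realType) (n : nat).
Implicit Types x y z : 'rV[R]_n.

(** The conditional laws of [Z] and [v] are accessible only through fixed Borel sets, and this
    shapes the proof. The volume of a sphere is never computed: 0/0 and +oo/+oo have value 0 here,
    so the total mass 1 of the law of [v] already forces 0 < L < +oo, and that of the law of [Z]
    forces N > 0. That [Z] is a face is replaced by the statement that it lies almost surely in the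
    skeleton, which involves countably many events only. For a small ball and the cell inside it,
    the conditional probability that [Z] lies in B and hits the ball, times the share of the
    skeleton in the cell, can be read as an expectation over [v] or over [Z]. In the limit the first
    reading gives 1_B(W) / N, because [v] lies in the relative interior of [W] and in no other face;
    the second gives 1_B(Z) H^k(Z) / L. Taking B to be everything yields E H^k(Z) = L / N, the
    normalization in the theorem. General position rests on independence and on [kappa] giving no
    mass to the great hyperspheres through a fixed point. *)

Lemma dotC x y : dot x y = dot y x.
Proof. by apply: eq_bigr => i _; rewrite mulrC. Qed.

Lemma dotDr x y z : dot x (y + z) = dot x y + dot x z.
Proof. by rewrite -big_split; apply: eq_bigr => i _; rewrite mxE mulrDr. Qed.

Lemma dotZr a x y : dot x (a *: y) = a * dot x y.
Proof. by rewrite mulr_sumr; apply: eq_bigr => i _; rewrite mxE mulrCA. Qed.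

Lemma dotDl x y z : dot (y + z) x = dot y x + dot z x.
Proof. by rewrite dotC dotDr !(dotC x). Qed.

Lemma dotZl a x y : dot (a *: y) x = a * dot y x.
Proof. by rewrite dotC dotZr (dotC x). Qed.

Lemma dot0r x : dot x 0 = 0.
Proof. by rewrite -(scale0r 0) dotZr mul0r. Qed.

Lemma dot0l x : dot 0 x = 0. Proof. by rewrite dotC dot0r. Qed.

Lemma dotNr x y : dot x (- y) = - dot x y.
Proof. by rewrite -scaleN1r dotZr mulN1r. Qed.

Lemma dotNl x y : dot (- y) x = - dot y x.
Proof. by rewrite dotC dotNr dotC. Qed.

Lemma dotBr x y z : dot x (y - z) = dot x y - dot x z.
Proof. by rewrite dotDr dotNr. Qed.

Lemma dot_ge0 x : 0 <= dot x x.
Proof. by apply: sumr_ge0 => i _; rewrite -expr2 sqr_ge0. Qed.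

Lemma dot_eq0 x : (dot x x == 0) = (x == 0).
Proof.
apply/idP/eqP => [|->]; last by rewrite dot0r.
rewrite psumr_eq0 => [/allP x0|i _]; last by rewrite -expr2 sqr_ge0.
apply/rowP => i; rewrite mxE; apply/eqP.
by have := x0 i (mem_index_enum _); rewrite mulf_eq0 orbb.
Qed.

Lemma enorm_ge0 x : 0 <= enorm x. Proof. exact: sqrtr_ge0. Qed.

Lemma sqr_enorm x : enorm x ^+ 2 = dot x x.
Proof. by rewrite sqr_sqrtr // dot_ge0. Qed.

Lemma enorm_eq0 x : (enorm x == 0) = (x == 0).
Proof. by rewrite -dot_eq0 -sqr_enorm expf_eq0. Qed.

Lemma enorm_gt0 x : (0 < enorm x) = (x != 0).
Proof. by rewrite lt_def enorm_ge0 andbT enorm_eq0. Qed.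

Lemma enorm0 : enorm (0 : 'rV[R]_n) = 0.
Proof. by apply/eqP; rewrite enorm_eq0. Qed.

Lemma enormZ a x : enorm (a *: x) = `|a| * enorm x.
Proof.
by rewrite /enorm dotZl dotZr mulrA -expr2 sqrtrM ?sqr_ge0// sqrtr_sqr.
Qed.

Lemma coord_le_enorm x i : `|x 0 i| <= enorm x.
Proof.
rewrite -sqrtr_sqr ler_wsqrtr// /dot (bigD1 i)//= -expr2 lerDl sumr_ge0// => j _.
by rewrite -expr2 sqr_ge0.
Qed.

Lemma norm_le_enorm x : `|x| <= enorm x.
Proof.
rewrite [leLHS]mx_normrE; apply: bigmax_le => [|[i j] _ /=]; first exact: enorm_ge0.
by rewrite (ord1 i) coord_le_enorm.
Qed.

End EuclideanFacts.

Section HausdorffGauge.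
Variables (R : realType) (n k : nat).
Local Notation V := 'rV[R]_n.
Implicit Types A B : set V.
Local Open Scope ereal_scope.

Lemma ball_volume_ge0 j : (0 <= ball_volume R j)%R.
Proof.
suff : (0 <= ball_volume R j /\ 0 <= ball_volume R j.+1)%R by case.
elim: j => [//|j [? ?]]; split=> //=; rewrite mulr_ge0// mulr_ge0 ?invr_ge0//.
by rewrite mulr_ge0// pi_ge0.
Qed.

Lemma ediam_ge0 A : A !=set0 -> 0 <= ediam A.
Proof.
move=> [x Ax]; apply: ereal_sup_ubound; exists x => //; exists x => //.
by rewrite subrr enorm0.
Qed.

Lemma hausdorff_gauge0 : hausdorff_gauge k (set0 : set V) = 0.
Proof. by rewrite /hausdorff_gauge asboolT. Qed.

Lemma hausdorff_gauge_ge0 A : 0 <= hausdorff_gauge k A.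
Proof.
rewrite /hausdorff_gauge; case: asboolP => // /eqP/set0P A0.
by rewrite mule_ge0 ?lee_fin ?divr_ge0 ?ball_volume_ge0// expe_ge0 ?ediam_ge0.
Qed.

End HausdorffGauge.

Lemma le_hausdorff_gauge (R : realType) k n n' (A : set 'rV[R]_n) (B : set 'rV[R]_n') :
  (ediam A <= ediam B)%E -> (B = set0 -> A = set0) ->
  (hausdorff_gauge k A <= hausdorff_gauge k B)%E.
Proof.
move=> AB B0; have [A0|/eqP/set0P An0] := pselect (A = set0).
  by rewrite A0 hausdorff_gauge0 hausdorff_gauge_ge0.
have A0 : A <> set0 by move=> A0; move: An0; rewrite A0 => -[].
rewrite /hausdorff_gauge !asboolF//; last by move/B0.
rewrite lee_pmul ?lee_fin ?divr_ge0 ?ball_volume_ge0 ?expe_ge0 ?ediam_ge0//.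
by elim: k => [|j IH]; rewrite ?expe0// !expeS lee_pmul ?expe_ge0 ?ediam_ge0.
Qed.

(** * The Hausdorff outer measure and separated sets *)

Section HausdorffOuterMeasure.
Variables (R : realType) (n k : nat).
Local Notation V := 'rV[R]_n.
Local Notation muH := (@hausdorff_measure R n k).
Implicit Types A B : set V.
Local Open Scope ereal_scope.

(** The diameter bound becomes an infinite cost, which turns the premeasure into the outer measure
    [mu_ext] of a set function. The sigma-field is the whole power set because coverings consist of
    arbitrary sets. *)
Definition small_gauge (delta : R) (A : set (g_sigma_algebraType [set: set V])) :
  \bar R := if ediam (A : set V) <= delta%:E then hausdorff_gauge k A else +oo.

Lemma small_gauge0 delta : small_gauge delta set0 = 0.
Proof.
rewrite /small_gauge hausdorff_gauge0 ifT//.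
by rewrite ge_ereal_sup// => _ [x []].
Qed.

Lemma small_gauge_ge0 delta A : 0 <= small_gauge delta A.
Proof. by rewrite /small_gauge; case: ifP => _; rewrite ?leey ?hausdorff_gauge_ge0. Qed.

(** A covering with one oversized member has infinite total cost and does not affect the infimum. *)
Lemma hausdorff_premeasureE delta A :
  hausdorff_premeasure k delta A = mu_ext (small_gauge delta) A.
Proof.
apply/eqP; rewrite eq_le; apply/andP; split; last first.
  apply: ereal_inf_le_tmp => _ [U [AU Ud] <-]; exists U.
    by split=> // i; exact: sub_sigma_algebra.
  by apply: eq_eseriesr => i _; rewrite /small_gauge Ud.
apply: le_ereal_inf_tmp => _ [U [_ AU] <-].
have [Ud|] := pselect (forall i, ediam (U i : set V) <= delta%:E).
  apply: ereal_inf_lbound; exists U => //.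
  by apply: eq_eseriesr => i _; rewrite /small_gauge Ud.
rewrite -existsNP => -[i /negP Ui].
rewrite (eseries_pinfty _ (k := i))// ?leey// => [j _|].
  by rewrite -ltNye (lt_le_trans _ (small_gauge_ge0 _ _)).
by rewrite /small_gauge ifN.
Qed.

Lemma hausdorff_premeasure_le delta A : (0 < delta)%R ->
  hausdorff_premeasure k delta A <= muH A.
Proof. by move=> d0; apply: ereal_sup_ubound; exists delta. Qed.

Lemma hausdorff_measure0 : muH set0 = 0.
Proof.
apply/eqP; rewrite eq_le; apply/andP; split; last first.
  by rewrite (le_trans _ (hausdorff_premeasure_le _ ltr01))// hausdorff_premeasureE
    mu_ext_ge0//; exact: small_gauge_ge0.
apply: ge_ereal_sup => _ [delta _ <-].
by rewrite hausdorff_premeasureE mu_ext0//; [exact: small_gauge0|exact: small_gauge_ge0].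
Qed.

Lemma hausdorff_measure_ge0 A : 0 <= muH A.
Proof.
rewrite (le_trans _ (hausdorff_premeasure_le _ ltr01))// hausdorff_premeasureE.
by rewrite mu_ext_ge0//; exact: small_gauge_ge0.
Qed.

Lemma le_hausdorff_measure : {homo muH : A B / A `<=` B >-> A <= B}.
Proof.
move=> A B AB; apply: ge_ereal_sup => _ [delta d0 <-].
rewrite (le_trans _ (hausdorff_premeasure_le _ d0))// !hausdorff_premeasureE.
by apply: le_mu_ext.
Qed.

Lemma hausdorff_measure_sigma_subadditive : sigma_subadditive muH.
Proof.
move=> F; apply: ge_ereal_sup => _ [delta d0 <-]; rewrite hausdorff_premeasureE.
have := @mu_ext_sigma_subadditive _ (g_sigma_algebraType [set: set V]) R
  (small_gauge delta) (small_gauge_ge0 delta) F.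
move=> /le_trans; apply; apply: lee_nneseries => [i _ _|i _].
  by rewrite mu_ext_ge0//; exact: small_gauge_ge0.
by rewrite -hausdorff_premeasureE hausdorff_premeasure_le.
Qed.

HB.instance Definition _ := isOuterMeasure.Build R V muH
  hausdorff_measure0 hausdorff_measure_ge0 le_hausdorff_measure
  hausdorff_measure_sigma_subadditive.

(** No set of small diameter meets both [A] and [B], so a fine covering of the union splits into a
    covering of [A] and one of [B]. *)
Lemma hausdorff_measure_separated A B (e : R) : (0 < e)%R ->
  (forall x y, A x -> B y -> e <= enorm (x - y))%R -> muH A + muH B <= muH (A `|` B).
Proof.
move=> e0 AB; have [->|ABoo] := eqVneq (muH (A `|` B)) +oo; first by rewrite leey.
have fin C : C `<=` A `|` B -> muH C \is a fin_num.
  move=> CAB; rewrite ge0_fin_numE ?hausdorff_measure_ge0//.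
  by rewrite (le_lt_trans (le_hausdorff_measure CAB))// lt_neqAle ABoo leey.
have finA := fin A (@subsetUl _ _ _); have finB := fin B (@subsetUr _ _ _).
rewrite -leeBrDr//.
apply: ge_ereal_sup => _ [da da0 <-].
rewrite leeBrDr//.
rewrite addeC.
have [pAoo|pAfin] := eqVneq (hausdorff_premeasure k da A) +oo.
  move: finA; rewrite ge0_fin_numE ?hausdorff_measure_ge0//.
  by rewrite ltNge => /negP[]; rewrite -pAoo hausdorff_premeasure_le.
have pA : hausdorff_premeasure k da A \is a fin_num.
  rewrite ge0_fin_numE ?lt_neqAle ?leey ?andbT// hausdorff_premeasureE mu_ext_ge0//.
  exact: small_gauge_ge0.
rewrite -leeBrDr//; apply: ge_ereal_sup => _ [db db0 <-]; rewrite leeBrDr//.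
(* The bound e / 2 makes the diameters strictly smaller than the distance e. *)
pose dm := Num.min (Num.min da db) (e / 2)%R.
have dm0 : (0 < dm)%R by rewrite !lt_min da0 db0 divr_gt0.
apply: le_trans (hausdorff_premeasure_le _ dm0).
apply: le_ereal_inf_tmp => _ [U [ABU Ud] <-].
pose W C i := if `[< U i `&` C !=set0 >] then U i else set0.
have Wd C i (dl : R) : (dm <= dl)%R -> (0 < dl)%R -> ediam (W C i) <= dl%:E.
  move=> dmd dl0; rewrite /W; case: asboolP => _.
    by rewrite (le_trans (Ud i))// lee_fin.
  by rewrite ge_ereal_sup// => _ [x []].
have cov C : C `<=` A `|` B -> C `<=` \bigcup_i W C i.
  move=> CAB x Cx; have [i _ Uix] := ABU _ (CAB _ Cx).
  by exists i => //; rewrite /W asboolT//; exists x.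
apply: (@le_trans _ _ (\sum_(0 <= i <oo) hausdorff_gauge k (W B i) +
                       \sum_(0 <= i <oo) hausdorff_gauge k (W A i))).
  apply: leeD; apply: ereal_inf_lbound.
  - exists (W B) => //; split; first by apply: cov; exact: subsetUr.
    by move=> i; apply: Wd => //; rewrite !ge_min lexx orbT.
  - exists (W A) => //; split; first by apply: cov; exact: subsetUl.
    by move=> i; apply: Wd => //; rewrite !ge_min lexx.
rewrite -nneseriesD; [|by move=> *; exact: hausdorff_gauge_ge0..].
apply: lee_nneseries => [i _ _|i _].
  by rewrite adde_ge0// hausdorff_gauge_ge0.
rewrite /W; case: asboolP => [[y [Uy By]]|_]; last first.
  by rewrite hausdorff_gauge0 add0e; case: asboolP => // _; 
    rewrite hausdorff_gauge0 hausdorff_gauge_ge0.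
rewrite asboolF ?hausdorff_gauge0 ?adde0// => -[x [Ux Ax]].
have : (enorm (x - y)%R)%:E <= dm%:E.
  by rewrite (le_trans _ (Ud i))//; apply: ereal_sup_ubound; exists x => //; exists y.
rewrite lee_fin leNgt => /negP[]; rewrite (lt_le_trans _ (AB _ _ Ax By))//.
rewrite (@le_lt_trans _ _ (e / 2)%R) ?ge_min ?lexx ?orbT//.
by rewrite ltr_pdivrMr// ltr_pMr// ltr1n.
Qed.

End HausdorffOuterMeasure.

(** * Measurability of Borel sets for the Hausdorff outer measure *)

Section HausdorffBorel.
Variables (R : realType) (n k : nat).
Local Notation V := 'rV[R]_n.
Local Notation muH := (@hausdorff_measure R n k).
Implicit Types A B X : set V.
Local Open Scope ereal_scope.

(* The sets [S l] are the shells of the classical proof of Caratheodory's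
   criterion; shells of the same parity are at positive distance. *)
Lemma caratheodory_lipschitz (f : V -> R) :
  (forall x y, `|f x - f y| <= enorm (x - y))%R ->
  muH.-caratheodory [set x | f x <= 0]%R.
Proof.
move=> lipf; apply: le_caratheodory_measurable => X.
set F := [set x | _].
change (muH (X `&` F) + muH (X `&` ~` F) <= muH X).
have [->|Xoo] := eqVneq (muH X) +oo; first by rewrite leey.
have Xfin : muH X \is a fin_num.
  by rewrite ge0_fin_numE ?hausdorff_measure_ge0// lt_neqAle Xoo leey.
pose a j : R := (j.+1%:R^-1)%R.
have a_gt0 j : (0 < a j)%R by rewrite invr_gt0.
have a_lt i j : (i < j)%N -> (a j < a i)%R.
  by move=> ij; rewrite ltf_pV2 ?posrE// ltr_nat.
have a_le i j : (i <= j)%N -> (a j <= a i)%R.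
  by move=> ij; rewrite lef_pV2 ?posrE// ler_nat.
have sep (b c : R) Y Z : (b < c)%R -> (forall x, Y x -> (f x <= b)%R) ->
    (forall x, Z x -> (c <= f x)%R) -> muH Y + muH Z <= muH (Y `|` Z).
  move=> bc Yb Zc; apply: (@hausdorff_measure_separated _ _ _ _ _ (c - b)%R).
    by rewrite subr_gt0.
  move=> x y /Yb xb /Zc yc; rewrite (le_trans _ (lipf x y))// distrC.
  by rewrite (le_trans _ (ler_norm _))// lerB.
pose A j := X `&` [set x | a j <= f x]%R.
pose S l := X `&` [set x | a l.+2 <= f x < a l.+1]%R.
have SX p N : \sum_(i < N) muH (S (2 * i + p)%N) <= muH (A (2 * N + p)%N).
  elim: N => [|N IH]; first by rewrite big_ord0 hausdorff_measure_ge0.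
  rewrite big_ord_recr /= (le_trans (leeD2r _ IH))// addeC.
  apply: le_trans (sep _ _ _ _ (a_lt _ _ (ltnSn (2 * N + p))) _ _) _.
  - by move=> x [_ /andP[_ /ltW]].
  - by move=> x [].
  - apply: le_hausdorff_measure => x -[[Xx /andP[fx _]]|[Xx fx]]; split => //=.
      by rewrite (le_trans _ fx)// a_le// mulnS.
    by rewrite (le_trans _ fx)// a_le// mulnS -addnA leq_addl.
have AX j : muH (A j) <= muH X by apply: le_hausdorff_measure => x [].
have SX2 N : \sum_(0 <= l < N) muH (S l) <= muH X + muH X.
  apply: (@le_trans _ _ (\sum_(0 <= l < N.*2) muH (S l))).
    rewrite [leRHS](big_cat_nat (n := N)) -?addnn ?leq_addr//= leeDl//.
    by apply: sume_ge0 => i _; exact: hausdorff_measure_ge0.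
  apply: (@le_trans _ _ (\sum_(i < N) muH (S (2 * i + 0)%N) +
                         \sum_(i < N) muH (S (2 * i + 1)%N))).
    rewrite le_eqVlt; apply/orP; left; apply/eqP.
    elim: N => [|N IH]; first by rewrite double0 big_nil !big_ord0 adde0.
    rewrite doubleS !big_nat_recr//= IH !big_ord_recr/= addn0 addn1 -!mul2n.
    by rewrite -!addeA; congr (_ + _); rewrite addeCA.
  by rewrite leeD// (le_trans (SX _ _)).
have S_ge0 l : 0 <= muH (S l) by exact: hausdorff_measure_ge0.
have Ssum : \sum_(0 <= l <oo) muH (S l) < +oo.
  apply: (@le_lt_trans _ _ (muH X + muH X)); last by rewrite -ge0_fin_numE
    ?adde_ge0 ?hausdorff_measure_ge0// fin_numD Xfin.
  by apply: lime_le; [exact: is_cvg_nneseries|exact: nearW].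
have tail := nneseries_tail_cvg Ssum (fun l _ => S_ge0 l).
apply/lee_addgt0Pr => e e0.
have [j tailj] : exists j, \sum_(j <= l <oo) muH (S l) <= e%:E.
  have : \forall N \near \oo, \sum_(N <= l <oo) muH (S l) < e%:E.
    apply: (tail (fun y => y < e%:E)); apply: open_nbhs_nbhs.
    by split; [exact: open_ereal_lt_ereal|rewrite /= lte_fin].
  by move=> [j _ /(_ j (leqnn j)) /ltW ?]; exists j.
have cover : X `&` ~` F `<=` A j.+1 `|` \bigcup_(l in ~` `I_j) S l.
  move=> x [Xx /negP]; rewrite -ltNge => fx0.
  have [l al] : exists l, (a l <= f x)%R.
    have [l fl] := ltr_add_invr (fx0 : 0 < f x)%R.
    by exists l; rewrite add0r in fl; rewrite ltW.
  case: (ex_minnP (ex_intro (fun l => a l <= f x)%R l al)) => m am mmin.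
  have [mj|jm] := leqP m j.+1; first by left; split => //=; rewrite (le_trans _ am)// a_le.
  right; case: m am mmin jm => [//|[//|m]] am mmin jm.
  exists m; first by apply/negP; rewrite -leqNgt.
  split=> //=; rewrite am/= ltNge; apply/negP => /mmin; by rewrite ltnn.
apply: (@le_trans _ _ (muH (X `&` F) + (muH (A j.+1) + e%:E))).
  rewrite leeD2l// (le_trans (le_hausdorff_measure _ cover))//.
  rewrite (le_trans (outer_measureU2 muH _ _))// leeD2l//.
  by rewrite (le_trans (outer_measure_sigma_subadditive_tail muH _ _)).
rewrite addeA leeD2r//.
apply: le_trans (sep _ _ _ _ (a_gt0 j.+1) _ _) _.
- by move=> x [].
- by move=> x [].
- by apply: le_hausdorff_measure => x [] [].
Qed.

(** An enumeration of the rational points by all natural numbers; numbers that encode no point are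
    sent to 0. *)
Definition rat_point (i : nat) : V :=
  if unpickle i is Some q then map_mx ratr (q : 'rV[rat]_n) else 0%R.

Lemma rat_point_dense (x : V) (e : R) : (0 < e)%R ->
  exists i, (`|x - rat_point i| < e)%R.
Proof.
move=> e0; have /choice[q xq] : forall j, exists q : rat, (`|x ord0 j - ratr q| < e)%R.
  move=> j; have [|q] := @rat_in_itvoo R (x ord0 j - e)%R (x ord0 j + e)%R.
    by rewrite ltrD2l (lt_trans _ e0)// oppr_lt0.
  by rewrite in_itv/= => xqe; exists q; rewrite distrC ltr_distl.
exists (pickle (\row_j q j)); rewrite /rat_point pickleK [ltLHS]mx_normrE.
by apply: bigmax_lt => // -[i j] _ /=; rewrite (ord1 i) !mxE xq.
Qed.

(** An open set is a countable union of balls with rational centres, and the complement of a ball is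
    a sublevel set of a Lipschitz function. *)
Lemma open_caratheodory (O : set V) : open O -> muH.-caratheodory O.
Proof.
move=> oO; pose e m : R := (m.+1%:R^-1)%R.
pose b i m : set V := ball (rat_point i) (e m).
have -> : O = \bigcup_i \bigcup_m (if `[< b i m `<=` O >] then b i m else set0).
  apply/seteqP; split=> [x Ox|x [i _ [m _]]]; last by case: asboolP => // bO /bO.
  have /nbhs_ballP[r /= r0 xr] := open_nbhs_nbhs (conj oO Ox).
  have [m mr] := ltr_add_invr (divr_gt0 r0 (ltr0n R 2) : 0 < r / 2)%R.
  rewrite add0r in mr.
  have em0 : (0 < e m)%R by rewrite invr_gt0.
  have [i xi] := rat_point_dense x em0.
  exists i => //; exists m => //; rewrite asboolT.
    by rewrite /b -ball_normE/= distrC.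
  move=> y; rewrite /b -ball_normE /= => iy; apply: xr; rewrite -ball_normE /=.
  rewrite (le_lt_trans (ler_distD (rat_point i) _ _))//.
  by rewrite [ltRHS](splitr r) ltrD// (lt_trans _ mr).
have bM i m : muH.-caratheodory (b i m).
  (* These are balls of the sup norm, which is dominated by [enorm]; hence [f] is 1-Lipschitz for
     [enorm]. *)
  pose f x := (e m - `|rat_point i - x|)%R.
  rewrite -(setCK (b i m)); apply: caratheodory_measurable_setC.
  have -> : ~` b i m = [set x | f x <= 0]%R.
    apply/seteqP; split=> x; rewrite /b -ball_normE/= subr_le0.
      by move/negP; rewrite -leNgt.
    by move=> h; apply/negP; rewrite -leNgt.
  apply: caratheodory_lipschitz => x y.
  rewrite opprB addrC addrA subrK (le_trans (ler_dist_dist _ _))//.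
  rewrite opprB addrC addrA subrK.
  by rewrite (le_trans _ (norm_le_enorm _))// distrC.
apply: caratheodory_measurable_bigcup => i; apply: caratheodory_measurable_bigcup => m.
by case: asboolP => // _; exact: caratheodory_measurable_set0.
Qed.

Lemma borel_caratheodory (A : set (borel_rV R n)) :
  measurable A -> muH.-caratheodory A.
Proof.
move=> mA; apply: (mA muH.-caratheodory); split; last exact: open_caratheodory.
split.
- exact: caratheodory_measurable_set0.
- by move=> B mB; rewrite setTD; exact: caratheodory_measurable_setC.
- exact: caratheodory_measurable_bigcup.
Qed.

Section restriction.
Variable X : set V.

(** [X] is arbitrary: Caratheodory's condition for a Borel set holds against every test set, so the
    trace of the outer measure on [X] is a Borel measure even when [X] is not Borel. *)
Definition hausdorff_on (A : set (borel_rV R n)) : \bar R := muH (X `&` A).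

Let hausdorff_on0 : hausdorff_on set0 = 0.
Proof. by rewrite /hausdorff_on setI0 hausdorff_measure0. Qed.

Let hausdorff_on_ge0 A : 0 <= hausdorff_on A.
Proof. exact: hausdorff_measure_ge0. Qed.

Let hausdorff_on_sigma_additive : semi_sigma_additive hausdorff_on.
Proof.
move=> F mF tF mUF.
have cF i : muH.-caratheodory (F i) by apply: borel_caratheodory.
have sumE N : \sum_(0 <= i < N) hausdorff_on (F i) =
    muH (X `&` \big[setU/set0]_(i < N) F i).
  by rewrite big_mkord (caratheodory_additive cF tF).
suff -> : hausdorff_on (\bigcup_i F i) = \sum_(0 <= i <oo) hausdorff_on (F i).
  by apply: is_cvg_nneseries.
apply/eqP; rewrite eq_le; apply/andP; split.
  exact: (outer_measure_bigcup_lim muH).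
apply: lime_le; first exact: is_cvg_nneseries.
apply: nearW => N; rewrite sumE; apply: le_hausdorff_measure.
by apply: setIS; exact: bigsetU_bigcup.
Qed.

HB.instance Definition _ := isMeasure.Build _ (borel_rV R n) R hausdorff_on
  hausdorff_on0 hausdorff_on_ge0 hausdorff_on_sigma_additive.

End restriction.

End HausdorffBorel.

Lemma dotE (R : realType) n (x y : 'rV[R]_n) : dot x y = (x *m y^T) 0 0.
Proof. by rewrite mxE; apply: eq_bigr => i _; rewrite mxE. Qed.

(** * Hyperplane sections, orthonormal bases, isometries of subspaces *)

Section LinearAlgebra.
Variables (R : realType) (n : nat).
Local Notation V := 'rV[R]_n.
Implicit Types (u x y : V) (U L M : {vspace V}).

Definition dotr u : V -> R^o := dot u.

Let dotr_linear u : linear (dotr u).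
Proof. by move=> a x y; rewrite /dotr dotDr dotZr. Qed.

HB.instance Definition _ u := GRing.isLinear.Build R V R^o _ (dotr u) (dotr_linear u).

Definition hyperplane u : {vspace V} := lker (linfun (dotr u)).

Lemma mem_hyperplane u x : (x \in hyperplane u) = (dot u x == 0).
Proof. by rewrite memv_ker lfunE. Qed.

(** Rank-nullity for the form [dotr u] on [U]; the witness [x] makes the image one-dimensional. *)
Lemma dim_cap_hyperplane u U x : x \in U -> dot u x != 0 ->
  \dim U = (\dim (U :&: hyperplane u)).+1.
Proof.
move=> xU ux; rewrite -(limg_ker_dim (linfun (dotr u)) U) -/(hyperplane u).
suff -> : \dim (linfun (dotr u) @: U)%VS = 1%N by rewrite addn1.
apply/eqP; rewrite eqn_leq; apply/andP; split.
  by rewrite (leq_trans (dimvS (subvf _)))// dimvf.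
rewrite lt0n dimv_eq0; apply: contraNneq ux => U0.
by have := memv_img (linfun (dotr u)) xU; rewrite U0 memv0 lfunE.
Qed.

Lemma cap_hyperplane_id u U : (forall x, x \in U -> dot u x = 0) ->
  (U :&: hyperplane u)%VS = U.
Proof.
move=> uU; apply/capv_idPl/subvP => x xU.
by rewrite mem_hyperplane uU.
Qed.

Lemma dim_gt0_mem U : (0 < \dim U)%N -> exists2 x, x \in U & x != 0.
Proof.
rewrite lt0n dimv_eq0 => U0; exists (vpick U); first exact: memv_pick.
by rewrite vpick0.
Qed.

(** Cutting a subspace by the hyperplane orthogonal to one of its own nonzero vectors lowers the
    dimension by exactly one. *)
Lemma subspace_of_dim m L : (m <= \dim L)%N -> exists2 M, (M <= L)%VS & \dim M = m.
Proof.
elim: (\dim L) {-2}L (erefl (\dim L)) => [|e IH] {}L dL; rewrite dL ?leqn0.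
  by move=> /eqP ->; exists L.
rewrite leq_eqVlt => /orP[/eqP->|]; first by exists L.
rewrite ltnS => me; have [|x xL x0] := @dim_gt0_mem L; first by rewrite dL.
have := @dim_cap_hyperplane x L x xL; rewrite dot_eq0 => /(_ x0).
rewrite dL => -[/esym dLx]; have [|M ML dM] := IH _ dLx; first by rewrite dLx.
by exists M => //; rewrite (subv_trans ML)// capvSl.
Qed.

(** Gram-Schmidt: a unit vector of [U] is placed above an orthonormal basis of its orthogonal
    complement in [U]. *)
Lemma orthonormal_rows m U : \dim U = m ->
  exists2 E : 'M[R]_(m, n), E *m E^T = 1%:M &
    forall x, x \in U <-> exists c, x = c *m E.
Proof.
elim: m U => [|m IH] U dU.
  exists 0; first by rewrite [LHS]flatmx0 [RHS]flatmx0.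
  move=> x; have /eqP -> : U == 0%VS by rewrite -dimv_eq0 dU.
  rewrite memv0; split=> [/eqP ->|[c ->]]; last by rewrite mulmx0.
  by exists 0; rewrite mulmx0.
have [|w wU w0] := @dim_gt0_mem U; first by rewrite dU.
pose e := (enorm w)^-1 *: w.
have eU : e \in U by rewrite memvZ.
have e1 : dot e e = 1.
  rewrite dotZl dotZr -sqr_enorm expr2 mulKf ?mulVf// ?enorm_eq0//.
have dUe : \dim (U :&: hyperplane e) = m.
  by have := @dim_cap_hyperplane e U e eU; rewrite e1 oner_neq0 dU => /(_ isT) [].
have [E EE EU] := IH _ dUe.
have eE : e *m E^T = 0.
  apply/rowP => j; rewrite [RHS]mxE.
  have : row j E \in (U :&: hyperplane e)%VS.
    by apply/EU; exists (delta_mx 0 j); rewrite -rowE.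
  rewrite memv_cap mem_hyperplane => /andP[_ /eqP <-].
  by rewrite mxE; apply: eq_bigr => i _; rewrite !mxE.
have ee : col_mx e E *m (col_mx e E)^T = 1%:M.
  rewrite tr_col_mx mul_col_row EE eE.
  have -> : E *m e^T = 0 by rewrite -[LHS]trmxK trmx_mul trmxK eE trmx0.
  have -> : e *m e^T = 1%:M by apply/matrixP => i j; rewrite !ord1 -dotE e1 mxE.
  by rewrite -scalar_mx_block.
have mem_rows (c : 'rV[R]_(1 + m)) : c *m col_mx e E \in U.
  rewrite -[c]hsubmxK mul_row_col memvD//.
    by rewrite [lsubmx _]mx11_scalar mul_scalar_mx memvZ.
  set c' := rsubmx _; have : c' *m E \in (U :&: hyperplane e)%VS by apply/EU; exists c'.
  by rewrite memv_cap => /andP[].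
exists (col_mx e E : 'M[R]_(1 + m, n)); first exact: ee.
move=> x; split=> [xU|[c ->]].
  have : x - dot e x *: e \in (U :&: hyperplane e)%VS.
    rewrite memv_cap mem_hyperplane memvB ?memvZ//= dotBr dotZr e1 mulr1.
    by rewrite subrr.
  move=> /EU[c xc]; exists (row_mx (dot e x)%:M c).
  by rewrite (@mul_row_col _ 1 1 m) mul_scalar_mx -xc addrC subrK.
exact: mem_rows.
Qed.

Lemma exists_isometry U M : \dim U = \dim M ->
  exists f : V -> V,
    [/\ forall x, x \in U -> f x \in M,
        forall y, y \in M -> exists2 x, x \in U & f x = y
      & forall x y, x \in U -> y \in U -> f (x - y) = f x - f y /\ enorm (f x) = enorm x].
Proof.
move=> dUM; have [E EE EU] := orthonormal_rows dUM.
have [F FF FM] := orthonormal_rows (erefl (\dim M)).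
have fE c : c *m E *m E^T *m F = c *m F by rewrite -(mulmxA c) EE mulmx1.
have enormE (G : 'M[R]_(\dim M, n)) (c : 'rV_(\dim M)) :
    G *m G^T = 1%:M -> enorm (c *m G) = enorm c.
  by move=> GG; rewrite /enorm !dotE trmx_mul mulmxA -(mulmxA c) GG mulmx1.
(* Coordinates with respect to the basis [E] of [U] are reinterpreted with respect to the basis [F]
   of [M]. *)
exists (fun x => x *m E^T *m F); split.
- by move=> x /EU[c ->]; apply/FM; exists c; rewrite fE.
- by move=> y /FM[c ->]; exists (c *m E); [apply/EU; exists c|rewrite fE].
- move=> x y /EU[c ->] _; split; first by rewrite !mulmxBl.
  by rewrite fE !enormE.
Qed.

End LinearAlgebra.

(** * Hausdorff measure of great subspheres *)

Section SphereHausdorff.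
Variables (R : realType) (k : nat).
Local Open Scope ereal_scope.

Lemma hausdorff_measure_nonexpansive n n' (f : 'rV[R]_n -> 'rV[R]_n') (A : set 'rV[R]_n) :
  (forall x y, A x -> A y -> enorm (f x - f y) <= enorm (x - y))%R ->
  hausdorff_measure k (f @` A) <= hausdorff_measure k A.
Proof.
move=> fA; apply: ge_ereal_sup => _ [delta d0 <-].
apply: le_trans (hausdorff_premeasure_le _ _ d0).
apply: le_ereal_inf_tmp => _ [U [AU Ud] <-].
have diam_f i : ediam (f @` (U i `&` A)) <= ediam (U i).
  apply: ge_ereal_sup => _ [_ [x [Ux Ax] <-] [_ [y [Uy Ay] <-] <-]].
  apply: (@le_trans _ _ (enorm (x - y))%:E); first by rewrite lee_fin fA.
  by apply: ereal_sup_ubound; exists x => //; exists y.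
apply: (@le_trans _ _ (\sum_(0 <= i <oo) hausdorff_gauge k (f @` (U i `&` A)))).
  apply: ereal_inf_lbound; exists (fun i => f @` (U i `&` A)) => //; split.
    by move=> _ [x Ax <-]; have [i _ Uix] := AU _ Ax; exists i => //; exists x.
  by move=> i; rewrite (le_trans (diam_f i)).
apply: lee_nneseries => [i _ _|i _]; first exact: hausdorff_gauge_ge0.
by apply: le_hausdorff_gauge => // ->; rewrite set0I image_set0.
Qed.

Variable d : nat.
Local Notation V := 'rV[R]_d.+1.
Implicit Types U L M : {vspace V}.
Local Notation muH := (@hausdorff_measure R d.+1 k).

Definition subsphere U : set V := @sphere R d `&` [set x | x \in U].

Lemma hausdorff_subsphere_le U M : \dim U = \dim M ->
  muH (subsphere M) <= muH (subsphere U).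
Proof.
move=> /exists_isometry[f [fU fM fiso]].
have -> : subsphere M = f @` subsphere U.
  apply/seteqP; split => [y [y1 /fM[x xU fx]]|_ [x [x1 xU] <-]].
    by exists x => //; split => //; rewrite /sphere/= -fx in y1; rewrite /sphere/=
      -(fiso x x xU xU).2.
  by split; [rewrite /sphere/= (fiso x x xU xU).2|exact: fU].
apply: hausdorff_measure_nonexpansive => x y [_ xU] [_ yU].
by rewrite -(fiso x y xU yU).1 (fiso _ _ (memvB xU yU) yU).2.
Qed.

Lemma hausdorff_subsphere U M : \dim U = \dim M ->
  muH (subsphere U) = muH (subsphere M).
Proof. by move=> UM; apply/eqP; rewrite eq_le !hausdorff_subsphere_le. Qed.

Lemma continuous_dot (u : V) : continuous (dot u : V -> R).
Proof.
apply: (@continuous_big R _ +%R 0%R xpredT add_continuous V (index_enum 'I_d.+1)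
          (fun i x => u 0 i * x 0 i)%R) => i _ x.
exact: (cvgM (cvg_cst _) (coord_continuous (x := x))).
Qed.

Lemma measurable_dot0 (u : V) : measurable [set x : borel_rV R d.+1 | dot u x = 0%R].
Proof.
rewrite -[X in measurable X]setCK; apply: measurableC; apply: sub_sigma_algebra.
apply: closed_openC; apply: (preimage_closed _ (@closed_eq R 0%R)).
by move=> x _; exact: continuous_dot.
Qed.

(* A great subsphere of dimension less than [k] has infinitely many congruent
   copies in one of dimension at most [k], and these meet in a smaller one. *)
Lemma hausdorff_subsphere_eq0 L M : \dim L = k.+1 -> muH (subsphere L) < +oo ->
  (\dim M <= k)%N -> muH (subsphere M) = 0.
Proof.
move=> dL Lfin; move dM : (\dim M) => m; elim: m M dM => [|m IH] M dM mk.
  have /eqP M0 : M == 0%VS by rewrite -dimv_eq0 dM.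
  suff -> : subsphere M = set0 by rewrite hausdorff_measure0.
  apply/seteqP; split=> // x [/=]; rewrite M0 memv0 => + /eqP x0.
  by rewrite /sphere /= x0 enorm0 => /esym/eqP; rewrite oner_eq0.
have [|L2 L2L dL2] := @subspace_of_dim _ _ m.+2 L; first by rewrite dL.
have L2fin : muH (subsphere L2) < +oo.
  apply: le_lt_trans Lfin; apply: le_hausdorff_measure => x [x1 xL2].
  by split => //; exact: (subvP L2L).
have [|p pL2 p0] := @dim_gt0_mem _ _ L2; first by rewrite dL2.
have := @dim_cap_hyperplane _ _ p L2 p pL2; rewrite dot_eq0 dL2 => /(_ p0)[/esym dLp].
have [|q qLp q0] := @dim_gt0_mem _ _ (L2 :&: hyperplane p)%VS; first by rewrite dLp.
have := @dim_cap_hyperplane _ _ q _ q qLp; rewrite dot_eq0 dLp => /(_ q0)[/esym dLpq].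
have [qL2 pq] : q \in L2 /\ dot p q = 0%R.
  by move: qLp; rewrite memv_cap mem_hyperplane => /andP[? /eqP].
(* As [p] and [q] are orthogonal, [dot q (w t)] is [dot q q], so every section of [L2] by the
   hyperplane of [w t] has the dimension of [M]. Two of these sections meet only where both [p] and
   [q] vanish. *)
pose w (t : nat) : V := (q - t%:R *: p)%R.
pose nu := hausdorff_on k (subsphere L2).
pose N : set (borel_rV R d.+1) := [set x | dot p x = 0%R] `&` [set x | dot q x = 0%R].
(* Removing the common part [N], null by induction, makes the sections disjoint without changing
   their measure. *)
pose Bt t : set (borel_rV R d.+1) := [set x | dot (w t) x = 0%R] `\` N.
have mN : measurable N by apply: measurableI; exact: measurable_dot0.
have mB t : measurable (Bt t) by apply: measurableD => //; exact: measurable_dot0.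
have nuN : nu N = 0.
  rewrite -(IH _ dLpq (ltnW mk)); congr muH; apply/seteqP; split => x.
    by move=> [[x1 xL2] [px qx]]; split => //=; rewrite !memv_cap !mem_hyperplane px qx
      xL2 !eqxx.
  move=> [x1 /=]; rewrite !memv_cap !mem_hyperplane => /andP[/andP[? /eqP ?] /eqP ?].
  by split.
have nuB t : nu (Bt t) = muH (subsphere M).
  have nuw : nu [set x | dot (w t) x = 0%R] = muH (subsphere M).
    rewrite (@hausdorff_subsphere _ (L2 :&: hyperplane (w t))); last first.
      rewrite dM; apply/eqP; rewrite -eqSS -dL2; apply/eqP.
      apply: (dim_cap_hyperplane qL2).
      by rewrite dotDl dotNl dotZl pq mulr0 subr0 dot_eq0.
    congr muH; apply/seteqP; split => x.
      by move=> [[x1 xL2] /= wx]; split => //=; rewrite memv_cap mem_hyperplane wx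
        xL2 eqxx.
    by move=> [x1 /=]; rewrite memv_cap mem_hyperplane => /andP[? /eqP ?].
  apply/eqP; rewrite eq_le -{1}nuw; apply/andP; split.
    by rewrite le_measure ?inE//; [exact: measurable_dot0|exact: subDsetl].
  rewrite -nuw -[leRHS]adde0 -nuN.
  apply: le_trans (outer_measureU2 muH _ _); apply: le_hausdorff_measure => x [Lx wx].
  by have [?|?] := pselect (N x); [right|left].
have tB : trivIset setT Bt.
  apply/trivIsetP => s t _ _ st; apply/seteqP; split => // x [[ws Ns] [wt _]].
  apply: Ns; move: ws wt; rewrite /= /w !dotDl !dotNl !dotZl => ws wt.
  have px : dot p x = 0%R.
    have : ((t%:R - s%:R) * dot p x = 0)%R.
      by rewrite -[RHS](subrr 0%R) -{1}ws -wt; ring.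
    move=> /eqP; rewrite mulf_eq0 subr_eq0 eqr_nat eq_sym (negbTE st) /=.
    by move/eqP.
  by split=> //=; move: ws; rewrite px mulr0 subr0.
apply/eqP; rewrite eq_le hausdorff_measure_ge0 andbT leNgt; apply/negP => M0.
have sumB N' : \sum_(t < N') muH (subsphere M) <= muH (subsphere L2).
  under eq_bigr => t _ do rewrite -(nuB t).
  rewrite -(@measure_semi_additive_ord_I _ _ _ (hausdorff_on k (subsphere L2)) Bt N')//;
    do ?[exact: sub_trivIset tB|exact: bigsetU_measurable].
  by apply: le_hausdorff_measure; exact: subIsetl.
move: (sumB 1%N); rewrite big_ord1 => /le_lt_trans /(_ L2fin) Mfin.
have fin : muH (subsphere M) \is a fin_num by rewrite ge0_fin_numE ?ltW.
have fin2 : muH (subsphere L2) \is a fin_num.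
  by rewrite ge0_fin_numE ?hausdorff_measure_ge0.
move: M0 sumB; rewrite -(fineK fin) -(fineK fin2) lte_fin.
set a := fine _; set b := fine _ => a0 sumB.
(* More than b / a disjoint sets of measure a do not fit into measure b. *)
have := sumB (Num.bound (b / a)).
rewrite sumEFin lee_fin sumr_const card_ord leNgt => /negP; apply.
rewrite -mulr_natl -ltr_pdivrMr// archi_boundP// divr_ge0 ?(ltW a0)//.
by rewrite /b fine_ge0// hausdorff_measure_ge0.
Qed.

End SphereHausdorff.

(** * Faces of the tessellation *)

Section SignVectors.
Variables (R : realType) (n : nat).
Local Notation V := 'rV[R]_n.
Implicit Types (a x y w : V) (L I : seq V) (U : {vspace V}) (s : seq (option bool)).

Definition osgn (r : R) : option bool := if r == 0 then None else Some (0 < r).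

Lemma osgn_eq0 r : (osgn r == None) = (r == 0).
Proof. by rewrite /osgn; case: ifP. Qed.

Lemma osgn_true r : osgn r = Some true <-> 0 < r.
Proof.
rewrite /osgn; case: eqVneq => [->|r0]; first by rewrite ltxx.
by split=> [[]|->].
Qed.

Lemma osgn_false r : osgn r = Some false <-> r < 0.
Proof.
rewrite /osgn; case: eqVneq => [->|r0]; first by rewrite ltxx.
by rewrite [r < 0]lt_neqAle r0/= leNgt; split=> [[->]|/negbTE ->].
Qed.

Definition signs L x : seq (option bool) := [seq osgn (dot a x) | a <- L].

Lemma size_signs L x : size (signs L x) = size L.
Proof. exact: size_map. Qed.

Lemma signs0 L : signs L 0 = nseq (size L) None.
Proof. by elim: L => //= a L ->; rewrite dot0r /osgn eqxx. Qed.

Definition zeros L x : seq V := [seq a <- L | dot a x == 0].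

Lemma count_zeros L x : count_mem None (signs L x) = size (zeros L x).
Proof.
by rewrite count_map size_filter; apply: eq_count => a /=; rewrite osgn_eq0.
Qed.

Lemma osgn_perturb (a b : R) : a != 0 ->
  exists2 t, 0 < t & forall r, `|r| <= t -> osgn (a + r * b) = osgn a.
Proof.
(* The summand 1 avoids division by zero and the factor 1/2 makes the perturbation strictly smaller
   than [a] in absolute value. *)
move=> a0; exists (`|a| / (`|b| + 1) / 2); first by rewrite !divr_gt0// ?normr_gt0 ?ltr_wpDl.
move=> r rt; have rb : `|r * b| < `|a|.
  rewrite normrM (@le_lt_trans _ _ (`|r| * (`|b| + 1)))//.
    by rewrite ler_wpM2l// lerDl.
  rewrite (@le_lt_trans _ _ (`|a| / (`|b| + 1) / 2 * (`|b| + 1)))//.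
    by rewrite ler_wpM2r// addr_ge0.
  rewrite mulrAC divfK ?gt_eqF ?ltr_wpDl//.
  by rewrite ltr_pdivrMr// ltr_pMr ?normr_gt0// ltr1n.
move: rb; rewrite ltr_norml; case: (ltgtP a 0) a0 => [a0 _|a0 _|//].
  rewrite ltr0_norm// opprK => /andP[_ rb].
  by have /osgn_false -> := a0; apply/osgn_false; lra.
rewrite gtr0_norm// => /andP[rb _].
by have /osgn_true -> := a0; apply/osgn_true; lra.
Qed.

Lemma signs_perturb L x w :
  exists2 t, 0 < t & forall r, `|r| <= t -> forall a, a \in L -> dot a x != 0 ->
    osgn (dot a (x + r *: w)) = osgn (dot a x).
Proof.
elim: L => [|a L [t t0 IH]]; first by exists 1.
have [ax0|ax] := eqVneq (dot a x) 0.
  exists t => // r rt b; rewrite inE => /predU1P[->|bL]; first by rewrite ax0 eqxx.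
  exact: IH.
have [t' t'0 IH'] := osgn_perturb (dot a w) ax.
exists (Num.min t t') => [|r]; first by rewrite lt_min t0.
rewrite le_min => /andP[rt rt'] b; rewrite inE => /predU1P[-> _|bL].
  by rewrite dotDr dotZr IH'.
exact: IH.
Qed.

Definition cap_hyperplanes U I : {vspace V} :=
  foldr (fun a W => W :&: hyperplane a)%VS U I.

Lemma mem_cap_hyperplanes U I x :
  (x \in cap_hyperplanes U I) = (x \in U) && all (fun a => dot a x == 0) I.
Proof.
elim: I => [|a I IH]; first by rewrite andbT.
by rewrite /= memv_cap IH mem_hyperplane -andbA [X in _ && X]andbC.
Qed.

Lemma mem_zeros U L x : x \in U -> x \in cap_hyperplanes U (zeros L x).
Proof. by move=> xU; rewrite mem_cap_hyperplanes xU filter_all. Qed.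

(** At most [\dim U] of the forms are always linearly independent on [U]; truncated subtraction
    makes longer selections meet in 0 only. *)
Definition general_position U L : Prop :=
  forall I, subseq I L -> \dim (cap_hyperplanes U I) = (\dim U - size I)%N.

Lemma cap_hyperplanesC U I a :
  cap_hyperplanes (U :&: hyperplane a) I = (cap_hyperplanes U I :&: hyperplane a)%VS.
Proof.
apply/vspaceP => x; rewrite memv_cap !mem_cap_hyperplanes memv_cap.
by rewrite -!andbA [X in _ && X]andbC.
Qed.

Lemma general_position_tail U a L : general_position U (a :: L) -> general_position U L.
Proof. by move=> gp I IL; apply/gp/(subseq_trans IL)/subseq_cons. Qed.

Lemma dim_general_position1 U a L : general_position U (a :: L) ->
  \dim (U :&: hyperplane a) = (\dim U).-1.
Proof.
move=> gp; rewrite -subn1 -(gp [:: a])//=.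
by rewrite eqxx sub0seq.
Qed.

Lemma general_position_cap U a L : general_position U (a :: L) ->
  general_position (U :&: hyperplane a) L.
Proof.
move=> gp I IL; rewrite (dim_general_position1 gp) cap_hyperplanesC.
by rewrite (gp (a :: I)) ?subn1 ?subnS ?predn_sub//= eqxx.
Qed.

(** With fewer than [\dim U] zeros at [x], the span of the face through [x] has positive dimension,
    and by general position it is not contained in the hyperplane of [a]. So one can leave that
    hyperplane to either side while staying in the face. *)
Lemma general_position_push U a L x : general_position U (a :: L) -> x \in U ->
  (size (zeros L x) < \dim U)%N ->
  exists w, [/\ w \in U, 0 < dot a w,
     exists2 t, 0 < t & forall r, `|r| <= t -> signs L (x + r *: w) = signs L x
     & all (fun b => dot b w == 0) (zeros L x)].
Proof.
move=> gp xU zU; set I := zeros L x; set W := cap_hyperplanes U I.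
have dW : \dim W = (\dim U - size I)%N.
  by apply: (general_position_tail gp); exact: filter_subseq.
have dWa : \dim (W :&: hyperplane a) = (\dim U - (size I).+1)%N.
  by apply: (gp (a :: I)); rewrite /= eqxx filter_subseq.
have [w wW aw] : exists2 w, w \in W & dot a w != 0.
  have [//|noW] := pselect (exists2 w, w \in W & dot a w != 0).
  have : (\dim U - (size I).+1)%N == (\dim U - size I)%N.
    rewrite -dW -dWa; apply/eqP; congr (\dim _); apply: cap_hyperplane_id => w wW.
    by apply/eqP; apply: contra_notT noW => aw; exists w.
  by rewrite subnS; case: (_ - _)%N (subn_gt0 (size I) (\dim U)) => [|m]; 
    rewrite ?zU// => _ /eqP/n_Sn.
have {w wW aw} [w wW aw] : exists2 w, w \in W & 0 < dot a w.
  have [aw0|aw0] := ltP 0 (dot a w); first by exists w.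
  by exists (- w); rewrite ?memvN// dotNr oppr_gt0 lt_neqAle aw.
move: wW; rewrite mem_cap_hyperplanes => /andP[wU wI].
exists w; split => //; have [t t0 tP] := signs_perturb L x w.
exists t => // r rt; apply/eq_in_map => b bL.
have [bx|bx] := eqVneq (dot b x) 0; last exact: tP.
have /eqP bw : dot b w == 0 by apply: (allP wI); rewrite mem_filter bx eqxx.
by rewrite dotDr dotZr bw mulr0 addr0.
Qed.

Fixpoint all_signs m : seq (seq (option bool)) :=
  if m is m'.+1 then
    allpairs cons [:: None; Some true; Some false] (all_signs m')
  else [:: [::]].

Lemma mem_all_signs m s : (s \in all_signs m) = (size s == m).
Proof.
elim: m s => [|m IH] [|o s]; rewrite ?inE//.
  by apply/negP => /allpairsP[[? ?] []].
rewrite -[all_signs m.+1]/(allpairs cons [:: None; Some true; Some false] (all_signs m)).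
rewrite eqSS -IH; apply/allpairsP/idP => [|sm]; first by case=> -[b' s'] [_ /= s'm [_ ->]].
by exists (o, s); split => //=; case: o => [[]|].
Qed.

Lemma uniq_all_signs m : uniq (all_signs m).
Proof.
elim: m => // m IH; apply: allpairs_uniq => // -[b s] [b' s'] _ _ /= [-> ->] //.
Qed.

Definition realized U L s : Prop := exists2 x, x \in U & signs L x = s.

Definition realized_with_zeros U L z s : bool :=
  `[< realized U L s >] && (count_mem None s == z).

(* Number of faces with [z] vanishing signs of an arrangement of [m] hyperplanes
   in general position in dimension [D], by deletion and restriction. *)
Fixpoint num_faces (m D z : nat) : nat :=
  if m is m'.+1 then
    if (z < D)%N then
      (num_faces m' D z + num_faces m' D.-1 z +
       (if z is z'.+1 then num_faces m' D.-1 z' else 0))%N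
    else (z == m) else (z == 0).

(** A face inside the first hyperplane is a face of the restricted arrangement with one zero fewer.
    The faces on its two sides are counted by inclusion-exclusion: a face of the remaining
    arrangement reaches at least one side, and it reaches both exactly when the hyperplane cuts
    it. *)
Lemma count_realized U L z : general_position U L ->
  count (realized_with_zeros U L z) (all_signs (size L)) =
  num_faces (size L) (\dim U) z.
Proof.
elim: L U z => [|a L IH] U z gp.
  rewrite /= /realized_with_zeros /= addn0 asboolT ?andTb 1?eq_sym//.
  by exists 0; rewrite ?mem0v.
rewrite [RHS]/=; case: ltnP => [zU|Uz].
  rewrite /= !count_cat !count_map /= addn0.
  pose P o := preim (cons o) (realized_with_zeros U (a :: L) z).
  rewrite -[LHS]/(count (P None) _ + (count (P (Some true)) _ +
    count (P (Some false)) _))%N addnC.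
  congr (_ + _)%N; last first.
    case: z zU @P => [|z] zU P.
      by apply/eqP; rewrite -leqn0 leqNgt -has_count; apply/hasPn => s _;
        rewrite /P /= /realized_with_zeros /= add1n andbF.
    rewrite -(dim_general_position1 gp) -IH; last exact: general_position_cap.
    apply: eq_count => s; rewrite /P /= /realized_with_zeros /= add1n eqSS.
    congr (_ && _); apply/asboolP/asboolP => -[x].
      move=> xU [/eqP]; rewrite osgn_eq0 => ax xs; exists x => //.
      by rewrite memv_cap xU mem_hyperplane.
    rewrite memv_cap mem_hyperplane => /andP[xU ax] xs; exists x => //=.
    by rewrite xs; congr (_ :: _); apply/eqP; rewrite osgn_eq0.
  (* The union of the two sides is the deletion and their intersection the restriction. *)
  rewrite -count_predUI -(dim_general_position1 gp) -!IH; last 2 first.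
  - exact: general_position_cap.
  - exact: general_position_tail gp.
  congr (_ + _)%N; apply: eq_count => s; rewrite /P /= /realized_with_zeros /= add0n.
    rewrite -andb_orl; case: eqP => sz; rewrite ?andbF ?andbT//.
    apply/orP/asboolP => [[/asboolP|/asboolP] [x xU [_ xs]]|[x xU xs]].
    - by exists x.
    - by exists x.
    have [|w [wU aw [t t0 tP] _]] := @general_position_push U a L x gp xU.
      by rewrite -count_zeros xs sz.
    have [ax|ax|ax] := ltgtP (dot a x) 0.
    - by right; apply/asboolP; exists x => //=; rewrite xs; congr (_ :: _); apply/osgn_false.
    - by left; apply/asboolP; exists x => //=; rewrite xs; congr (_ :: _); apply/osgn_true.
    left; apply/asboolP; exists (x + t *: w); first by rewrite memvD// memvZ.
    rewrite /= tP ?xs ?gtr0_norm//; congr (_ :: _); apply/osgn_true.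
    by rewrite dotDr dotZr ax add0r mulr_gt0.
  rewrite andbACA andbb; case: eqP => sz; rewrite ?andbF ?andbT//.
  apply/andP/asboolP => [[/asboolP [x xU [/osgn_true ax xs]] /asboolP[y yU [/osgn_false ay ys]]]|].
    (* The parameter at which the segment from [x] to [y] crosses the hyperplane of [a]. *)
    pose r := dot a x / (dot a x - dot a y).
    have axy : 0 < dot a x - dot a y by lra.
    exists (x + r *: (y - x)).
      rewrite memv_cap mem_hyperplane memvD ?memvZ ?memvB//= dotDr dotZr dotBr.
      by rewrite /r -[dot a y - _]opprB mulrN divfK ?subrr// gt_eqF.
    have r0 : 0 < r by rewrite divr_gt0.
    have r1 : r < 1 by rewrite ltr_pdivrMr// mul1r; lra.
    rewrite -xs; apply/eq_in_map => b bL.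
    have := congr1 (fun s => nth None s (index b L)) (etrans xs (esym ys)).
    rewrite /= !(nth_map 0) ?index_mem// !nth_index// dotDr dotZr dotBr.
    have -> : dot b x + r * (dot b y - dot b x) = (1 - r) * dot b x + r * dot b y by ring.
    have r1' : 0 < 1 - r by lra.
    case bxE : (osgn (dot b x)) => [[]|] /esym.
    - move: bxE => /osgn_true bx /osgn_true byy; apply/osgn_true.
      by rewrite addr_gt0// mulr_gt0.
    - move: bxE => /osgn_false bx /osgn_false byy; apply/osgn_false.
      by rewrite -[ltRHS](addr0 0) ltrD// pmulr_rlt0.
    - move: bxE => /eqP + /eqP; rewrite !osgn_eq0 => /eqP -> /eqP ->.
      by rewrite !mulr0 addr0 /osgn eqxx.
  move=> [x]; rewrite memv_cap mem_hyperplane => /andP[xU /eqP ax] xs.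
  have [|w [wU aw [t t0 tP] _]] := @general_position_push U a L x gp xU.
    by rewrite -count_zeros xs sz.
  split; apply/asboolP.
    exists (x + t *: w); first by rewrite memvD// memvZ.
    rewrite /= tP ?xs ?gtr0_norm//; congr (_ :: _); apply/osgn_true.
    by rewrite dotDr dotZr ax add0r mulr_gt0.
  exists (x + (- t) *: w); first by rewrite memvD// memvZ.
  rewrite /= tP ?xs ?normrN ?gtr0_norm//; congr (_ :: _); apply/osgn_false.
  by rewrite dotDr dotZr ax add0r mulNr oppr_lt0 mulr_gt0.
(* With z at least the dimension, only the origin can have z zeros, and there all signs vanish. *)
set m := (size L).+1; pose s0 : seq (option bool) := nseq m None.
have real0 s : realized U (a :: L) s -> count_mem None s = z -> s = s0.
  move=> [x xU <-]; rewrite count_zeros => xz.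
  have := mem_zeros (a :: L) xU; have := gp _ (filter_subseq _ _ : subseq (zeros (a :: L) x) _).
  rewrite xz => dz.
  have /eqP -> : cap_hyperplanes U (zeros (a :: L) x) == 0%VS.
    by rewrite -dimv_eq0 dz subn_eq0.
  rewrite memv0 => /eqP ->; exact: (signs0 (a :: L)).
have cz s : realized_with_zeros U (a :: L) z s = (z == m) && (s == s0).
  apply/andP/andP => [[/asboolP real /eqP sz]|[/eqP zm /eqP ->]].
    have ss0 := real0 _ real sz; split; last exact/eqP.
    by rewrite -sz ss0 count_nseq mul1n.
  split; last by rewrite zm count_nseq mul1n.
  apply/asboolP; exists 0; first exact: mem0v.
  exact: (signs0 (a :: L)).
rewrite (eq_count cz); case: (z == m) => /=; last by rewrite count_pred0.
by rewrite (count_uniq_mem s0 (uniq_all_signs m)) mem_all_signs size_nseq eqxx.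
Qed.

End SignVectors.

(** * Closed cones of an arrangement and their faces *)

Section PolarCones.
Variables (R : realType) (d : nat).
Local Notation V := 'rV[R]_d.+1.
Implicit Types (a g x y w : V) (L : seq V) (U : {vspace V}) (A : set V).

(* The closure of the cell, in the arrangement of the hyperplanes orthogonal to
   the vectors of [L], that contains [g] in its relative interior. *)
Definition sign_cone L g : set V :=
  [set x | forall a, a \in L ->
     (dot a g = 0 -> dot a x = 0) /\ 0 <= dot a g * dot a x].

Lemma sign_cone_refl L g : sign_cone L g g.
Proof. by move=> a _; split=> //; rewrite -expr2 sqr_ge0. Qed.

Lemma sign_cone0 L g : sign_cone L g 0.
Proof. by move=> a _; rewrite dot0r mulr0. Qed.

Lemma sign_coneD L g : convex_cone (sign_cone L g).
Proof.
split=> [|a b x y a0 b0 gx gy c cL]; first exact: sign_cone0.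
have [gx1 gx2] := gx c cL; have [gy1 gy2] := gy c cL.
rewrite dotDr !dotZr; split=> [g0|]; first by rewrite gx1// gy1// !mulr0 addr0.
by rewrite mulrDr mulrCA (mulrCA (dot c g)) addr_ge0// mulr_ge0.
Qed.

Lemma mulr_ge0_pivot (a b c : R) : a != 0 -> 0 <= a * b -> 0 <= a * c -> 0 <= b * c.
Proof.
move=> a0 ab ac; have a2 : 0 < a ^+ 2 by rewrite exprn_even_gt0.
rewrite -(pmulr_rge0 _ a2); have -> : a ^+ 2 * (b * c) = (a * b) * (a * c) by ring.
exact: mulr_ge0.
Qed.

(** [sign_cone L g x] says that each sign of [x] is zero or equal to that of [g]. This is the face
    order on sign vectors, hence a preorder on points whose equivalence classes are the relatively
    open cells. *)
Lemma sign_cone_trans L g x y : sign_cone L x g -> sign_cone L g y -> sign_cone L x y.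
Proof.
move=> xg gy a aL; have [xg1 xg2] := xg a aL; have [gy1 gy2] := gy a aL.
split=> [/xg1/gy1//|]; have [ag|ag] := eqVneq (dot a g) 0; first by rewrite gy1 ?mulr0.
by apply: (mulr_ge0_pivot ag) => //; rewrite mulrC.
Qed.

Lemma eq_sign_cone L g g' : signs L g = signs L g' -> sign_cone L g = sign_cone L g'.
Proof.
suff sub h h' : signs L h = signs L h' -> sign_cone L h `<=` sign_cone L h'.
  by move=> gg'; apply/seteqP; split; apply: sub.
move=> hh' x hx a aL; have [hx1 hx2] := hx a aL.
have : osgn (dot a h) = osgn (dot a h').
  have := congr1 (fun s => nth None s (index a L)) hh'.
  by rewrite /= !(nth_map 0) ?index_mem// !nth_index.
have [h0|h0|h0] := ltgtP (dot a h) 0.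
- have /osgn_false -> := h0; move=> /esym/osgn_false h'0; split.
    by move=> h'e; rewrite h'e ltxx in h'0.
  by rewrite nmulr_rge0//; rewrite nmulr_rge0// in hx2.
- have /osgn_true -> := h0; move=> /esym/osgn_true h'0; split.
    by move=> h'e; rewrite h'e ltxx in h'0.
  by rewrite pmulr_rge0//; rewrite pmulr_rge0// in hx2.
- rewrite h0 /osgn eqxx; case: eqVneq => // h'0 _.
  by rewrite hx1// mulr0.
Qed.

Lemma sign_cone_inj L g g' : sign_cone L g g' -> sign_cone L g' g ->
  signs L g = signs L g'.
Proof.
move=> gg' g'g; apply/eq_in_map => a aL.
have [g0 gg0] := gg' a aL; have [g'0 _] := g'g a aL.
have [h0|h0|h0] := ltgtP (dot a g) 0.
- have /osgn_false -> := h0; apply/esym/osgn_false.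
  have [g'e|] := eqVneq (dot a g') 0; first by move: h0; rewrite (g'0 g'e) ltxx.
  by rewrite lt_neqAle => -> /=; rewrite -(nmulr_rge0 _ h0).
- have /osgn_true -> := h0; apply/esym/osgn_true.
  have [g'e|] := eqVneq (dot a g') 0; first by move: h0; rewrite (g'0 g'e) ltxx.
  by rewrite lt_def => -> /=; rewrite -(pmulr_rge0 _ h0).
- by rewrite h0 g0.
Qed.

Lemma sign_cone_zeros L g x : sign_cone L g x ->
  zeros L g = [seq a <- zeros L x | dot a g == 0].
Proof.
move=> gx; rewrite -filter_predI; apply: eq_in_filter => a aL /=.
by case: eqP => // /(gx a aL).1 ->; rewrite eqxx.
Qed.

(** The hyperplanes through [g] are among those through [x], so comparing their numbers forces
    equality. *)
Lemma eq_zeros L g x : sign_cone L g x -> (size (zeros L x) <= size (zeros L g))%N ->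
  forall a, a \in L -> dot a x = 0 -> dot a g = 0.
Proof.
move=> gx; rewrite (sign_cone_zeros gx) size_filter => xg a aL ax.
have : all (fun b => dot b g == 0) (zeros L x).
  by rewrite all_count eqn_leq count_size.
by move=> /allP /(_ a); rewrite mem_filter ax eqxx aL => /(_ isT)/eqP.
Qed.

(** A real vector space is not a finite union of proper subspaces: a vector off the previous
    hyperplanes is perturbed off the next one. *)
Lemma avoid_hyperplanes L U :
  (forall a, a \in L -> exists2 v, v \in U & dot a v != 0) ->
  exists2 w, w \in U & forall a, a \in L -> dot a w != 0.
Proof.
elim: L => [|a L IH] LU; first by exists 0; rewrite ?mem0v.
have [w wU wL] : exists2 w, w \in U & forall b, b \in L -> dot b w != 0.
  by apply: IH => b bL; apply: LU; rewrite inE bL orbT.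
have [aw|aw] := eqVneq (dot a w) 0; last first.
  by exists w => // b; rewrite inE => /predU1P[->|/wL].
have [v vU av] := LU a (mem_head _ _).
have [t t0 tP] := signs_perturb L w v.
exists (w + t *: v); first by rewrite memvD// memvZ.
move=> b; rewrite inE => /predU1P[->|bL].
  by rewrite dotDr dotZr aw add0r mulf_neq0// gt_eqF.
rewrite -osgn_eq0 tP ?gtr0_norm ?wL// osgn_eq0; exact: wL.
Qed.

(** A small move from [g] along the space where the zeros of [g] vanish changes no sign, so it stays
    in the cone; the difference spans the direction. *)
Lemma sign_cone_span L g (U : {vspace V}) : sign_cone L g `<=` [set y | y \in U] ->
  (cap_hyperplanes fullv (zeros L g) <= U)%VS.
Proof.
move=> gU; apply/subvP => w; rewrite mem_cap_hyperplanes memvf /= => /allP wg.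
have [t t0 tP] := signs_perturb L g w.
have gw : sign_cone L g (g + t *: w).
  have <- : sign_cone L (g + t *: w) = sign_cone L g.
    apply: eq_sign_cone; apply/eq_in_map => a aL.
    have [ag|ag] := eqVneq (dot a g) 0; last by rewrite tP ?gtr0_norm.
    have /eqP aw : dot a w == 0 by apply: wg; rewrite mem_filter ag eqxx.
    by rewrite dotDr dotZr aw mulr0 addr0.
  exact: sign_cone_refl.
have := memvB (gU _ gw) (gU _ (@sign_cone_refl L g)).
by rewrite addrC addKr rpredZeq gt_eqF.
Qed.

Lemma lin_hull_sign_cone L g :
  lin_hull (sign_cone L g) = [set y | y \in cap_hyperplanes fullv (zeros L g)].
Proof.
apply/seteqP; split => [x /(_ (cap_hyperplanes fullv (zeros L g)))|x xg U gU].
  apply=> y gy /=; rewrite mem_cap_hyperplanes memvf; apply/allP => a.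
  by rewrite mem_filter => /andP[/eqP ag aL]; rewrite (gy a aL).1.
exact: (subvP (sign_cone_span gU)).
Qed.

Lemma sign_cone_lin_dim L g m :
  has_lin_dim (sign_cone L g) m <-> \dim (cap_hyperplanes fullv (zeros L g)) = m.
Proof.
rewrite /has_lin_dim lin_hull_sign_cone; split=> [[U <- WU]|Wm].
  congr (\dim _); apply/vspaceP => x.
  by apply/idP/idP; move: x; case/seteqP: WU.
by exists (cap_hyperplanes fullv (zeros L g)).
Qed.

Lemma sign_cone_polyhedral L g : polyhedral_cone (sign_cone L g).
Proof.
(* An equality is encoded by the two inequalities for [a] and [- a]; for the other hyperplanes the
   second list contributes the trivial inequality of the vector 0. *)
pose b := [seq if dot a g == 0 then - a else dot a g *: a | a <- L] ++
          [seq if dot a g == 0 then a else 0 | a <- L].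
exists (size b), (fun i => nth 0 b i); apply/seteqP; split=> x.
  move=> gx i /=; move: (mem_nth 0 (ltn_ord i)); rewrite mem_cat.
  case/orP => /mapP[a aL ->]; have [ag1 ag2] := gx a aL; case: eqP => ag.
  - by rewrite dotNl ag1// oppr0.
  - by rewrite dotZl.
  - by rewrite ag1.
  - by rewrite dot0l.
move=> bx a aL.
have memb c : c \in b -> 0 <= dot c x.
  by move=> /(nthP 0)[i ib <-]; exact: (bx (Ordinal ib)).
have b1 : 0 <= dot (if dot a g == 0 then - a else dot a g *: a) x.
  by apply: memb; rewrite mem_cat; apply/orP; left; apply/mapP; exists a.
have b2 : 0 <= dot (if dot a g == 0 then a else 0) x.
  by apply: memb; rewrite mem_cat; apply/orP; right; apply/mapP; exists a.
move: b1 b2; case: eqVneq => ag b1 b2.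
  rewrite ag mul0r; split=> // _; apply/eqP; rewrite eq_le b2 andbT.
  by rewrite -oppr_ge0 -dotNl.
by split=> [/eqP|]; [rewrite (negbTE ag)|rewrite -dotZl].
Qed.

Lemma sign_cone_convex L g : convex_set (sign_cone L g : set (convex_lmodType V)).
Proof.
move=> x y t /set_mem gx /set_mem gy; apply/mem_set.
apply: (sign_coneD L g).2 => //; rewrite ?ge0//.
by rewrite subr_ge0 le1.
Qed.

(** On the cone of [x] each form has a fixed weak sign, so if it vanishes on a proper convex
    combination it vanishes at both ends. *)
Lemma sign_cone_face L x g : (forall a, a \in L -> dot a x != 0) -> sign_cone L x g ->
  cone_face (sign_cone L x) (sign_cone L g).
Proof.
move=> x0 xg; split; last 1 first.
- move=> y z t xy xz /andP[t0 t1] gyz.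
  have t1' : 0 < 1 - t by rewrite subr_gt0.
  suff pt a : a \in L -> 0 <= dot a x * dot a y -> 0 <= dot a x * dot a z ->
      (dot a g = 0 -> dot a y = 0 /\ dot a z = 0) /\
      0 <= dot a g * dot a y /\ 0 <= dot a g * dot a z.
    split=> a aL; have [pt1 [pt2 pt3]] := pt a aL (xy a aL).2 (xz a aL).2.
      by split=> // /pt1[].
    by split=> // /pt1[].
  move=> aL ay az; have [g1 g2] := gyz a aL; have [_ xg2] := xg a aL.
  move: g1 g2; rewrite dotDr !dotZr => g1 g2.
  have [ax|ax|ax] := ltgtP (dot a x) 0; last by move: (x0 a aL); rewrite ax eqxx.
  + rewrite !nmulr_rge0// in ay az xg2; split; last first.
      by split; rewrite mulr_le0.
    move=> /g1 e; have : t * dot a y <= 0 by rewrite pmulr_rle0.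
    have : (1 - t) * dot a z <= 0 by rewrite pmulr_rle0.
    move=> h1 h2; have /eqP : t * dot a y = 0 by lra.
    rewrite mulf_eq0 gt_eqF//= => /eqP ay0; split=> //.
    have /eqP : (1 - t) * dot a z = 0 by lra.
    by rewrite mulf_eq0 gt_eqF//= => /eqP.
  + rewrite !pmulr_rge0// in ay az xg2; split; last first.
      by split; rewrite mulr_ge0.
    move=> /g1 e; have : 0 <= t * dot a y by rewrite pmulr_rge0.
    have : 0 <= (1 - t) * dot a z by rewrite pmulr_rge0.
    move=> h1 h2; have /eqP : t * dot a y = 0 by lra.
    rewrite mulf_eq0 gt_eqF//= => /eqP ay0; split=> //.
    have /eqP : (1 - t) * dot a z = 0 by lra.
    by rewrite mulf_eq0 gt_eqF//= => /eqP.
- by move=> y; exact: sign_cone_trans.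
- exact: sign_cone_convex.
Qed.

(* A point of [G] with as few vanishing signs as possible is interior to [G]. *)
Lemma face_sign_cone L x (G : set V) : (forall a, a \in L -> dot a x != 0) ->
  cone_face (sign_cone L x) G -> G !=set0 -> exists2 g, G g & G = sign_cone L g.
Proof.
move=> x0 [GC Gconv Gface] [g0 Gg0].
have [g Gg gmin] : exists2 g, G g &
    forall y, G y -> (size (zeros L g) <= size (zeros L y))%N.
  pose Pn m := `[< exists2 y, G y & size (zeros L y) = m >].
  have exP : exists m, Pn m by exists (size (zeros L g0)); apply/asboolP; exists g0.
  case: (ex_minnP exP) => m /asboolP[g Gg <-] mmin.
  by exists g => // y Gy; apply: mmin; apply/asboolP; exists y.
exists g => //; have xg := GC _ Gg; apply/seteqP; split=> y.
  (* The midpoint [z] vanishes only where both [g] and [y] do, so minimality of the zeros of [g]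
     makes [y] vanish wherever [g] does. *)
  move=> Gy; have xy := GC _ Gy; pose z := 2^-1 *: g + (1 - 2^-1) *: y.
  have Gz : G z.
    have h1 : (2^-1 : R) <= 1 by rewrite invf_le1// ler1n.
    have h0 : 0 <= (2^-1 : R) by rewrite invr_ge0.
    exact/set_mem/(Gconv g y (Itv01 h0 h1))/mem_set/Gy/mem_set.
  have zE a : dot a z = 2^-1 * (dot a g + dot a y).
    by rewrite dotDr !dotZr; field.
  have gy a : a \in L -> 0 <= dot a g * dot a y.
    by move=> aL; apply: mulr_ge0_pivot (x0 a aL) (xg a aL).2 (xy a aL).2.
  have zg : sign_cone L z g.
    move=> a aL; rewrite zE; split; last first.
      rewrite -mulrA pmulr_rge0 ?invr_gt0// mulrDl addr_ge0 -?expr2 ?sqr_ge0//.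
      by rewrite mulrC gy.
    move=> /eqP; rewrite mulf_eq0 invr_eq0 pnatr_eq0/= addrC addr_eq0 => /eqP yg.
    have := gy a aL; rewrite yg mulrN -expr2 oppr_ge0 => ag.
    by apply/eqP; rewrite -sqrf_eq0 eq_le ag sqr_ge0.
  move=> a aL; split; last exact: gy.
  move=> ag; have := eq_zeros zg (gmin _ Gz) aL ag.
  rewrite zE ag add0r => /eqP; rewrite mulf_eq0 invr_eq0 pnatr_eq0/=.
  by move/eqP.
(* The segment from [y] to [g] is prolonged a little beyond [g], to [z]. Then [g] is interior to the
   segment from [z] to [y], and the face property puts [y] into [G]. *)
move=> gy; have [t t0 tP] := signs_perturb L g (g - y).
pose z := g + t *: (g - y).
have gz : sign_cone L g z.
  have <- : sign_cone L z = sign_cone L g; last exact: sign_cone_refl.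
  apply: eq_sign_cone; apply/eq_in_map => a aL.
  have [ag|ag] := eqVneq (dot a g) 0; last by rewrite tP ?gtr0_norm.
  by rewrite dotDr dotZr dotBr (gy a aL).1// ag subrr mulr0 addr0.
have t1 : 0 < 1 + t by rewrite addr_gt0.
have : G ((1 + t)^-1 *: z + (1 - (1 + t)^-1) *: y).
  suff -> : (1 + t)^-1 *: z + (1 - (1 + t)^-1) *: y = g by [].
  apply/rowP => i; rewrite !mxE; field; exact: lt0r_neq0.
have t01 : 0 < (1 + t)^-1 < 1 by rewrite invr_gt0 t1/= invf_lt1// ltrDl.
move=> Gs; apply: (Gface z y _ _ _ t01 Gs).2.
- exact: sign_cone_trans xg gz.
- exact: sign_cone_trans xg gy.
Qed.

End PolarCones.

(** * Components of the complement of the great hyperspheres *)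

Section SphereTopology.
Variables (R : realType) (d : nat).
Local Notation V := 'rV[R]_d.+1.
Local Notation sphere := (@sphere R d).
Implicit Types (a g x y w : V) (L : seq V).

Lemma continuous_enorm : continuous (@enorm R d.+1).
Proof.
move=> x; apply: (@continuous_comp _ _ _ (fun x => dot x x) Num.sqrt); last first.
  exact: sqrt_continuous.
apply: (@continuous_big R _ +%R 0%R xpredT add_continuous V (index_enum 'I_d.+1)
          (fun i x => x 0 i * x 0 i)%R) => i _ y.
exact: (cvgM (coord_continuous (x := y)) (coord_continuous (x := y))).
Qed.

Definition normz x : V := (enorm x)^-1 *: x.

Lemma normz_sphere x : x != 0 -> sphere (normz x).
Proof.
move=> x0; rewrite /sphere/= enormZ ger0_norm ?invr_ge0 ?enorm_ge0//.
by rewrite mulVf// enorm_eq0.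
Qed.

Lemma normz_id x : sphere x -> normz x = x.
Proof. by rewrite /sphere/= /normz => ->; rewrite invr1 scale1r. Qed.

Lemma sphere_neq0 x : sphere x -> x != 0.
Proof. by rewrite -enorm_eq0 => /= ->; rewrite oner_eq0. Qed.

Lemma dot_normz a x : dot a (normz x) = (enorm x)^-1 * dot a x.
Proof. exact: dotZr. Qed.

Lemma enormV_gt0 x : x != 0 -> 0 < (enorm x)^-1.
Proof. by move=> x0; rewrite invr_gt0 enorm_gt0. Qed.

Lemma continuous_normz x : x != 0 -> {for x, continuous normz}.
Proof.
move=> x0; have e0 : enorm x != 0 by rewrite enorm_eq0.
have cV := @cvgV _ _ _ _ (@enorm R d.+1) _ e0 (@continuous_enorm x).
exact: (cvgZ (cV _) cvg_id).
Qed.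

Lemma continuous_line x w : continuous (fun r : R => x + r *: w).
Proof.
move=> r; apply: cvgD; first exact: cvg_cst.
by apply: cvgZr_tmp; exact: cvg_id.
Qed.

Lemma continuous_normz_line x w (r : R) : x + r *: w != 0 ->
  {for r, continuous (fun r : R => normz (x + r *: w))}.
Proof.
by move=> xw; exact: (cvg_comp _ _ (@continuous_line x w r) (continuous_normz xw)).
Qed.

Lemma normz_perturb x w (B : set V) : x != 0 -> nbhs (normz x) B ->
  exists2 t, 0 < t & forall r, `|r| <= t -> B (normz (x + r *: w)).
Proof.
move=> x0 xB; have x0' : x + 0 *: w != 0 by rewrite scale0r addr0.
have := continuous_normz_line x0'; rewrite /prop_for /continuous_at scale0r addr0.
move=> /(_ _ xB)/nbhs_ballP[e/= e0 eB].
exists (e / 2); first by rewrite divr_gt0.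
move=> r re; apply: eB; rewrite -ball_normE/= sub0r normrN (le_lt_trans re)//.
by rewrite ltr_pdivrMr// ltr_pMr// ltr1n.
Qed.

Lemma nbhs_enorm x (e : R) : 0 < e -> nbhs x [set y | enorm (y - x) < e].
Proof.
move=> e0; have : {for x, continuous (fun y => enorm (y - x))}.
  apply: (@continuous_comp _ _ _ (fun y => y - x) (@enorm R d.+1)).
    exact: (cvgD cvg_id (cvg_cst _)).
  exact: continuous_enorm.
rewrite /prop_for /continuous_at subrr enorm0 => /(_ [set r | r < e]); apply.
exact: lt_nbhsl.
Qed.

Definition cell L x : set V := sphere `&` [set y | forall a, a \in L -> 0 < dot a x * dot a y].

Definition off_hyperplanes L : set V := sphere `&` [set y | forall a, a \in L -> dot a y != 0].

(** By the intermediate value theorem a connected set off the hyperplanes keeps all signs.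
    Conversely, the segment between two points with equal signs is projected to the sphere; a
    nonempty [L] keeps it away from the origin. *)
Lemma component_cell L x : L != [::] -> off_hyperplanes L x ->
  connected_component (off_hyperplanes L) x = cell L x.
Proof.
move=> L0 [x1 xL]; apply/seteqP; split => y.
  move=> [C [Cx CD Cconn] Cy]; have [y1 yL] := CD _ Cy; split=> // a aL.
  rewrite lt_def mulf_neq0 ?xL ?yL//= leNgt; apply/negP => xy.
  have : connected (dot a @` C).
    apply: connected_continuous_connected => //; apply: continuous_subspaceT.
    exact: continuous_dot.
  move=> /connected_intervalP itv.
  have : (dot a @` C) 0.
    have [ax|ax] := leP 0 (dot a x).
      apply: (itv (dot a y) (dot a x)); [by exists y|by exists x|].
      rewrite ax andbT; apply: contraLR (xy); rewrite -ltNge -leNgt => ay.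
      by rewrite mulr_ge0// ltW.
    apply: (itv (dot a x) (dot a y)); [by exists x|by exists y|].
    rewrite ltW//=; apply: contraLR (xy); rewrite -ltNge -leNgt => ay.
    by rewrite mulr_le0// ltW.
  by move=> [z Cz az]; have := (CD _ Cz).2 a aL; rewrite az eqxx.
move=> [y1 xy]; pose z (r : R) := x + r *: (y - x).
have zP r : r \in `[0, 1] -> forall a, a \in L -> 0 < dot a x * dot a (z r).
  rewrite in_itv/= => /andP[r0 r1] a aL; rewrite dotDr dotZr dotBr.
  have -> : dot a x * (dot a x + r * (dot a y - dot a x)) =
    (1 - r) * dot a x ^+ 2 + r * (dot a x * dot a y) by ring.
  have ax2 : 0 < dot a x ^+ 2 by rewrite exprn_even_gt0//= xL.
  have := xy a aL => /= axy.
  have [r0'|r0'] := ltP 0 r.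
    apply: ltr_wpDl; last exact: mulr_gt0.
    by apply: mulr_ge0; [rewrite subr_ge0|exact: ltW].
  by have -> : r = 0 by [lra]; rewrite subr0 mul1r mul0r addr0.
have z0 r : r \in `[0, 1] -> z r != 0.
  move=> r01; have [a aL] : exists a, a \in L.
    by case: L L0 {xL xy zP} => // a L _; exists a; exact: mem_head.
  by apply: contraTneq (zP r r01 a aL) => ->; rewrite dot0r mulr0 ltxx.
apply: (@connected_component_max _ _ ((fun r => normz (z r)) @` `[0, 1]%classic)).
- by exists 0; rewrite /= ?in_itv/= ?lexx ?ler01// /z scale0r addr0 normz_id.
- move=> _ [r r01 <-]; split; first by apply: normz_sphere; exact: z0.
  move=> a aL; rewrite dot_normz mulf_neq0 ?invr_eq0 ?enorm_eq0 ?z0//.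
  by apply: contraTneq (zP r r01 a aL) => ->; rewrite mulr0 ltxx.
- apply: connected_continuous_connected; first exact: segment_connected.
  apply: continuous_in_subspaceT => r /set_mem r01.
  exact/continuous_normz_line/z0.
- exists 1; rewrite /= ?in_itv/= ?lexx ?ler01// /z scale1r addrC subrK normz_id//.
Qed.

Lemma closed_dot0 a : closed [set x | dot a x = 0].
Proof.
apply: (preimage_closed _ (@closed_eq R 0)).
by move=> x _; exact: continuous_dot.
Qed.

Lemma closed_dot_ge0 a : closed [set x | 0 <= dot a x].
Proof.
apply: (preimage_closed _ (@closed_ge R 0)).
by move=> x _; exact: continuous_dot.
Qed.

Lemma closed_sphere : closed sphere.
Proof.
apply: (preimage_closed _ (@closed_eq R 1)).
by move=> x _; exact: continuous_enorm.
Qed.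

Lemma sign_cone_closed L g : closed (sign_cone L g).
Proof.
have -> : sign_cone L g = \bigcap_(a in [set a | a \in L])
   ([set x | dot a g = 0 -> dot a x = 0] `&` [set x | 0 <= dot (dot a g *: a) x]).
  apply/seteqP; split=> x gx a aL; have := gx a aL.
    by move=> [? ?]; split => //=; rewrite dotZl.
  by move=> [? /=]; rewrite dotZl; split.
apply: closed_bigI => a aL; apply: closedI; last exact: closed_dot_ge0.
have [ag|ag] := eqVneq (dot a g) 0; last first.
  have -> : [set x | dot a g = 0 -> dot a x = 0] = setT; last exact: closedT.
  by apply/seteqP; split=> // x _ /= ag'; rewrite ag' eqxx in ag.
have -> : [set x | dot a g = 0 -> dot a x = 0] = [set x | dot a x = 0].
  by apply/seteqP; split=> x /=; [apply|].
exact: closed_dot0.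
Qed.

(** A point of the closed cone that is moved slightly in the direction of [x] and projected back to
    the sphere enters the open cell. *)
Lemma closure_cell L x : L != [::] -> off_hyperplanes L x ->
  closure (cell L x) = sign_cone L x `&` sphere.
Proof.
move=> L0 [x1 xL]; apply/seteqP; split.
  have cl : closed (sign_cone L x `&` sphere).
    by apply: closedI; [exact: sign_cone_closed|exact: closed_sphere].
  rewrite [X in _ `<=` X](closure_id _).1//; apply: closure_subset => y [y1 xy].
  by split=> // a aL; split; [move/eqP; rewrite (negbTE (xL a aL))|exact/ltW/xy].
move=> y [xy y1] B yB.
have := yB; rewrite -{1}(normz_id y1) => /(normz_perturb x (sphere_neq0 y1))[t t0 tB].
have yx a : a \in L -> 0 < dot a x * dot a (y + t *: x).
  move=> aL; rewrite dotDr dotZr mulrDr ltr_wpDl ?(xy a aL).2// mulrCA mulr_gt0//.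
  by rewrite -expr2 exprn_even_gt0//= xL.
have yx0 : y + t *: x != 0.
  have [a aL] : exists a, a \in L.
    by case: L L0 {xL xy yx} => // a L _; exists a; exact: mem_head.
  by apply: contraTneq (yx a aL) => ->; rewrite dot0r mulr0 ltxx.
exists (normz (y + t *: x)); split; last by apply: tB; rewrite gtr0_norm.
split; first exact: normz_sphere.
by move=> a aL; rewrite dot_normz mulrCA mulr_gt0 ?enormV_gt0// yx.
Qed.

End SphereTopology.

(** * Faces and skeleton of a tessellation in general position *)

Section TessellationFaces.
Variables (R : realType) (d : nat).
Local Notation V := 'rV[R]_d.+1.
Local Notation sphere := (@sphere R d).
Implicit Types (a g x y w : V) (L : seq V) (F K : spherical_body R d).

Lemma body_inj : injective (@body R d).
Proof. exact: val_inj. Qed.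

(** The default, the whole sphere, is returned only for the cone reduced to 0, which has no point on
    the sphere. *)
Definition sign_body L g : spherical_body R d :=
  insubd (point : raw_spherical_body R d) (sign_cone L g `&` sphere).

Lemma sign_bodyE L g : (0 < \dim (cap_hyperplanes fullv (zeros L g)))%N ->
  body (sign_body L g) = sign_cone L g `&` sphere.
Proof.
move=> dg; rewrite /body /raw_body val_insubd ifT//.
apply/mem_set; exists (sign_cone L g); split => //.
- exact: sign_cone_closed.
- exact: sign_coneD.
- move=> g0; suff : (cap_hyperplanes fullv (zeros L g) <= 0)%VS.
    by rewrite subv0 -dimv_eq0; case: (\dim _) dg.
  by apply: sign_cone_span; rewrite g0 => _ ->; exact: mem0v.
Qed.

Lemma convex_coneZ (C : set V) c x : convex_cone C -> 0 <= c -> C x -> C (c *: x).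
Proof.
by move=> [C0 CP] c0 Cx; have := CP _ 0 _ _ c0 (lexx 0) Cx C0; rewrite scaler0 addr0.
Qed.

(** Scaling recovers a convex cone from its unit vectors. This identifies the cone that
    [spherical_face] merely asserts to exist. *)
Lemma convex_cone_sphere_inj (A B : set V) : convex_cone A -> convex_cone B ->
  A `&` sphere = B `&` sphere -> A = B.
Proof.
suff sub (C D : set V) : convex_cone C -> convex_cone D ->
    C `&` sphere = D `&` sphere -> C `<=` D.
  by move=> cA cB AB; apply/seteqP; split; apply: sub.
move=> cC cD CD x Cx; have [->|x0] := eqVneq x 0; first exact: cD.1.
have : (C `&` sphere) (normz x).
  by split; [exact: convex_coneZ (ltW (enormV_gt0 x0)) Cx|exact: normz_sphere].
rewrite CD => -[/(convex_coneZ cD (enorm_ge0 x)) + _].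
by rewrite scalerA mulfV ?scale1r// enorm_eq0.
Qed.

Lemma polyhedral_convex_cone (C : set V) : polyhedral_cone C -> convex_cone C.
Proof.
move=> [m [a ->]]; split=> [i|b c x y b0 c0 xC yC i]; first by rewrite dot0r.
by rewrite dotDr !dotZr addr_ge0// mulr_ge0// ?xC ?yC.
Qed.

Lemma general_position_neq0 L a : general_position fullv L -> a \in L -> a != 0.
Proof.
move=> gp aL; apply: contraTneq isT => a0.
have := gp [:: a]; rewrite sub1seq => /(_ aL) /=; rewrite dimvf /= subn1.
suff -> : (fullv :&: hyperplane a)%VS = fullv.
  by rewrite dimvf /dim/= => e; exfalso; lia.
by apply: cap_hyperplane_id => x _; rewrite a0 dot0l.
Qed.

Lemma dim_zeros L g : general_position fullv L ->
  \dim (cap_hyperplanes fullv (zeros L g)) = (d.+1 - size (zeros L g))%N.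
Proof.
move=> gp; rewrite gp; last exact: filter_subseq.
by rewrite dimvf; congr (_ - _)%N; exact: mul1n.
Qed.

Variables (n k : nat) (H : 'I_n -> spherical_body R d) (u : 'I_n -> V).
Hypotheses (n_gt0 : (0 < n)%N) (kd : (k <= d)%N).
Hypothesis Hu : forall i, body (H i) = polar_sphere (u i).
Let L := [seq u i | i <- enum 'I_n].
Hypothesis gp : general_position fullv L.

Let L_neq0 : L != [::].
Proof. by rewrite -size_eq0 size_map size_enum_ord -lt0n. Qed.

Let mem_L a : a \in L -> exists i, a = u i.
Proof. by move=> /mapP[i _ ->]; exists i. Qed.

Let u_L i : u i \in L.
Proof. by apply: map_f; rewrite mem_enum. Qed.

Lemma off_hyperplanesE : sphere `\` \bigcup_i body (H i) = off_hyperplanes L.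
Proof.
apply/seteqP; split=> x [x1 xH]; split=> //.
  move=> a /mem_L[i ->]; apply/eqP => ux; apply: xH; exists i => //.
  by rewrite Hu.
move=> [i _]; rewrite Hu => -[_ ux].
by have := xH _ (u_L i); rewrite ux eqxx.
Qed.

(** In general position a cone of dimension k + 1 lies in exactly d - k of the hyperplanes. A face
    of a cell is a sign cone by [face_sign_cone]; conversely a point with d - k zeros is moved off
    all hyperplanes, which gives a cell having its cone as a face. *)
Lemma tess_facesP F : tess_faces H k F <->
  exists2 g, size (zeros L g) = (d - k)%N & body F = sign_cone L g `&` sphere.
Proof.
have dimk g : (\dim (cap_hyperplanes fullv (zeros L g)) == k.+1) =
              (size (zeros L g) == d - k)%N.
  by rewrite dim_zeros//; apply/eqP/eqP; lia.
split.
  move=> [P [x]]; rewrite off_hyperplanesE => xD.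
  rewrite component_cell// closure_cell// => bP [C [G [pC C0 PC [CG dG] FG]]].
  have x0 := xD.2.
  have CE : C = sign_cone L x.
    apply: convex_cone_sphere_inj; first exact: polyhedral_convex_cone.
      exact: sign_coneD.
    by rewrite -PC bP.
  rewrite CE in CG.
  have G0 : G !=set0.
    apply/set0P/eqP => G0.
    case: dG => U; rewrite G0 => dU /seteqP[_ sub].
    have [z zU z0] : exists2 z, z \in U & z != 0 by apply: dim_gt0_mem; rewrite dU.
    have /(_ 0%VS) := sub z zU; rewrite memv0 (negbTE z0) => h.
    by have : false by apply: h.
  have [g Gg GE] := face_sign_cone x0 CG G0.
  exists g; last by rewrite FG GE.
  by apply/eqP; rewrite -dimk; apply/eqP/sign_cone_lin_dim; rewrite -GE.
move=> [g gz FE].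
(* A direction transversal to all hyperplanes; a small move along it leads from [g] into an adjacent
   cell. *)
have [w _ wL] : exists2 w, w \in fullv & forall a, a \in L -> dot a w != 0.
  apply: avoid_hyperplanes => a aL; exists a; first exact: memvf.
  by rewrite dot_eq0; exact: general_position_neq0 gp aL.
have [t t0 tP] := signs_perturb L g w.
pose z := g + t *: w.
have zL a : a \in L -> dot a z != 0.
  move=> aL; have [ag|ag] := eqVneq (dot a g) 0.
    by rewrite dotDr dotZr ag add0r mulf_neq0 ?wL// gt_eqF.
  by rewrite -osgn_eq0 tP ?gtr0_norm// osgn_eq0.
have z0 : z != 0.
  have [a aL] : exists a, a \in L.
    by case: (L) L_neq0 => // a L' _; exists a; exact: mem_head.
  by apply: contraNneq (zL a aL) => ->; rewrite dot0r.
pose x := normz z.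
have zx : signs L z = signs L x.
  apply/eq_in_map => a aL; rewrite dot_normz /osgn mulf_eq0 invr_eq0 enorm_eq0.
  by rewrite (negbTE z0) pmulr_rgt0// enormV_gt0.
have xD : off_hyperplanes L x.
  split; first exact: normz_sphere.
  move=> a aL; rewrite dot_normz mulf_neq0 ?zL// gt_eqF//.
  exact: enormV_gt0.
have xg : sign_cone L x g.
  rewrite -(eq_sign_cone zx) => a aL; split=> [az|].
    by have := zL a aL; rewrite az eqxx.
  have [->|ag] := eqVneq (dot a g) 0; first by rewrite mulr0.
  have := tP t; rewrite gtr0_norm// => /(_ (lexx _) a aL ag) tg.
  have [h|h|h] := ltgtP (dot a g) 0; last by rewrite h mulr0.
    have /osgn_false h' := h; rewrite h' in tg; have /osgn_false := tg.
    by move=> /ltW h2; rewrite mulr_le0// ltW.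
  have /osgn_true h' := h; rewrite h' in tg; have /osgn_true := tg.
  by move=> /ltW h2; rewrite mulr_ge0// ltW.
have dx : (0 < \dim (cap_hyperplanes fullv (zeros L x)))%N.
  rewrite dim_zeros// subn_gt0; suff -> : zeros L x = [::] by [].
  by apply/eqP; rewrite -[_ == _]negbK -has_filter; apply/hasPn => a aL; exact: xD.2.
exists (sign_body L x).
  exists x; first by rewrite off_hyperplanesE.
  by rewrite off_hyperplanesE component_cell// closure_cell// sign_bodyE.
exists (sign_cone L x), (sign_cone L g); split=> //.
- exact: sign_cone_polyhedral.
- move=> C0; have := @sign_cone_refl _ _ L x; rewrite C0 => /= x0.
  by have := sphere_neq0 xD.1; rewrite x0 eqxx.
- exact: sign_bodyE.
- split; first exact: sign_cone_face xD.2 xg.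
  by apply/sign_cone_lin_dim/eqP; rewrite dimk gz.
Qed.

Lemma face_body g : size (zeros L g) = (d - k)%N ->
  body (sign_body L g) = sign_cone L g `&` sphere.
Proof. by move=> gz; rewrite sign_bodyE// dim_zeros// gz; lia. Qed.

Definition sign_witness (s : seq (option bool)) : V := xget 0 [set g | signs L g = s].

Definition faces_seq : seq (spherical_body R d) :=
  [seq sign_body L (sign_witness s) |
    s <- all_signs n & realized_with_zeros fullv L (d - k)%N s].

Lemma counting_seq (s : seq (spherical_body R d)) : uniq s ->
  counting [set F | F \in s] = (size s)%:R%:E :> \bar R.
Proof.
move=> us; have fs : finite_set [set F | F \in s] by exact: finite_seq.
rewrite /counting asboolT//; congr (_%:R%:E).
have := seq_fsetE tt s; have := size_seq_fset tt s; rewrite undup_id//.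
move: (seq_fset tt s) => A sA As.
have -> : [set F | F \in s] = [set` A] by apply/seteqP; split=> F /=; rewrite As.
by rewrite set_fsetK.
Qed.

Lemma sign_witnessP s : realized_with_zeros fullv L (d - k)%N s ->
  signs L (sign_witness s) = s /\ size (zeros L (sign_witness s)) = (d - k)%N.
Proof.
move=> /andP[/asboolP[x _ xs] /eqP sz].
have sw : signs L (sign_witness s) = s.
  exact: (@xgetPex _ 0 [set g | signs L g = s] (ex_intro _ x xs)).
by split=> //; rewrite -count_zeros sw.
Qed.

Lemma tess_facesE : tess_faces H k = [set F | F \in faces_seq].
Proof.
apply/seteqP; split=> F.
  move=> /tess_facesP[g gz FE]; apply/mapP; exists (signs L g).
    rewrite mem_filter mem_all_signs size_signs size_map size_enum_ord eqxx andbT.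
    rewrite /realized_with_zeros count_zeros gz eqxx andbT.
    by apply/asboolP; exists g; rewrite ?memvf.
  have [|ws wz] := @sign_witnessP (signs L g).
    rewrite /realized_with_zeros count_zeros gz eqxx andbT.
    by apply/asboolP; exists g; rewrite ?memvf.
  by apply: body_inj; rewrite FE face_body// (eq_sign_cone ws).
move=> /mapP[s]; rewrite mem_filter => /andP[/sign_witnessP[ws wz] _] ->.
by apply/tess_facesP; exists (sign_witness s) => //; exact: face_body.
Qed.

Lemma counting_faces :
  counting (tess_faces H k) = (num_faces n d.+1 (d - k)%N)%:R%:E :> \bar R.
Proof.
rewrite tess_facesE counting_seq; last first.
  rewrite map_inj_in_uniq; first by rewrite filter_uniq ?uniq_all_signs.
  move=> s s'; rewrite !mem_filter => /andP[/sign_witnessP[ws wz] _].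
  move=> /andP[/sign_witnessP[ws' wz'] _] /(congr1 (@body R d)).
  rewrite !face_body// => /convex_cone_sphere_inj E.
  rewrite -ws -ws'; apply: sign_cone_inj.
    by rewrite E; [exact: sign_cone_refl|exact: sign_coneD|exact: sign_coneD].
  by rewrite -E; [exact: sign_cone_refl|exact: sign_coneD|exact: sign_coneD].
rewrite size_map size_filter.
have := count_realized (d - k)%N gp; rewrite size_map size_enum_ord => ->.
by rewrite dimvf /dim/= mul1n.
Qed.

(** A relative interior point of a face has the signs of that face. In a second k-face containing
    it, the number of zeros is again d - k, which forces the same signs. *)
Lemma relint_face_unique F F' x : tess_faces H k F -> tess_faces H k F' ->
  sphere_relint (body F) x -> body F' x -> F = F'.
Proof.
move=> /tess_facesP[g gz FE] /tess_facesP[g' gz' FE'] [].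
rewrite FE FE' => -[gx x1] [e e0 rel] [g'x _].
have xn0 : x != 0 := sphere_neq0 x1.
(* If [a] vanished at [x] and not at [g], moving from [x] along [- g], which stays in the hull of
   the face, would reach the wrong side of [a]. *)
have gx0 a : a \in L -> dot a g != 0 -> dot a x != 0.
  move=> aL ag; apply: contraNneq (ag) => ax.
  have g0 : g != 0 by apply: contraNneq ag => ->; rewrite dot0r.
  have := nbhs_enorm x e0; rewrite -{1}(normz_id x1).
  move=> /(normz_perturb (- g) xn0)[t t0 tB].
  have xg : x + t *: - g != 0.
    apply: contraNneq ag => xg; have := congr1 (dot a) xg.
    rewrite dotDr dotZr dotNr ax add0r dot0r => /eqP.
    by rewrite mulf_eq0 gt_eqF//= oppr_eq0.
  have [//|||/(_ _ aL)[_]] := rel (normz (x + t *: - g)).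
  - exact: normz_sphere.
  - move=> U FU; have xU : x \in U by apply: FU.
    rewrite memvZ// memvD// memvZ// memvN.
    have /(memvZ (enorm g)) : normz g \in U.
      apply: FU; split; last exact: normz_sphere.
      apply: convex_coneZ (ltW (enormV_gt0 g0)) _; first exact: sign_coneD.
      exact: sign_cone_refl.
    by rewrite scalerA mulfV ?scale1r// enorm_eq0.
  - by have := tB t; rewrite gtr0_norm//; apply.
  rewrite dot_normz dotDr dotZr dotNr ax add0r mulrCA pmulr_rge0 ?enormV_gt0//.
  rewrite mulrN mulrN oppr_ge0 mulrCA pmulr_rle0// => ag2.
  by rewrite -sqrf_eq0 eq_le -expr2 in ag2 *; rewrite ag2 sqr_ge0.
have xg : sign_cone L x g.
  move=> a aL; have [_] := gx a aL; rewrite mulrC; split=> // /eqP ax.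
  by apply/eqP; apply: contraTT ax => ag; exact: gx0.
have sx : signs L g = signs L x by apply: sign_cone_inj.
have sx' : signs L g' = signs L x.
  apply: sign_cone_inj => // a aL; have [_ g2] := g'x a aL.
  rewrite mulrC; split=> // ax; apply: (eq_zeros g'x) => //.
  by rewrite gz' -gz -!count_zeros sx.
by apply: body_inj; rewrite FE FE' (eq_sign_cone sx) (eq_sign_cone sx').
Qed.

Local Notation muH := (@hausdorff_measure R d.+1 k).
Implicit Type m : n.-tuple bool.

(** Boolean masks index the intersections by the hyperplanes taking part, which gives a finite index
    set independent of the normals. *)
Definition vanishing_space m : {vspace V} := cap_hyperplanes fullv (mask m L).

Definition vanishing_mask x : n.-tuple bool := [tuple dot (u i) x == 0 | i < n].

Lemma tuple_mapE m : val m = [seq tnth m i | i <- enum 'I_n].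
Proof. by rewrite map_tnth_enum. Qed.

Lemma mask_vanishing_mask x : mask (vanishing_mask x) L = zeros L x.
Proof.
rewrite /zeros filter_mask; congr mask; rewrite tuple_mapE /L -map_comp.
by apply: eq_map => i; rewrite tnth_mktuple.
Qed.

Lemma count_vanishing_mask x : count id (vanishing_mask x) = size (zeros L x).
Proof.
rewrite -mask_vanishing_mask size_mask// size_tuple size_map.
by rewrite size_enum_ord.
Qed.

Lemma mask_enum m : mask m (enum 'I_n) = [seq i <- enum 'I_n | tnth m i].
Proof. by rewrite filter_mask -tuple_mapE. Qed.

Lemma count_enum m : count id m = count (tnth m) (enum 'I_n).
Proof. by rewrite [in LHS]tuple_mapE count_map. Qed.

Lemma mem_vanishing_space m x :
  x \in vanishing_space m <-> forall i, tnth m i -> dot (u i) x = 0.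
Proof.
rewrite mem_cap_hyperplanes memvf /= -map_mask all_map mask_enum all_filter.
split=> [/allP ui i mi|ui]; last first.
  by apply/allP => i _ /=; apply/implyP => mi; rewrite ui.
by have := ui i (mem_enum _ i); rewrite /= mi => /eqP.
Qed.

Lemma dim_vanishing_space m : \dim (vanishing_space m) = (d.+1 - count id m)%N.
Proof.
have sL : size m = size L by rewrite size_tuple size_map size_enum_ord.
rewrite /vanishing_space (gp (mask_subseq m L)) (size_mask sL).
by rewrite dimvf /dim/= mul1n.
Qed.

(** Each k-dimensional intersection is tiled by faces: a point of it, moved slightly within the
    intersection off all other hyperplanes, has exactly the prescribed zeros, and the original point
    lies in the closed cone of the moved one. *)
Lemma skelE : skel H k =
  \bigcup_(m in [set m : n.-tuple bool | count id m = (d - k)%N]) subsphere (vanishing_space m).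
Proof.
apply/seteqP; split=> x.
  move=> [F /tess_facesP[g gz FE]]; rewrite FE => -[gx x1].
  exists (vanishing_mask g); first by rewrite /= count_vanishing_mask.
  split=> //; apply/mem_vanishing_space => i; rewrite tnth_mktuple => /eqP.
  exact: (gx _ (u_L i)).1.
move=> [m /= mk [x1 /mem_vanishing_space xm]].
(* No further hyperplane contains the intersection, since by general position adding one to the mask
   lowers the dimension. *)
have [w wm wL] : exists2 w, w \in vanishing_space m &
    forall a, a \in [seq u i | i <- enum 'I_n & ~~ tnth m i] -> dot a w != 0.
  apply: avoid_hyperplanes => a /mapP[i]; rewrite mem_filter => /andP[mi _] ->{a}.
  pose m' := [tuple tnth m j || (j == i) | j < n].
  have mm' : vanishing_space m' = (vanishing_space m :&: hyperplane (u i))%VS.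
    apply/vspaceP => y; rewrite memv_cap mem_hyperplane; apply/idP/andP.
      move=> /mem_vanishing_space ym'; split.
        by apply/mem_vanishing_space => j mj; apply: ym'; rewrite tnth_mktuple mj.
      by apply/eqP/ym'; rewrite tnth_mktuple eqxx orbT.
    move=> [/mem_vanishing_space ym /eqP yi]; apply/mem_vanishing_space => j.
    by rewrite tnth_mktuple => /orP[/ym//|/eqP ->].
  have cm' : count id m' = (count id m).+1.
    rewrite !count_enum; under eq_count do rewrite tnth_mktuple.
    have := count_predUI (tnth m) (pred1 i) (enum 'I_n).
    rewrite (@eq_count _ (predI (tnth m) (pred1 i)) pred0); last first.
      by move=> j /=; case: eqP => [->|]; rewrite ?(negbTE mi) ?andbF.
    rewrite count_pred0 addn0 (count_uniq_mem _ (enum_uniq _)) mem_enum addn1.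
    by move=> <-; apply: eq_count.
  apply: contrapT => no.
  have /(congr1 (fun U => \dim U)) : vanishing_space m' = vanishing_space m.
    rewrite mm'; apply: cap_hyperplane_id => y ym.
    by apply/eqP; apply: contra_notT no => uy; exists y.
  by rewrite !dim_vanishing_space cm' mk; lia.
have [t t0 tP] := signs_perturb L x w.
pose g := x + t *: w.
have gL i : dot (u i) g = 0 <-> tnth m i.
  split=> [|mi]; last first.
    by move/mem_vanishing_space : wm => wm; rewrite dotDr dotZr xm// wm// mulr0 addr0.
  apply: contraPT => mi; apply/eqP.
  have uw : dot (u i) w != 0 by apply: wL; apply: map_f; rewrite mem_filter mi mem_enum.
  have [ux|ux] := eqVneq (dot (u i) x) 0.
    by rewrite dotDr dotZr ux add0r mulf_neq0// gt_eqF.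
  by rewrite -osgn_eq0 tP ?gtr0_norm// osgn_eq0.
have gz : size (zeros L g) = (d - k)%N.
  rewrite -count_vanishing_mask -mk; congr (count _ (tval _)).
  apply/eq_from_tnth => i; rewrite tnth_mktuple; apply/eqP/idP; exact: (gL i).1 || exact: (gL i).2.
exists (sign_body L g); last first.
  rewrite face_body//; split=> // a /mem_L[i ->]; split=> [/gL/xm//|].
  have [ux|ux] := eqVneq (dot (u i) x) 0; first by rewrite ux mulr0.
  have := tP t; rewrite gtr0_norm// => /(_ (lexx _) _ (u_L i) ux) tg.
  have [h|h|h] := ltgtP (dot (u i) x) 0; last by rewrite h mulr0.
    have /osgn_false h' := h; rewrite h' in tg; have /osgn_false := tg.
    by move=> /ltW h2; rewrite mulr_le0// ltW.
  have /osgn_true h' := h; rewrite h' in tg; have /osgn_true := tg.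
  by move=> /ltW h2; rewrite mulr_ge0// ltW.
by apply/tess_facesP; exists g => //; exact: face_body.
Qed.

Lemma measurable_vanishing_mask m :
  measurable [set x : borel_rV R d.+1 | vanishing_mask x = m].
Proof.
have -> : [set x : borel_rV R d.+1 | vanishing_mask x = m] =
    \bigcap_(i in setT) [set x : borel_rV R d.+1 | (dot (u i) x == 0) = tnth m i].
  apply/seteqP; split=> x /= => [<- i _|xm]; first by rewrite /= tnth_mktuple.
  by apply: eq_from_tnth => i; rewrite tnth_mktuple; exact: xm.
apply: fin_bigcap_measurable => // i _; case: (tnth m i).
  have -> : [set x : borel_rV R d.+1 | (dot (u i) x == 0) = true] =
      [set x : borel_rV R d.+1 | dot (u i) x = 0].
    by apply/seteqP; split=> x /= /eqP.
  exact: measurable_dot0.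
have -> : [set x : borel_rV R d.+1 | (dot (u i) x == 0) = false] =
    ~` [set x : borel_rV R d.+1 | dot (u i) x = 0].
  by apply/seteqP; split=> x /= => [/negbT/eqP|/eqP/negbTE].
by apply: measurableC; exact: measurable_dot0.
Qed.

(** Since d - k is at most n, some d - k of the hyperspheres can be chosen, and their intersection
    lies in the skeleton. Finite volume of the skeleton thereby passes to every great
    k-subsphere. *)
Lemma hausdorff_subsphere_le_skel (U : {vspace V}) : (d - k <= n)%N ->
  \dim U = k.+1 -> (muH (subsphere U) <= muH (skel H k))%E.
Proof.
move=> dkn dU; have [m mk] : exists m, count id m = (d - k)%N.
  have sz : size (nseq (d - k) true ++ nseq (n - (d - k)) false) == n.
    by rewrite size_cat !size_nseq subnKC.
  by exists (Tuple sz); rewrite /= count_cat !count_nseq /= mul1n mul0n addn0.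
rewrite (@hausdorff_subsphere _ _ _ _ (vanishing_space m)); last first.
  by rewrite dU dim_vanishing_space mk; lia.
by apply: le_hausdorff_measure; rewrite skelE => x xm; exists m.
Qed.

(** Off the points that lie on more than d - k hyperspheres, the great subspheres of the skeleton
    become disjoint Borel pieces, given by the exact vanishing mask. The right-hand side does not
    involve the position of the hyperspheres. *)
Lemma hausdorff_skel (U : {vspace V}) :
  \dim U = k.+1 -> (muH (subsphere U) < +oo)%E ->
  muH (skel H k) = (\sum_(m \in [set m : n.-tuple bool | count id m = (d - k)%N])
                      muH (subsphere U))%E.
Proof.
move=> dU Ufin.
(* Finitely many great subspheres of dimension less than k, hence a null set. *)
pose N := \bigcup_(m in [set m : n.-tuple bool | (d - k < count id m)%N])
            subsphere (vanishing_space m).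
have N0 : muH N = 0%E.
  apply/eqP; rewrite eq_le hausdorff_measure_ge0 andbT.
  pose f i := if (unpickle i : option (n.-tuple bool)) is Some m then
    if (d - k < count id m)%N then subsphere (vanishing_space m)
    else set0 else set0.
  apply: (@le_trans _ _ (muH (\bigcup_i f i))).
    apply: le_hausdorff_measure => x [m /= mk xm].
    by exists (pickle m) => //; rewrite /f pickleK mk.
  rewrite (le_trans (hausdorff_measure_sigma_subadditive _ _))//.
  rewrite eseries0// => i _ _; rewrite /f; case: (unpickle i) => [m|]; last first.
    exact: hausdorff_measure0.
  case: ifPn => mk; last exact: hausdorff_measure0.
  apply: (hausdorff_subsphere_eq0 dU Ufin); rewrite dim_vanishing_space.
  lia.
pose nu := hausdorff_on k sphere.
pose B m : set (borel_rV R d.+1) := [set x | vanishing_mask x = m].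
(* A point of the m-th subsphere lies on the hyperspheres of [m] and either on no others or on
   strictly more. *)
have BN m : subsphere (vanishing_space m) `<=`
    (sphere `&` B m) `|` \bigcup_(m' in [set m' : n.-tuple bool |
       (count id m < count id m')%N]) subsphere (vanishing_space m').
  move=> x [x1 /mem_vanishing_space xm].
  have [xB|xB] := eqVneq (vanishing_mask x) m; first by left.
  right; exists (vanishing_mask x); last first.
    split=> //; apply/mem_vanishing_space => i.
    by rewrite tnth_mktuple => /eqP.
  change (count id m < count id (vanishing_mask x))%N.
  rewrite !count_enum -!size_filter; apply: contra_neqT xB.
  rewrite -leqNgt => le; apply: eq_from_tnth => i.
  have sub : [seq i <- enum 'I_n | tnth m i] =
      [seq i <- [seq i <- enum 'I_n | tnth (vanishing_mask x) i] | tnth m i].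
    rewrite -filter_predI; apply: eq_filter => j /=.
    case mj : (tnth m j) => //=; rewrite tnth_mktuple; apply/esym/eqP.
    exact: xm.
  have al : all (tnth m) [seq i <- enum 'I_n | tnth (vanishing_mask x) i].
    by rewrite all_count eqn_leq count_size/= -[X in (_ <= X)%N]size_filter -sub.
  case mi : (tnth m i); first by rewrite tnth_mktuple; apply/eqP/xm.
  apply/negP => xi; move: (allP al i); rewrite mem_filter xi mem_enum => /(_ isT).
  by rewrite mi.
have nuB m : count id m = (d - k)%N -> nu (B m) = muH (subsphere U).
  move=> mk; rewrite (@hausdorff_subsphere _ _ _ _ (vanishing_space m)); last first.
    by rewrite dU dim_vanishing_space mk; lia.
  apply/eqP; rewrite eq_le; apply/andP; split.
    apply: le_hausdorff_measure => x [x1 xm]; split=> //.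
    by apply/mem_vanishing_space => i; rewrite -xm tnth_mktuple => /eqP.
  rewrite -[leRHS]adde0 -N0; apply: le_trans (outer_measureU2 muH _ _).
  by apply: le_hausdorff_measure => x /BN; rewrite mk.
have -> : muH (skel H k) = nu (\bigcup_(m in [set m : n.-tuple bool |
    count id m = (d - k)%N]) B m).
  rewrite skelE; apply/eqP; rewrite eq_le; apply/andP; split.
    rewrite -[leRHS]adde0 -N0; apply: le_trans (outer_measureU2 muH _ _).
    apply: le_hausdorff_measure => x [m /= mk /BN]; rewrite mk => -[[x1 xm]|]; last by right.
    by left; split=> //; exists m.
  apply: le_hausdorff_measure => x [x1 [m /= mk xm]]; exists m => //; split=> //.
  by apply/mem_vanishing_space => i; rewrite -xm tnth_mktuple => /eqP.
rewrite /nu (measure_fin_bigcup (hausdorff_on k sphere)); last 3 first.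
- exact: finite_finset.
- by move=> m m' _ _ [x [<- <-]].
- by move=> m _; exact: measurable_vanishing_mask.
by apply: eq_fsbigr => m /set_mem /nuB.
Qed.

End TessellationFaces.

(** * Almost sure general position *)

Section HittingSets.
Variables (R : realType) (d : nat).
Local Notation V := 'rV[R]_d.+1.
Local Notation sphere := (@sphere R d).
Implicit Types (q x y : V) (K : spherical_body R d).

Lemma body_sphere K : body K `<=` sphere.
Proof.
have /set_mem[C [_ _ _ CE]] := valP K; rewrite /body /raw_body CE.
exact: subIsetr.
Qed.

Lemma body_closed K : closed (body K).
Proof.
have /set_mem[C [cC _ _ CE]] := valP K; rewrite /body /raw_body CE.
by apply: closedI => //; exact: closed_sphere.
Qed.

Lemma body_nonempty K : body K !=set0.
Proof.
have /set_mem[C [_ ccC C0 CE]] := valP K; rewrite /body /raw_body CE.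
have [x [Cx x0]] : exists x, C x /\ x != 0.
  apply: contrapT => no; apply: C0; apply/seteqP; split=> x; last by move=> ->; exact: ccC.1.
  by move=> Cx; apply/eqP; apply: contra_notT no => x0; exists x.
exists (normz x); split; last exact: normz_sphere.
exact: convex_coneZ (ltW (enormV_gt0 x0)) Cx.
Qed.

Lemma dot_sphere_bounds x y : sphere x -> sphere y -> -1 <= dot x y <= 1.
Proof.
rewrite /sphere/= => x1 y1; have xx : dot x x = 1 by rewrite -sqr_enorm x1 expr1n.
have yy : dot y y = 1 by rewrite -sqr_enorm y1 expr1n.
have := dot_ge0 (x - y); have := dot_ge0 (x + y).
rewrite !(dotDl, dotDr, dotNl, dotNr) xx yy (dotC y x) => h1 h2.
by apply/andP; split; lra.
Qed.

Lemma enormB_sphere x y : sphere x -> sphere y ->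
  enorm (x - y) ^+ 2 = 2 - 2 * dot x y.
Proof.
rewrite /sphere/= => x1 y1; have xx : dot x x = 1 by rewrite -sqr_enorm x1 expr1n.
have yy : dot y y = 1 by rewrite -sqr_enorm y1 expr1n.
by rewrite sqr_enorm !(dotDl, dotDr, dotNl, dotNr) xx yy (dotC y x); ring.
Qed.

Lemma sphere_dist_enorm (r : R) : 0 < r -> exists2 e, 0 < e &
  forall x y, sphere x -> sphere y -> sphere_dist x y < e -> enorm (x - y) < r.
Proof.
move=> r0; pose s := Num.min r 1.
have s0 : 0 < s by rewrite lt_min r0 ltr01.
have s1 : s <= 1 by rewrite ge_min lexx orbT.
have sr : s <= r by rewrite ge_min lexx.
have s2 : s ^+ 2 <= 1 by rewrite exprn_ile1// ltW.
have s20 : 0 < s ^+ 2 by rewrite exprn_gt0.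
(* The cosine of the angle whose chord has length [s]; capping [s] at 1 keeps [c] in the domain of
   [acos]. *)
pose c := 1 - s ^+ 2 / 2.
have cb : -1 <= c < 1 by rewrite /c; apply/andP; split; lra.
have cb' : -1 <= c <= 1 by case/andP: cb => -> /ltW.
exists (acos c); first exact: acos_gt0.
move=> x y x1 y1 xy; have xyb := dot_sphere_bounds x1 y1.
have cxy : c < dot x y.
  rewrite -(acosK (x := c)) ?in_itv// -(acosK (x := dot x y)) ?in_itv//.
  by rewrite ltr_cos ?in_itv/= ?acos_ge0 ?acos_lepi.
rewrite (lt_le_trans _ sr)// -(ltr_pXn2r (n := 2)) ?nnegrE ?enorm_ge0 ?ltW//.
by rewrite enormB_sphere// /c in cxy *; lra.
Qed.

(** The real [sup] and [inf] are meaningful because bodies are nonempty and spherical distances lie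
    between 0 and [pi]. *)
Lemma hausdorff_dist_near (K K' : spherical_body R d) x (e : R) :
  spherical_hausdorff_dist K K' < e -> body K x ->
  exists2 y, body K' y & sphere_dist x y < e.
Proof.
move=> KK' Kx; have [y0 K'y0] := body_nonempty K'.
have dist_ge0 y z : body K y -> body K' z -> 0 <= sphere_dist y z.
  by move=> /body_sphere y1 /body_sphere z1; apply/acos_ge0/dot_sphere_bounds.
have lb y : body K y -> has_lbound [set sphere_dist y z | z in body K'].
  by move=> Ky; exists 0 => _ [z K'z <-]; exact: dist_ge0.
have ub : has_ubound [set inf [set sphere_dist x y | y in body K'] | x in body K].
  exists pi => _ [y Ky <-]; apply: (@le_trans _ _ (sphere_dist y y0)).
    by apply: (ge_inf (lb _ Ky)); exists y0.
  by apply/acos_lepi/dot_sphere_bounds; [exact: body_sphere Ky|exact: body_sphere K'y0].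
have : inf [set sphere_dist x y | y in body K'] < e.
  apply: le_lt_trans KK'; rewrite le_max; apply/orP; left.
  by apply: (ub_le_sup ub); exists x.
move=> /inf_lt[|_ [y K'y <-] xye]; last by exists y.
by exists (sphere_dist x y0); exists y0.
Qed.

Definition hits q (r : R) : set (spherical_body R d) := [set K | (body K `&` ball q r) !=set0].

(** Hitting an open ball is an open condition: a body near [K] has a point near any given point of
    [K]. *)
Lemma measurable_hits q (r : R) : measurable (hits q r).
Proof.
apply: sub_sigma_algebra => K [x [Kx]]; rewrite -ball_normE/= => qx.
have rq : 0 < r - `|q - x| by rewrite subr_gt0.
have [e e0 eP] := sphere_dist_enorm rq.
exists e => // K' KK'; have [y K'y xy] := hausdorff_dist_near KK' Kx.
exists y; split=> //; rewrite -ball_normE/= (le_lt_trans (ler_distD x _ _))//.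
rewrite -ltrBrDl (le_lt_trans (norm_le_enorm _))//.
by apply: eP => //; [exact: body_sphere Kx|exact: body_sphere K'y].
Qed.

End HittingSets.

(** * From containments of great subspheres to general position *)

Section NormalVectors.
Variables (R : realType) (d : nat).
Local Notation V := 'rV[R]_d.+1.

Lemma great_hypersphere_normal (A : set V) : (0 < d)%N -> great_subsphere d.-1 A ->
  exists u : V, A = polar_sphere u.
Proof.
move=> d0 [U dU ->]; rewrite prednK// in dU.
have [E _ EU] := orthonormal_rows dU.
have : kermx E^T != 0.
  rewrite -mxrank_eq0 mxrank_ker subn_eq0 -ltnNge ltnS.
  exact: rank_leq_col.
case/rowV0Pn => u /sub_kermxP uE u0; exists u.
suff -> : U = hyperplane u.
  by apply/seteqP; split=> x [x1 /=]; rewrite mem_hyperplane => /eqP.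
have sU : (U <= hyperplane u)%VS.
  apply/subvP => x /EU[c ->]; rewrite mem_hyperplane dotE trmx_mul mulmxA uE mul0mx.
  by rewrite mxE.
apply/eqP; rewrite eqEdim sU /= dU.
have := @dim_cap_hyperplane _ _ u fullv u (memvf _).
by rewrite capfv dot_eq0 dimvf /dim/= => /(_ u0); lia.
Qed.

(** Each new hyperplane lowers the dimension unless it contains the intersection of the previous
    ones; beyond d of them that intersection is already 0. The hypothesis speaks of point sets
    because the normals are chosen separately for each outcome, with no measurability. *)
Lemma general_position_normals n (u : 'I_n -> V) :
  (forall (J : {set 'I_n}) i, i \notin J -> (#|J| <= d)%N ->
     ~ (@sphere R d `&` \bigcap_(j in [set j | j \in J]) polar_sphere (u j)
          `<=` polar_sphere (u i))) ->
  general_position fullv [seq u i | i <- enum 'I_n].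
Proof.
move=> uJ I /subseqP[m sm ->]; rewrite -map_mask size_map.
have : uniq (mask m (enum 'I_n)) by rewrite mask_uniq// enum_uniq.
have -> : \dim (fullv : {vspace V}) = d.+1 by rewrite dimvf /dim/= mul1n.
elim: (mask _ _) => [_|i s IH /=/andP[si /IH dims]].
  by rewrite /= dimvf /dim/= mul1n subn0.
rewrite /=; set W := cap_hyperplanes _ _ in dims *.
have [sd|ds] := leqP (size s) d; last first.
  have := dimvS (capvSl W (hyperplane (u i))); rewrite dims.
  have /eqP -> : (d.+1 - size s)%N == 0%N by rewrite subn_eq0.
  have /eqP -> : (d.+1 - (size s).+1)%N == 0%N by rewrite subn_eq0 ltnW.
  by rewrite leqn0 => /eqP.
have [y yW uy] : exists2 y, y \in W & dot (u i) y != 0.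
  apply: contrapT => no; have := uJ [set j in s] i; rewrite inE cardsE => /(_ si); apply.
    by rewrite (leq_trans (card_size _)).
  move=> y [y1 ys]; split=> //=; apply/eqP; apply: contra_notT no => uy; exists y => //.
  rewrite mem_cap_hyperplanes memvf all_map; apply/allP => j js /=.
  by apply/eqP; have [] := ys j; rewrite /= ?inE.
by have := dim_cap_hyperplane yW uy; rewrite dims subnS => ->.
Qed.

End NormalVectors.

(** * Intersections of bodies through countably many hitting events *)

Section MeetingBodies.
Variables (R : realType) (d : nat).
Local Notation V := 'rV[R]_d.+1.
Local Notation sphere := (@sphere R d).
Implicit Types (q x y : V) (K : spherical_body R d).

Definition inv_succ (m : nat) : R := m.+1%:R^-1.

Lemma inv_succ_gt0 m : 0 < inv_succ m. Proof. by rewrite invr_gt0. Qed.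

Lemma inv_succ_le m m' : (m <= m')%N -> inv_succ m' <= inv_succ m.
Proof. by move=> mm'; rewrite lef_pV2 ?posrE// ler_nat. Qed.

Lemma inv_succ_lt (r : R) : 0 < r -> exists m, inv_succ m < r.
Proof. by move=> r0; have [m] := ltr_add_invr r0; rewrite add0r; exists m. Qed.

Lemma body_hitsP K x : body K x <-> forall m, hits x (inv_succ m) K.
Proof.
split=> [Kx m|Kx].
  by exists x; split=> //; apply: ballxx; exact: inv_succ_gt0.
rewrite (closure_id (body K)).1; last exact: body_closed.
move=> B /nbhs_ballP[r /= r0 rB]; have [m mr] := inv_succ_lt r0.
have [y [Ky xy]] := Kx m; exists y; split=> //; apply: rB.
exact: le_ball (ltW mr) _ xy.
Qed.

Lemma measurable_contains x : measurable [set K | body K x].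
Proof.
have -> : [set K | body K x] = \bigcap_m hits x (inv_succ m).
  apply/seteqP; split=> K Kx; first by move=> m _; move/body_hitsP : Kx; apply.
  by apply/body_hitsP => m; exact: Kx.
by apply: bigcapT_measurable => m; exact: measurable_hits.
Qed.

(** The factor [sphere] gives the empty [J] the whole sphere as its set of common points. *)
Definition common_points n (K : 'I_n -> spherical_body R d) (J : {set 'I_n}) : set V :=
  sphere `&` \bigcap_(j in [set j | j \in J]) body (K j).

(** By compactness of the sphere, approximate common points at all scales accumulate at a true one.
    This writes the event by countable operations on hitting events. *)
Lemma common_points_meetP n (K : 'I_n -> spherical_body R d) J (Q : set V) : closed Q ->
  (common_points K J `&` Q) !=set0 <->
  forall m, exists i, (ball (rat_point R d.+1 i) (inv_succ m) `&` (sphere `&` Q)) !=set0 /\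
    forall j, j \in J -> hits (rat_point R d.+1 i) (inv_succ m) (K j).
Proof.
move=> cQ; split.
  move=> [y [[y1 yK] Qy]] m; have [i yi] := rat_point_dense y (inv_succ_gt0 m).
  have iy : ball (rat_point R d.+1 i) (inv_succ m) y by rewrite -ball_normE/= distrC.
  by exists i; split=> [|j jJ]; [exists y|exists y; split=> //; exact: yK].
move=> /choice[i iP].
have /choice[y yP] : forall m, exists y : V,
    ball (rat_point R d.+1 (i m)) (inv_succ m) y /\ (sphere `&` Q) y.
  by move=> m; have [[y [? ?]] _] := iP m; exists y.
have cSQ : compact (sphere `&` Q).
  apply: bounded_closed_compact; last by apply: closedI => //; exact: closed_sphere.
  exists 1; split; first exact: num_real.
  move=> r r1 x [x1 _]; apply: le_trans (norm_le_enorm x) _.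
  by rewrite x1 ltW.
have Fy : (y @ \oo) (sphere `&` Q) by exists 0 => // m _; exact: (yP m).2.
have [z [[z1 Qz] zc]] := cSQ (y @ \oo) _ Fy.
exists z; split=> //; split=> // j jJ /=.
rewrite (closure_id (body (K j))).1; last exact: body_closed.
move=> B /nbhs_ballP[r /= r0 rB].
(* The budget is r / 2 from [z] to [y m], r / 4 from there to the rational centre, and r / 4 on to a
   point of the body. *)
have r4 : 0 < r / 4 by rewrite divr_gt0.
have [N Nr] := inv_succ_lt r4.
have [||_ [[m Nm <-] zm]] := zc [set y m | m in [set m | (N <= m)%N]] (ball z (r / 2)).
- by exists N => // m Nm; exists m.
- by apply: nbhsx_ballx; rewrite divr_gt0.
have [w [Kw qw]] := (iP m).2 j jJ; exists w; split=> //; apply: rB.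
have qy := (yP m).1; have mr : inv_succ m < r / 4 by apply: le_lt_trans Nr; exact: inv_succ_le.
move: qw qy zm; rewrite -!ball_normE /= => qw qy zm.
rewrite (le_lt_trans (ler_distD (y m) _ _))// (splitr r) ltrD//.
rewrite (le_lt_trans (ler_distD (rat_point R d.+1 (i m)) _ _))//.
rewrite distrC; have -> : r / 2 = r / 4 + r / 4 by field.
by rewrite ltrD// (lt_trans _ mr).
Qed.

End MeetingBodies.

(** * Independence and general position *)

Section AlmostSureGeneralPosition.
Variables (R : realType) (d n : nat).
Local Notation V := 'rV[R]_d.+1.
Local Notation sphere := (@sphere R d).
Variables (kappa : probability (spherical_body R d) R).
Variables (dOm : measure_display) (Om : measurableType dOm) (P : probability Om R).
Variable S : 'I_n -> {RV P >-> spherical_body R d}.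
Hypothesis d_gt0 : (0 < d)%N.
Hypothesis hkappa : nondegenerate_directional_distribution kappa.
Hypothesis hS : iid_great_hyperspheres kappa S.
Local Open Scope ereal_scope.

(** Duality: the great hypersphere with normal [u] contains [x] exactly when [u] lies on the great
    hypersphere with normal [x], a null set by non-degeneracy. *)
Lemma kappa_contains (x : V) : sphere x -> kappa [set K | body K x] = 0.
Proof.
move=> x1; have [kappa0 [k1 _ k0 kE]] := hkappa.
have mS : measurable (sphere : set (borel_rV R d.+1)).
  rewrite -[X in measurable X]setCK; apply: measurableC; apply: sub_sigma_algebra.
  exact/closed_openC/closed_sphere.
rewrite kE; last exact: measurable_contains.
have -> : pushforward kappa0 (@great_hypersphere R d) [set K | body K x] =
    kappa0 [set u : borel_rV R d.+1 | dot x u = 0%R].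
  congr (kappa0 _); apply/seteqP; split=> u /=; rewrite /body /raw_body
    val_insubd polar_sphere_spherical_body// /polar_sphere/= dotC.
    by case.
  by move=> ux; split.
apply/eqP; rewrite eq_le measure_ge0 andbT.
have -> : [set u : borel_rV R d.+1 | dot x u = 0%R] =
    [set u : borel_rV R d.+1 | dot x u = 0%R] `&` sphere `|`
    [set u : borel_rV R d.+1 | dot x u = 0%R] `&` ~` sphere.
  by rewrite -setIUr setUCr setIT.
have m0 := @measurable_dot0 R d x.
rewrite measureU; last 3 first.
- exact: measurableI.
- by apply: measurableI => //; exact: measurableC.
- by rewrite setIACA setICr setI0.
rewrite [X in X + _](_ : _ = 0); last first.
  apply: k0; exists (hyperplane x).
    have := @dim_cap_hyperplane _ _ x fullv x (memvf _).
    rewrite capfv dot_eq0 dimvf /dim/= mul1n => /(_ (sphere_neq0 x1)) [<-].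
    by rewrite prednK.
  rewrite setIC; congr (_ `&` _); apply/seteqP; split=> u /=; rewrite mem_hyperplane.
    by move=> ->.
  by move/eqP.
rewrite add0e; apply: (@le_trans _ _ (kappa0 (~` sphere))).
  apply: le_measure; rewrite ?inE; last exact: subIsetr.
    by apply: measurableI => //; exact: measurableC.
  exact: measurableC.
rewrite probability_setC// k1; by rewrite subee.
Qed.

Lemma kappa_hits_small (x : V) (e : R) : sphere x -> (0 < e)%R ->
  exists m, kappa (hits x (inv_succ R m)) <= e%:E.
Proof.
move=> x1 e0.
have : kappa (hits x (inv_succ R m)) @[m --> \oo] --> kappa (\bigcap_m hits x (inv_succ R m)).
  apply: nonincreasing_cvg_mu.
  - by rewrite (le_lt_trans (probability_le1 _ _)) ?ltry//; exact: measurable_hits.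
  - by move=> m; exact: measurable_hits.
  - by apply: bigcapT_measurable => m; exact: measurable_hits.
  - move=> m m' mm'; apply/subsetPset => K [y [Ky xy]]; exists y; split=> //.
    exact: le_ball (inv_succ_le R mm') _ xy.
have -> : \bigcap_m hits x (inv_succ R m) = [set K | body K x].
  by apply/seteqP; split=> K Kx;
    [apply/body_hitsP => m; exact: Kx|move=> m _; move/body_hitsP : Kx; apply].
rewrite kappa_contains// => /(_ [set y | y < e%:E]) [|m _ /(_ m (leqnn m)) /ltW km].
  by apply: open_nbhs_nbhs; split; [exact: open_ereal_lt_ereal|rewrite /= lte_fin].
by exists m.
Qed.

Implicit Types (J : {set 'I_n}) (i : 'I_n).

(** A pi-system generating the joint sigma-field of the hyperspheres with index in [J]. *)
Definition rectangles J : set (set Om) :=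
  [set E | exists2 B : 'I_n -> set (spherical_body R d), forall i, measurable (B i) &
     E = \bigcap_(j in [set j | j \in J]) (S j @^-1` B j)].

Let S_measurable i (B : set (spherical_body R d)) : measurable B -> measurable (S i @^-1` B).
Proof. by move=> mB; rewrite -[X in measurable X]setTI; exact: measurable_funPT. Qed.

Lemma rectangles_measurable J E : <<s rectangles J >> E -> measurable E.
Proof.
move=> sE; apply: sE; split; first exact: sigma_algebra_measurable.
move=> _ [B mB ->]; apply: fin_bigcap_measurable; first exact: finite_finset.
by move=> j _; exact: S_measurable.
Qed.

(** The events that factor form a lambda-system containing the rectangles, where factorization is
    mutual independence for [i |: J]. *)
Lemma independent_sigma J i E B : i \notin J -> <<s rectangles J >> E ->
  measurable B -> P (E `&` S i @^-1` B) = P E * kappa B.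
Proof.
move=> iJ sE mB; have [_ lawS indep] := hS.
have PS : P (S i @^-1` B) = kappa B by rewrite -(lawS i B mB).
pose H := [set E | measurable E /\ P (E `&` S i @^-1` B) = P E * kappa B].
have mSB := S_measurable i mB.
suff : <<s rectangles J >> `<=` H by move=> /(_ E sE)[].
apply: lambda_system_subset => //.
- move=> _ _ [B1 mB1 ->] [B2 mB2 ->].
  exists (fun j => B1 j `&` B2 j); first by move=> j; exact: measurableI.
  by rewrite -bigcapI.
- split=> //.
  + by split=> //; rewrite setTI PS probability_setT mul1e.
  + move=> X Y YX [mX PX] [mY PY]; split; first exact: measurableD.
    have finP (Z : set Om) : measurable Z -> P Z < +oo.
      by move=> mZ; rewrite (le_lt_trans (probability_le1 _ _)) ?ltry.
    have mXS : measurable (X `&` S i @^-1` B) by exact: measurableI.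
    have -> : (X `\` Y) `&` S i @^-1` B = (X `&` S i @^-1` B) `\` Y.
      by rewrite !setDE setIAC.
    rewrite measureD//; last exact: finP.
    rewrite measureD//; last exact: finP.
    rewrite [T in T - _](_ : _ = P X * kappa B); last exact: PX.
    rewrite [T in _ - T](_ : _ = P Y * kappa B); last by rewrite setIAC (setIidr YX).
    rewrite [T in _ = (_ - T) * _](_ : _ = P Y); last by rewrite (setIidr YX).
    rewrite muleBl//; first exact: fin_num_measure.
    by apply: fin_num_adde_defr; rewrite fin_num_measure.
  + move=> F ndF HF; have mF m : measurable (F m) := (HF m).1.
    split; first exact: bigcupT_measurable.
    have ndFB : nondecreasing_seq (fun m => F m `&` S i @^-1` B).
      by move=> m m' mm'; apply/subsetPset; apply: setSI; have /subsetPset := ndF _ _ mm'.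
    rewrite setI_bigcupl.
    have cvg1 := @nondecreasing_cvg_mu _ _ _ P _ (fun m => measurableI _ _ (mF m) mSB)
      (bigcupT_measurable _ (fun m => measurableI _ _ (mF m) mSB)) ndFB.
    have cvg2 : (P \o F) m * kappa B @[m --> \oo] --> P (\bigcup_m F m) * kappa B.
      apply: cvgeM; last exact: cvg_cst.
        by apply: mule_def_fin; rewrite fin_num_measure//; exact: bigcupT_measurable.
      by apply: nondecreasing_cvg_mu => //; exact: bigcupT_measurable.
    have e : P \o (fun m => F m `&` S i @^-1` B) = (fun m => (P \o F) m * kappa B).
      by apply/funext => m; exact: (HF m).2.
    rewrite e in cvg1.
    by rewrite -[LHS](cvg_lim _ cvg1)// -[RHS](cvg_lim _ cvg2).
- move=> _ [B1 mB1 ->]; split.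
    by apply: (@rectangles_measurable J); apply: sub_sigma_algebra; exists B1.
  pose B2 j := if j == i then B else B1 j.
  have mB2 j : measurable (B2 j) by rewrite /B2; case: ifP.
  have := indep (i |: J) B2 mB2.
  rewrite big_setU1//= => iP.
  have -> : \bigcap_(j in [set j | j \in J]) (S j @^-1` B1 j) `&` S i @^-1` B =
    \bigcap_(j in [set j | j \in i |: J]) (S j @^-1` B2 j).
    apply/seteqP; split=> om.
      move=> [omJ omi] j /=; rewrite in_setU1 /B2; case: eqP => [->//|_ /= jJ].
      exact: omJ.
    move=> omi; split=> [j jJ|].
      have := omi j; rewrite /= in_setU1 jJ orbT /B2 => /(_ isT).
      by case: eqP => // ji; move: iJ; rewrite -ji jJ.
    by have := omi i; rewrite /= in_setU1 eqxx /B2 eqxx; apply.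
  rewrite iP /B2 eqxx PS muleC indep//; congr (_ * _).
  apply: eq_bigr => j jJ; case: eqP => // ji; by rewrite ji (negbTE iJ) in jJ.
Qed.

Lemma common_points_event_sigma J (Q : set V) : closed Q ->
  <<s rectangles J >> [set om | (common_points (fun j => S j om) J `&` Q) !=set0].
Proof.
move=> cQ; pose E m (i : nat) : set (g_sigma_algebraType (rectangles J)) :=
  if `[< (ball (rat_point R d.+1 i) (inv_succ R m) `&` (sphere `&` Q)) !=set0 >] then
    \bigcap_(j in [set j | j \in J]) (S j @^-1` hits (rat_point R d.+1 i) (inv_succ R m))
  else set0.
have -> : [set om | (common_points (fun j => S j om) J `&` Q) !=set0] =
    \bigcap_m \bigcup_(i : nat) E m i.
  apply/seteqP; split=> om.
    move=> /common_points_meetP => /(_ cQ) h m _; have [i [b hj]] := h m.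
    by exists i => //; rewrite /E asboolT//.
  move=> omE; apply/common_points_meetP => // m; have [i _] := omE m I.
  by rewrite /E; case: asboolP => // b hj; exists i; split.
suff : measurable (\bigcap_m \bigcup_i E m i) by [].
apply: bigcapT_measurable => m; apply: bigcupT_measurable => i.
rewrite /E; case: asboolP => _; last exact: measurable0.
apply: sub_sigma_algebra; exists (fun=> hits (rat_point R d.+1 i) (inv_succ R m)) => //.
by move=> _; exact: measurable_hits.
Qed.

Lemma dim_cap_hyperplanes_ge (U : {vspace V}) I :
  (\dim U <= \dim (cap_hyperplanes U I) + size I)%N.
Proof.
elim: I => [|a I IH]; first by rewrite addn0.
rewrite (leq_trans IH)//= addnS -addSn leq_add2r.
set W := cap_hyperplanes U I.
have [[x xW ax]|no] := pselect (exists2 x, x \in W & dot a x != 0%R).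
  by rewrite (dim_cap_hyperplane xW ax).
rewrite cap_hyperplane_id// => x xW; apply/eqP; apply: contra_notT no => ax.
by exists x.
Qed.

(** At most d hyperplanes of a space of dimension d + 1 share a nonzero vector. *)
Lemma common_points_nonempty J om : (#|J| <= d)%N ->
  common_points (fun j => S j om) J !=set0.
Proof.
move=> Jd; have [gs _ _] := hS.
have /choice[u uE] : forall i, exists u : V, body (S i om) = polar_sphere u.
  by move=> i; exact: great_hypersphere_normal (gs i om).
have [|x xU x0] := @dim_gt0_mem _ _ (cap_hyperplanes fullv [seq u j | j <- enum J]).
  have := dim_cap_hyperplanes_ge fullv [seq u j | j <- enum J].
  rewrite size_map -cardE dimvf /dim/= mul1n lt0n => dim_le.
  by apply: contraL dim_le => /eqP ->; rewrite add0n -ltnNge.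
move: xU; rewrite mem_cap_hyperplanes => /andP[_ /allP xu].
exists (normz x); split; first exact: normz_sphere.
move=> j /= jJ; rewrite uE; split; first exact: normz_sphere.
rewrite /= dot_normz; have /eqP -> : dot (u j) x == 0%R; last by rewrite mulr0.
by apply/xu/map_f; rewrite mem_enum.
Qed.

(** A hypersphere independent of the others rarely comes near a given common point of theirs.
    Instead of selecting such a point measurably, the outcomes are split by the first ball of a
    countable family that meets the common points; on each piece independence bounds the probability
    by e times that of the piece. *)
Lemma negligible_containment J i : i \notin J -> (#|J| <= d)%N ->
  P.-negligible [set om | common_points (fun j => S j om) J `<=` body (S i om)].
Proof.
move=> iJ Jd.
suff cover (e : R) : (0 < e)%R -> exists A, [/\ measurable A, P A <= e%:E &
    [set om | common_points (fun j => S j om) J `<=` body (S i om)] `<=` A].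
  have /choice[A AP] : forall m, exists A, [/\ measurable A, P A <= (inv_succ R m)%:E &
      [set om | common_points (fun j => S j om) J `<=` body (S i om)] `<=` A].
    by move=> m; apply: cover; exact: inv_succ_gt0.
  exists (\bigcap_m A m); split.
  - by apply: bigcapT_measurable => m; have [] := AP m.
  - apply/eqP; rewrite eq_le measure_ge0 andbT; apply/lee_addgt0Pr => e e0.
    rewrite add0e; have [m me] := inv_succ_lt e0; have [mA PA _] := AP m.
    apply: (@le_trans _ _ (P (A m))).
      rewrite le_measure ?inE//; last exact: bigcap_inf.
      by apply: bigcapT_measurable => m'; have [] := AP m'.
    by rewrite (le_trans PA)// lee_fin ltW.
  - by move=> om omS m _; have [_ _] := AP m; apply.
move=> e0; pose c (l : nat) : option (nat * nat) := unpickle l.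
(* Only balls that the hypersphere [S i] hits with probability at most e are kept. *)
pose good (p : nat * nat) := `[< kappa (hits (rat_point R d.+1 p.1) (inv_succ R p.2)) <= e%:E >].
(* Half the radius, so that the closed ball required by the compactness criterion lies inside the
   open ball of [T]. *)
pose Q l : set V := if c l is Some p then if good p then
  closed_ball (rat_point R d.+1 p.1) (inv_succ R p.2 / 2)%R else set0 else set0.
pose T l : set (spherical_body R d) := if c l is Some p then if good p then
  hits (rat_point R d.+1 p.1) (inv_succ R p.2) else set0 else set0.
have mT l : measurable (T l).
  by rewrite /T; case: (c l) => // p; case: ifP => // _; exact: measurable_hits.
have kT l : kappa (T l) <= e%:E.
  rewrite /T; case: (c l) => [p|]; last by rewrite measure0 lee_fin ltW.
  by case: ifP => [/asboolP//|_]; rewrite measure0 lee_fin ltW.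
have half (m : nat) : (0 < inv_succ R m / 2)%R by rewrite divr_gt0// inv_succ_gt0.
have cQ l : closed (Q l).
  rewrite /Q; case: (c l) => [p|]; last exact: closed0.
  case: ifP => _; last exact: closed0.
  exact: closed_ball_closed.
pose E l : set Om := [set om | (common_points (fun j => S j om) J `&` Q l) !=set0].
have sE l : <<s rectangles J >> (E l) by exact: common_points_event_sigma.
have sD l : <<s rectangles J >> (seqDU E l).
  have : measurable (seqDU E l : set (g_sigma_algebraType (rectangles J))).
    rewrite /seqDU; apply: measurableD; first exact: sE.
    by apply: bigsetU_measurable => l' _; exact: sE.
  by [].
have mD l : measurable (seqDU E l) := rectangles_measurable (sD l).
have mST l : measurable (seqDU E l `&` S i @^-1` T l).
  by apply: measurableI => //; exact: S_measurable.
exists (\bigcup_l (seqDU E l `&` S i @^-1` T l)); split.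
- exact: bigcupT_measurable.
- apply: (@le_trans _ _ (\sum_(0 <= l <oo) P (seqDU E l `&` S i @^-1` T l))).
    by apply: measure_sigma_subadditive => //; exact: bigcupT_measurable.
  apply: (@le_trans _ _ (\sum_(0 <= l <oo) e%:E * P (seqDU E l))).
    apply: lee_nneseries => // l _; rewrite (independent_sigma iJ (sD l) (mT l)).
    by rewrite muleC lee_wpmul2r.
  rewrite nneseriesZl//.
  rewrite -[leRHS]mule1; apply: lee_wpmul2l; first by rewrite lee_fin ltW.
  rewrite -measure_semi_bigcup//; do ?[exact: trivIset_seqDU|exact: bigcupT_measurable].
  by apply: probability_le1; exact: bigcupT_measurable.
- move=> om omS; have [y [y1 yJ]] := common_points_nonempty om Jd.
  have [l omE] : exists l, E l om.
    (* The ball of radius [inv_succ m] about the rational centre lies in the ball of radius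
       [inv_succ m0] about [y], hence it is good. *)
    have [m0 km0] := kappa_hits_small y1 e0.
    have [m mm0] := inv_succ_lt (half m0).
    have [i0 yi0] := rat_point_dense y (half m).
    exists (pickle (i0, m)); exists y; split; first by split.
    rewrite /Q /c pickleK /good asboolT/=; first by rewrite closed_ballE// /closed_ball_/= distrC ltW.
    apply: le_trans km0; apply: le_measure; rewrite ?inE; try exact: measurable_hits.
    move=> K [z [Kz]]; rewrite -ball_normE/= => iz; exists z; split=> //.
    rewrite -ball_normE/= (le_lt_trans (ler_distD (rat_point R d.+1 i0) _ _))//.
    by have := inv_succ_gt0 R m; lra.
  have : (\bigcup_l E l) om by exists l.
  rewrite seqDU_bigcup_eq => -[l' _ omD]; exists l' => //; split=> //.
  have [z [zJ]] : E l' om by exact: subset_seqDU omD.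
  rewrite /Q /= /T; case: (c l') => // p; case: ifP => // _; rewrite closed_ballE// /closed_ball_/= => zp.
  exists z; split; first exact: omS.
  rewrite -ball_normE/= (le_lt_trans zp)// ltr_pdivrMr// ltr_pMr ?inv_succ_gt0//.
  by rewrite ltr1n.
Qed.

Lemma ae_general_position : {ae P, forall om, exists u : 'I_n -> V,
  (forall i, body (S i om) = polar_sphere (u i)) /\
  general_position fullv [seq u i | i <- enum 'I_n]}.
Proof.
have ae : {ae P, forall om, forall p : {set 'I_n} * 'I_n, p.2 \notin p.1 ->
    (#|p.1| <= d)%N -> ~ common_points (fun j => S j om) p.1 `<=` body (S p.2 om)}.
  apply: filter_forall => -[J i] /=.
  have [iJ|] := boolP (i \notin J); last by move=> _; apply: aeW.
  have [Jd|Jd] := leqP #|J| d; last by apply: aeW.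
  apply: negligibleS (negligible_containment iJ Jd) => om /=.
  by move=> h; apply: contrapT => no; apply: h.
apply: filterS ae => om ae.
have [gs _ _] := hS.
have /choice[u uE] : forall i, exists u : V, body (S i om) = polar_sphere u.
  by move=> i; exact: great_hypersphere_normal (gs i om).
exists u; split => //; apply: general_position_normals => J i iJ Jd.
have := ae (J, i) iJ Jd; rewrite /common_points uE; apply: contra_not => /=.
by under eq_bigcapr do rewrite -uE.
Qed.

End AlmostSureGeneralPosition.

(** * Conditioning on the tessellation *)

Section DyadicCells.
Variables (R : realType) (d k : nat).
Local Notation V := 'rV[R]_d.+1.
Local Notation muH := (@hausdorff_measure R d.+1 k).
Implicit Types (x : V) (X : set V) (K : spherical_body R d).
Local Open Scope ereal_scope.

Definition rat_ball (m i : nat) : set (borel_rV R d.+1) :=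
  ball (rat_point R d.+1 i) (inv_succ R m).

(** Made disjoint, the rational balls of scale m form a countable Borel partition of the space. *)
Definition rat_cell (m : nat) : nat -> set (borel_rV R d.+1) := seqDU (rat_ball m).

Lemma measurable_rat_cell m i : measurable (rat_cell m i).
Proof.
have mb j : measurable (rat_ball m j).
  by apply: sub_sigma_algebra; exact: ball_open.
by apply: measurableD => //; exact: bigsetU_measurable.
Qed.

Lemma rat_cell_cover m x : exists i, rat_cell m i x.
Proof.
have [i xi] := rat_point_dense x (inv_succ_gt0 R m).
have : (\bigcup_i rat_ball m i) x by exists i => //; rewrite /rat_ball -ball_normE/= distrC.
by rewrite seqDU_bigcup_eq => -[j _ xj]; exists j.
Qed.

Lemma rat_cell_sub m i : rat_cell m i `<=` rat_ball m i.
Proof. exact: subset_seqDU. Qed.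

Lemma nneseries_rat_cell m i x (a : nat -> \bar R) : (forall j, 0 <= a j) ->
  rat_cell m i x -> \sum_(0 <= j <oo) a j * (\1_(rat_cell m j) x)%:E = a i.
Proof.
move=> a0 xi; rewrite (nneseriesD1 (n := i))//; last first.
  by move=> j _; rewrite mule_ge0// lee_fin.
rewrite indicE mem_set// mule1 eseries0 ?adde0// => j _ /= ji.
rewrite indicE memNset ?mule0// => xj; move: ji => /eqP; apply.
by apply: (@trivIset_seqDU _ (rat_ball m)) => //; exists x.
Qed.

(** The mass of [X] in the cells whose surrounding ball meets [K], an outer approximation of
    [muH (X]&[body K)] in which [K] occurs only through hitting events. *)
Definition cover_mass X K m : \bar R :=
  \sum_(0 <= i <oo) (\1_(hits (rat_point R d.+1 i) (inv_succ R m)) K)%:E *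
                    muH (X `&` rat_cell m i).

Lemma cover_massE X K m : cover_mass X K m = muH (X `&`
  \bigcup_(i in [set i | hits (rat_point R d.+1 i) (inv_succ R m) K]) rat_cell m i).
Proof.
rewrite /cover_mass -/(hausdorff_on k X _) measure_bigcup; last 2 first.
- by move=> i _; exact: measurable_rat_cell.
- by apply: sub_trivIset (@trivIset_seqDU _ _).
rewrite [RHS]eseries_mkcond; apply: eq_eseriesr => i _.
rewrite indicE; case: ifPn => iK.
  by rewrite mem_set ?mul1e//; exact/set_mem.
by rewrite memNset ?mul0e// => /mem_set; apply/negP.
Qed.

Lemma cover_mass_le X K m : cover_mass X K m <= muH X.
Proof. by rewrite cover_massE; apply: le_hausdorff_measure; exact: subIsetl. Qed.

(** The approximations are squeezed between [body K] and its open neighbourhoods, which decrease to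
    it because it is closed; finite mass gives continuity from above. *)
Lemma cover_mass_cvg X K : muH X < +oo ->
  cover_mass X K m @[m --> \oo] --> muH (X `&` body K).
Proof.
(* The factor 2: one radius from the point to the centre of its ball, one from the centre to [K]. *)
move=> Xfin; pose N m : set (borel_rV R d.+1) :=
  \bigcup_(y in body K) ball (y : V) (2 * inv_succ R m)%R.
have e2 m : (0 < 2 * inv_succ R m)%R by rewrite mulr_gt0// inv_succ_gt0.
have mN m : measurable (N m).
  apply: sub_sigma_algebra; apply: bigcup_open => y _; apply: ball_open.
have NK : \bigcap_m N m = body K.
  apply/seteqP; split=> [x Nx|x Kx m _]; last first.
    by exists x => //; apply: ballxx; exact: e2.
  rewrite (closure_id (body K)).1; last exact: body_closed.
  move=> B /nbhs_ballP[r /= r0 rB].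
  have r2 : (0 < r / 2)%R by rewrite divr_gt0.
  have [m mr] := inv_succ_lt r2; have [y Ky yx] := Nx m I.
  exists y; split=> //; apply: rB; apply: ball_sym; apply: le_ball yx.
  by lra.
have N_cvg : muH (X `&` N m) @[m --> \oo] --> muH (X `&` body K).
  rewrite -NK; apply: (@nonincreasing_cvg_mu _ _ _ (hausdorff_on k X) N) => //.
  - by apply: le_lt_trans Xfin; apply: le_hausdorff_measure; exact: subIsetl.
  - exact: bigcapT_measurable.
  - move=> m m' mm'; apply/subsetPset => x [y Ky yx]; exists y => //.
    by apply: le_ball yx; rewrite ler_pM2l// inv_succ_le.
apply: (squeeze_cvge _ (@cvg_cst _ (muH (X `&` body K)) _ _ _) N_cvg).
apply: nearW => m; rewrite cover_massE; apply/andP; split.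
  apply: le_hausdorff_measure => x [Xx Kx]; split=> //.
  by have [i xi] := rat_cell_cover m x; exists i => //; exists x; split=> //; exact: rat_cell_sub xi.
apply: le_hausdorff_measure => x [Xx [i [y [Ky iy]] xi]]; split=> //; exists y => //.
have := rat_cell_sub xi; move: iy; rewrite /rat_ball -!ball_normE/= => iy ix.
rewrite (le_lt_trans (ler_distD (rat_point R d.+1 i) _ _))// distrC.
by rewrite mulr_natl mulr2n ltrD.
Qed.

(** Each of the finitely many bodies that miss [x] has positive distance from it, so small balls
    near [x] miss them too. *)
Lemma hits_near_point x (A : set (spherical_body R d)) (i : nat -> nat) : finite_set A ->
  (forall m, rat_cell m (i m) x) ->
  \forall m \near \oo, A `&` hits (rat_point R d.+1 (i m)) (inv_succ R m) =
                       A `&` [set K | body K x].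
Proof.
move=> finA ix.
have sub m : [set K | body K x] `<=` hits (rat_point R d.+1 (i m)) (inv_succ R m).
  by move=> K Kx; exists x; split=> //; exact: (rat_cell_sub (ix m)).
have : \forall m \near \oo, forall K, A K -> ~ body K x ->
    ~ hits (rat_point R d.+1 (i m)) (inv_succ R m) K.
  have [s sA] := (finite_seqP _).1 finA.
  have near1 K : \forall m \near \oo, ~ body K x ->
      ~ hits (rat_point R d.+1 (i m)) (inv_succ R m) K.
    have [Kx|Kx] := pselect (body K x); first by apply: nearW.
    have [r r0 rK] : exists2 r : R, (0 < r)%R & forall y, ball x r y -> ~ body K y.
      have : nbhs x (~` body K).
        by apply: open_nbhs_nbhs; split=> //; exact/closed_openC/body_closed.
      by move=> /nbhs_ballP[r /= r0 rK]; exists r => // y /rK.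
    have r2 : (0 < r / 2)%R by rewrite divr_gt0.
    have [M Mr] := inv_succ_lt r2; exists M => // m /= Mm _ [y [Ky iy]].
    apply: (rK y) => //; have := rat_cell_sub (ix m).
    move: iy; rewrite /rat_ball -!ball_normE/= => iy ixm.
    rewrite (le_lt_trans (ler_distD (rat_point R d.+1 (i m)) _ _))// distrC.
    have := inv_succ_le R Mm; lra.
  rewrite sA; elim: s {sA} => [|K s IH]; first by apply: nearW.
  near=> m => K'; rewrite /= inE => /predU1P[->|K's].
    by near: m; exact: near1.
  by move: K' K's; near: m; exact: IH.
apply: filterS => m h; apply/seteqP; split=> K [AK hK]; split=> //; last exact: sub.
by apply: contrapT => Kx; exact: (h K AK Kx).
Unshelve. all: by end_near. Qed.

End DyadicCells.

(** * Lower integrals and integrals along random elements *)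

Section IntegrationFacts.
Import HBNNSimple.
Context {R : realType} {d : measure_display} {T : measurableType d}.
Variable mu : measure T R.
Local Open Scope ereal_scope.

(* The integral of a function that is not known to be measurable is its lower
   integral, for which monotonicity still holds. *)
Lemma le_integral_nonmeasurable (f g : T -> \bar R) :
  (forall x, 0 <= f x) -> (forall x, f x <= g x) -> \int[mu]_x f x <= \int[mu]_x g x.
Proof.
move=> f0 fg; rewrite !ge0_integralTE//; last by move=> x; exact: le_trans (fg x).
apply: ereal_sup_le => _ [h hf <-]; exists h => // x.
exact: le_trans (hf x) (fg x).
Qed.

(** Measurability of [g] alone suffices by comparison: from above with [g] increased to +oo on a
    null set, from below with [g] restricted to its complement. *)
Lemma ae_eq_integral_nonmeasurable (f g : T -> \bar R) :
  (forall x, 0 <= f x) -> (forall x, 0 <= g x) -> measurable_fun setT g ->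
  {ae mu, forall x, f x = g x} -> \int[mu]_x f x = \int[mu]_x g x.
Proof.
move=> f0 g0 mg [N [mN N0 fgN]].
have fgE x : ~ N x -> f x = g x by move=> Nx; apply: contrapT => /fgN.
pose s := cst +oo \_ N : T -> \bar R.
have ms : measurable_fun setT s.
  by apply/(measurable_restrictT _ mN); exact: measurable_cst.
have s0 x : 0 <= s x by rewrite /s patchE; case: ifP => // _; rewrite leey.
apply/eqP; rewrite eq_le; apply/andP; split.
  apply: (@le_trans _ _ (\int[mu]_x (g x + s x))).
    apply: le_integral_nonmeasurable => // x; rewrite /s patchE.
    case: ifPn => [_|/negP xN]; last by rewrite adde0 fgE// => /mem_set.
    by rewrite addey ?leey// gt_eqF// (lt_le_trans _ (g0 x)).
  rewrite ge0_integralD// -[in leLHS]integral_mkcond integral_cst// N0 mule0 adde0.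
  by [].
rewrite (ge0_negligible_integral mN measurableT)// integral_mkcond.
apply: le_integral_nonmeasurable => x; rewrite patchE; case: ifPn => // /set_mem[_ Nx].
by rewrite fgE.
Qed.

(** Simple approximations of [h] on [E] reduce the weighted integral to integrals of [w] over
    preimages of Borel sets. *)
Lemma integral_comp_approx (d' : measure_display) (E : measurableType d') (X : T -> E)
    (w : T -> \bar R) (h : E -> \bar R) (mh : measurable_fun setT h) :
  measurable_fun setT X -> measurable_fun setT w -> (forall x, 0 <= w x) ->
  (forall x, w x \is a fin_num) ->
  (forall y, 0 <= h y) ->
  \sum_(y \in range (nnsfun_approx measurableT mh m))
     y%:E * \int[mu]_(x in X @^-1` (nnsfun_approx measurableT mh m @^-1` [set y])) w x
  @[m --> \oo] --> \int[mu]_x (h (X x) * w x).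
Proof.
move=> mX mw w0 wfin h0; pose g m x := (nnsfun_approx measurableT mh m (X x))%:E * w x.
have mhm m : measurable_fun setT (fun x => (nnsfun_approx measurableT mh m (X x))%:E).
  apply/measurable_EFinP.
  by apply: (measurableT_comp (measurable_funPT (nnsfun_approx measurableT mh m))).
have gE m : \int[mu]_x g m x = \sum_(y \in range (nnsfun_approx measurableT mh m))
     y%:E * \int[mu]_(x in X @^-1` (nnsfun_approx measurableT mh m @^-1` [set y])) w x.
  set s := nnsfun_approx measurableT mh m.
  have mXs y : measurable (X @^-1` (s @^-1` [set y])).
    rewrite -[X in measurable X]setTI; apply: mX => //.
  have ind0 y x : 0 <= (y * \1_(s @^-1` [set y]) x)%:E.
    by rewrite EFinM nnfun_muleindic_ge0.
  transitivity (\int[mu]_x \sum_(y \in range s) ((y * \1_(s @^-1` [set y]) (X x))%:E * w x)).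
    by apply: eq_integral => x _; rewrite /g -/s fimfunE -fsumEFin// ge0_mule_fsuml.
  rewrite ge0_integral_fsum//; last 2 first.
  - move=> y; apply: emeasurable_funM => //; apply/measurable_EFinP.
    apply: measurable_funM => //.
    by apply: (measurableT_comp _ mX); exact: measurable_indic.
  - by move=> y x _; rewrite mule_ge0.
  apply: eq_fsbigr => y /set_mem[z _ yz].
  rewrite -ge0_integralZl//; last 2 first.
  - exact: measurable_funTS.
  - by rewrite lee_fin -yz.
  rewrite [RHS]integral_mkcond.
  apply: eq_integral => x _; rewrite EFinM -muleA patchE indicE.
  case: ifPn => [/set_mem xs|/negP xs]; first by rewrite mem_set ?mul1e.
  by rewrite memNset ?mul0e ?mule0// => xs'; apply: xs; exact/mem_set.
have -> : \int[mu]_x (h (X x) * w x) = \int[mu]_x limn (g ^~ x).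
  apply: eq_integral => x _; apply/esym/cvg_lim => //.
  apply: cvgeZr => //.
  exact: (@cvg_nnsfun_approx _ _ _ _ measurableT _ mh (fun y _ => h0 y) (X x) I).
under eq_cvg do rewrite -gE.
apply: cvg_monotone_convergence => //.
- by move=> m; apply: emeasurable_funM.
- by move=> m x _; rewrite mule_ge0// lee_fin.
- move=> x _ m m' mm'; rewrite lee_wpmul2r// lee_fin.
  by have /lefP := nd_nnsfun_approx measurableT mh mm'; apply.
Qed.

(** Both integrals are limits along the same simple functions on [E], so proportionality over
    preimages of Borel sets extends to all [h]. *)
Lemma eq_integral_comp (d' : measure_display) (E : measurableType d') (X1 X2 : T -> E)
    (w1 w2 : T -> \bar R) (c : R) (h : E -> \bar R) :
  measurable_fun setT X1 -> measurable_fun setT X2 ->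
  measurable_fun setT w1 -> measurable_fun setT w2 ->
  (forall x, 0 <= w1 x) -> (forall x, 0 <= w2 x) ->
  (forall x, w1 x \is a fin_num) -> (forall x, w2 x \is a fin_num) ->
  (forall B, measurable B ->
     \int[mu]_(x in X1 @^-1` B) w1 x = c%:E * \int[mu]_(x in X2 @^-1` B) w2 x) ->
  measurable_fun setT h -> (forall y, 0 <= h y) -> (0 <= c)%R ->
  \int[mu]_x (h (X1 x) * w1 x) = c%:E * \int[mu]_x (h (X2 x) * w2 x).
Proof.
move=> mX1 mX2 mw1 mw2 w10 w20 fw1 fw2 eqB mh h0 c0.
have cvg1 := integral_comp_approx mh mX1 mw1 w10 fw1 h0.
have cvg2 := cvgeZl (isT : c%:E \is a fin_num) (integral_comp_approx mh mX2 mw2 w20 fw2 h0).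
rewrite -[LHS](cvg_lim _ cvg1)// -[RHS](cvg_lim _ cvg2)//.
congr (limn _); apply/funext => m; set s := nnsfun_approx _ _ _.
rewrite !fsbig_finite//= big_seq [in RHS]big_seq ge0_sume_distrr.
  apply: eq_bigr => y _; rewrite muleCA; congr (_ * _); apply: eqB.
  by rewrite -[X in measurable X]setTI; exact: measurable_funPT.
move=> y; rewrite in_fset_set// => /set_mem[z _ <-].
by rewrite mule_ge0 ?lee_fin// integral_ge0.
Qed.

End IntegrationFacts.

(** * Quotients of extended reals and counting measure *)

Section Ratios.
Variable R : realType.
Local Open Scope ereal_scope.
Implicit Types a b : \bar R.

Lemma ratio_bounds a b : 0 <= a -> a <= b -> 0 <= a / b <= 1.
Proof.
move=> a0; case: b => [b|_|]; last by move/(le_trans a0).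
- rewrite le_eqVlt => /orP[/eqP ab|].
    rewrite {}ab in a0 *; have [b0|b0] := eqVneq b 0%R.
      by rewrite b0 mul0e lexx lee01.
    by rewrite divee// lexx lee01.
  move=> ab; have b0 : (0 < b)%R by rewrite -lte_fin (le_lt_trans a0).
  rewrite inver gt_eqF// mule_ge0 ?lee_fin ?invr_ge0 ?(ltW b0)//=.
  by rewrite lee_pdivrMr// mul1e ltW.
- by rewrite invey mule0 lexx lee01.
Qed.

(** As 0/0 and +oo/+oo are 0, a normalized mass equal to 1 detects a positive finite normalizing
    constant. *)
Lemma ratio_self b : 0 <= b -> (b / b == 1) = (0 < b < +oo).
Proof.
case: b => [b|_|//]; last by rewrite invey mule0 ltxx andbF eq_sym gt_eqF ?lte01.
rewrite lee_fin le_eqVlt ltry andbT => /predU1P[<-|b0].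
  by rewrite mul0e ltxx eq_sym gt_eqF ?lte01.
have bn0 : b%:E != 0 by rewrite gt_eqF// lte_fin.
by rewrite divee// eqxx lte_fin b0.
Qed.

Lemma le_counting (T : choiceType) (A B : set T) : A `<=` B ->
  counting A <= counting B :> \bar R.
Proof.
move=> AB; rewrite /counting; case: asboolP => [fA|iA]; case: asboolP => [fB|iB] //.
- by rewrite lee_fin ler_nat fsubset_leq_card// -fset_set_sub.
- by rewrite leey.
- by case: iA; exact: sub_finite_set AB fB.
Qed.

Lemma counting_finite (T : choiceType) (A : set T) :
  (counting A : \bar R) < +oo -> finite_set A.
Proof. by rewrite /counting; case: asboolP. Qed.

Lemma counting_ge0 (T : choiceType) (A : set T) : 0 <= counting A :> \bar R.
Proof. by rewrite /counting; case: asboolP; rewrite ?leey ?lee_fin. Qed.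

End Ratios.

(** * Conditional laws *)

Section ConditionalLaw.
Context {R : realType} {dOm : measure_display} {Om : measurableType dOm}.
Variable P : probability Om R.
Local Open Scope ereal_scope.

(** The defining identity concerns indicators of conditioning events; it extends to every
    non-negative function measurable for the conditioning sigma-field. *)
Lemma integral_cond_law (gens : set (set Om)) (d : measure_display) (E : measurableType d)
    (X : {RV P >-> E}) (mu : Om -> set E -> \bar R) (B : set E) (g : Om -> \bar R) :
  has_cond_law P <<s gens >> X mu -> measurable B ->
  (forall om, 0 <= mu om B <= 1) -> (forall om, 0 <= g om) ->
  preimage_set_system setT g measurable `<=` <<s gens >> ->
  \int[P]_om (g om * (\1_(X @^-1` B) om)%:E) = \int[P]_om (g om * mu om B).
Proof.
move=> [Gm law] mB mu01 g0 mg; have [muG muB] := law B mB.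
have mXB : measurable (X @^-1` B).
  by rewrite -[T in measurable T]setTI; exact: measurable_funPT.
pose OmG := g_sigma_algebraType gens.
(* Viewing the identity as a random element with values in the coarser measurable space makes
   [eq_integral_comp] applicable. *)
have mid : measurable_fun setT (id : Om -> OmG).
  by move=> _ Y mY; rewrite setTI; exact: Gm.
have mgG : measurable_fun setT (g : OmG -> \bar R).
  by move=> _ Y mY; apply: mg; exists Y.
have mmuB : measurable_fun setT (mu ^~ B).
  by move=> _ Y mY; apply: Gm; apply: muG; exists Y.
rewrite -[RHS]mul1e; apply: (eq_integral_comp mid mid _ mmuB _ _ _ _ _ mgG g0 ler01) => //.
- by apply/measurable_EFinP; exact: measurable_indic.
- by move=> om; have /andP[] := mu01 om.
- by move=> om; rewrite ge0_fin_numE;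
    have /andP[mu0 mu1] := mu01 om; rewrite ?(le_lt_trans mu1) ?ltry.
- move=> A mA; rewrite !preimage_id mul1e integral_indic//; last exact: Gm.
  by rewrite -(muB A mA) setIC.
Qed.

Lemma integral_cond_lawT (gens : set (set Om)) (d : measure_display) (E : measurableType d)
    (X : {RV P >-> E}) (mu : Om -> set E -> \bar R) :
  has_cond_law P <<s gens >> X mu -> \int[P]_om mu om setT = 1.
Proof.
move=> [_ law]; have GT : <<s gens >> setT.
  exact: (@measurableT _ (g_sigma_algebraType gens)).
by rewrite -((law setT measurableT).2 setT GT) preimage_setT setTI probability_setT.
Qed.

Lemma ae_exists (Q : Om -> Prop) : {ae P, forall om, Q om} -> exists om, Q om.
Proof.
move=> aeQ; have : ProperFilter (almost_everywhere P).
  by apply: ae_properfilter_algebraOfSetsType; rewrite [ltRHS](_ : _ = 1) ?lte01//;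
    exact: probability_setT.
by move=> PF; exact: (filter_ex aeQ).
Qed.

Lemma ae_and (Q1 Q2 : Om -> Prop) : {ae P, forall om, Q1 om} ->
  {ae P, forall om, Q2 om} -> {ae P, forall om, Q1 om /\ Q2 om}.
Proof. exact: filterI. Qed.

(** The outcomes with [mu om B = 0] form a conditioning event, on which [X] falls into [B] with
    probability 0. *)
Lemma ae_cond_law_neq0 (gens : set (set Om)) (d : measure_display) (E : measurableType d)
    (X : {RV P >-> E}) (mu : Om -> set E -> \bar R) (B : set E) :
  has_cond_law P <<s gens >> X mu -> measurable B ->
  {ae P, forall om, B (X om) -> mu om B != 0}.
Proof.
move=> [Gm law] mB; have [muG muB] := law B mB.
pose A := (mu ^~ B) @^-1` [set 0].
have GA : <<s gens >> A by apply: muG; exists [set 0] => //; rewrite setTI.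
have mXB : measurable (X @^-1` B).
  by rewrite -[T in measurable T]setTI; exact: measurable_funPT.
exists (A `&` X @^-1` B); split.
- by apply: measurableI => //; exact: Gm.
- rewrite [LHS](muB A GA); apply: integral0_eq => om omA; exact: omA.
- by move=> om /not_implyP[BX /negP/negPn/eqP mu0].
Qed.

End ConditionalLaw.

(** * The typical and the weighted typical face *)

Section TypicalFaces.
Variables (R : realType) (d k n : nat).
Hypotheses (hd : (1 <= d)%N) (hk : (k <= d)%N) (hn : (1 <= n)%N) (hnk : (d - k <= n)%N).
Variable kappa : probability (spherical_body R d) R.
Hypothesis hkappa : nondegenerate_directional_distribution kappa.
Variables (dOm : measure_display) (Om : measurableType dOm) (P : probability Om R).
Variable S : 'I_n -> {RV P >-> spherical_body R d}.
Hypothesis hS : iid_great_hyperspheres kappa S.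
Variables (Z W : {RV P >-> spherical_body R d}) (v : {RV P >-> borel_rV R d.+1}).
Local Notation F := (random_faces S k).
Local Notation X := (random_skel S k).
Local Notation muH := (@hausdorff_measure R d.+1 k).
Local Notation G := (sigma_of_random_set (R := R) (random_tessellation S)).
Local Open Scope ereal_scope.

Definition face_law (om : Om) (B : set (spherical_body R d)) : \bar R :=
  counting (F om `&` B) / counting (F om).

Definition skel_law (om : Om) (B : set (borel_rV R d.+1)) : \bar R :=
  muH (X om `&` B) / muH (X om).

Hypothesis hZ : has_cond_law P G Z face_law.
Hypothesis hv : has_cond_law P G v skel_law.
Hypothesis hW : {ae P, forall om, F om (W om) /\ sphere_relint (body (W om)) (v om)}.

Lemma face_law_bounds om B : 0 <= face_law om B <= 1.
Proof. by apply: ratio_bounds; [exact: counting_ge0|apply: le_counting; exact: subIsetl]. Qed.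

Lemma skel_law_bounds om B : 0 <= skel_law om B <= 1.
Proof.
apply: ratio_bounds; first exact: hausdorff_measure_ge0.
by apply: le_hausdorff_measure; exact: subIsetl.
Qed.

Lemma measurable_face_law B : measurable B -> measurable_fun setT (face_law ^~ B).
Proof. by move=> mB _ Y mY; apply: hZ.1; apply: (hZ.2 B mB).1; exists Y. Qed.

Lemma measurable_skel_law B : measurable B -> measurable_fun setT (skel_law ^~ B).
Proof. by move=> mB _ Y mY; apply: hv.1; apply: (hv.2 B mB).1; exists Y. Qed.

Local Notation N := (num_faces n d.+1 (d - k)).

Lemma ae_counting_faces : {ae P, forall om, counting (F om) = N%:R%:E :> \bar R}.
Proof.
apply: filterS (ae_general_position hd hkappa hS) => om [u [uE gp]].
exact: (counting_faces hn hk uE gp).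
Qed.

(** Without faces [face_law] would vanish almost surely, whereas its total mass has expectation
    1. *)
Lemma num_faces_gt0 : (0 < N)%N.
Proof.
rewrite lt0n; apply/eqP => N0.
have := integral_cond_lawT hZ.
have -> : \int[P]_om face_law om setT = \int[P]_om (cst 0 om).
  apply: ae_eq_integral_nonmeasurable => //.
    by move=> om; have /andP[] := face_law_bounds om setT.
  apply: filterS ae_counting_faces => om NE.
  by rewrite /face_law setIT NE N0 mul0e.
by rewrite integral0 => /eqP; rewrite eq_sym onee_eq0.
Qed.

(** The total mass of [skel_law] takes only the values 0 and 1 and has expectation 1. Working with
    this quotient provides the measurability that is not known for the volume of the skeleton. *)
Lemma ae_hausdorff_skel_bounds : {ae P, forall om, 0 < muH (X om) < +oo}.
Proof.
have mT := measurable_skel_law measurableT.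
pose A := (skel_law ^~ setT) @^-1` [set 1].
have mA : measurable A by rewrite -[X in measurable X]setTI; exact: mT.
have lawE om : skel_law om setT = (\1_A om)%:E.
  rewrite indicE; case: (boolP (om \in A)) => [/set_mem//|/negP omA].
  rewrite /skel_law setIT; case H : (muH (X om)) => [b| |].
  - have [b0|b0] := eqVneq b 0%R; first by rewrite b0 mul0e.
    exfalso; apply/omA/mem_set; rewrite /A /= /skel_law setIT H divee//.
  - by rewrite invey mule0.
  - by have := hausdorff_measure_ge0 k (X om); rewrite H.
have PA : P A = 1.
  have := integral_cond_lawT hv; under eq_integral do rewrite lawE.
  by rewrite integral_indic// setIT.
exists (~` A); split; first exact: measurableC.
  by rewrite probability_setC// [X in 1 - X]PA subee.
move=> om /= noX omA; apply: noX; rewrite -ratio_self ?hausdorff_measure_ge0//.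
by apply/eqP; move: omA; rewrite /A /= /skel_law setIT.
Qed.

(** A single outcome with finite skeleton volume makes great k-subspheres finite; [hausdorff_skel]
    then gives every outcome in general position the same volume. *)
Lemma ae_hausdorff_skel : exists2 L : R, (0 < L)%R & {ae P, forall om, muH (X om) = L%:E}.
Proof.
have ae := ae_and (ae_general_position hd hkappa hS) ae_hausdorff_skel_bounds.
have [|U _ dU] := @subspace_of_dim R d.+1 k.+1 fullv.
  by rewrite dimvf /dim/= mul1n.
have [om0 [[u0 [uE0 gp0]] /andP[X0 Xoo]]] := ae_exists ae.
have Ufin : muH (subsphere U) < +oo.
  exact: le_lt_trans (hausdorff_subsphere_le_skel hn hk uE0 gp0 hnk dU) Xoo.
have XE := hausdorff_skel hn hk uE0 gp0 dU Ufin.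
exists (fine (muH (X om0))); first by rewrite fine_gt0// X0.
apply: filterS (ae_general_position hd hkappa hS) => om [u [uE gp]].
rewrite fineK ?ge0_fin_numE ?hausdorff_measure_ge0// [RHS]XE.
exact: (hausdorff_skel hn hk uE gp dU Ufin).
Qed.

(** Almost surely every rational ball hit by [Z] has positive conditional hitting probability, hence
    is hit by some face. So each point of [Z] is a limit of points of the skeleton, which is closed
    as a finite union. *)
Lemma ae_typical_face_sub_skel : {ae P, forall om, body (Z om) `<=` X om}.
Proof.
have ae_hits : {ae P, forall om, forall i m,
    hits (rat_point R d.+1 i) (inv_succ R m) (Z om) ->
    face_law om (hits (rat_point R d.+1 i) (inv_succ R m)) != 0}.
  apply: ae_foralln => i; apply: ae_foralln => m.
  by apply: (ae_cond_law_neq0 hZ); exact: measurable_hits.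
have ae := ae_and ae_hits ae_counting_faces.
apply: filterS ae => om [Zhits NE].
have cX : closed (X om).
  apply: closed_bigcup => [|K _]; last exact: body_closed.
  by apply: (@counting_finite R); rewrite NE ltry.
rewrite (closure_id (X om)).1// => x Zx B /nbhs_ballP[r /= r0 rB].
have r2 : (0 < r / 2)%R by rewrite divr_gt0.
have [m mr] := inv_succ_lt r2; have [i xi] := rat_point_dense x (inv_succ_gt0 R m).
have ix : ball (rat_point R d.+1 i) (inv_succ R m) x by rewrite -ball_normE/= distrC.
have := Zhits i m (ex_intro _ x (conj Zx ix)).
have [[K [FK [y [Ky iy]]]] _|no] :=
  pselect (exists K, F om K /\ hits (rat_point R d.+1 i) (inv_succ R m) K).
  exists y; split; first by exists K.
  apply: rB; move: iy; rewrite -!ball_normE/= => iy.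
  by rewrite (le_lt_trans (ler_distD (rat_point R d.+1 i) _ _))//; lra.
rewrite /face_law (_ : _ `&` _ = set0); last first.
  by apply/seteqP; split=> // K FK; apply: no; exists K.
by rewrite /counting asboolT// fset_set0 mul0e eqxx.
Qed.

Local Notation hit m i := (hits (rat_point R d.+1 i) (inv_succ R m)).

(** This evaluates the conditional law of [Z] at the cell containing [v], and [mass_approx]
    evaluates the law of [v] along the balls hit by [Z]: two readings of one double sum. *)
Definition face_approx (B : set (spherical_body R d)) (m : nat) (om : Om) : \bar R :=
  \sum_(0 <= i <oo) face_law om (B `&` hit m i) * (\1_(rat_cell m i) (v om))%:E.

Definition mass_approx (m : nat) (om : Om) : \bar R :=
  \sum_(0 <= i <oo) (\1_(hit m i) (Z om))%:E * skel_law om (rat_cell m i).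

Let mZ (B : set (spherical_body R d)) : measurable B -> measurable (Z @^-1` B).
Proof. by move=> mB; rewrite -[T in measurable T]setTI; exact: measurable_funPT. Qed.

Let mW (B : set (spherical_body R d)) : measurable B -> measurable (W @^-1` B).
Proof. by move=> mB; rewrite -[T in measurable T]setTI; exact: measurable_funPT. Qed.

Let mv (B : set (borel_rV R d.+1)) : measurable B -> measurable (v @^-1` B).
Proof. by move=> mB; rewrite -[T in measurable T]setTI; exact: measurable_funPT. Qed.

Let mhit m i : measurable (hit m i).
Proof. exact: measurable_hits. Qed.

Let term_face m i B (om : Om) :=
  face_law om (B `&` hit m i) * (\1_(v @^-1` rat_cell m i) om)%:E.

Let measurable_term_face m i B : measurable B -> measurable_fun setT (term_face m i B).
Proof.
move=> mB; apply: emeasurable_funM.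
  by apply: measurable_face_law; exact: measurableI.
by apply/measurable_EFinP/measurable_indic/mv; exact: measurable_rat_cell.
Qed.

Let term_face_ge0 m i B om : 0 <= term_face m i B om.
Proof. by rewrite mule_ge0 ?lee_fin//; have /andP[] := face_law_bounds om (B `&` hit m i). Qed.

Let term_mass m i (om : Om) := (\1_(Z @^-1` hit m i) om)%:E * skel_law om (rat_cell m i).

Let measurable_term_mass m i : measurable_fun setT (term_mass m i).
Proof.
apply: emeasurable_funM; first exact/measurable_EFinP/measurable_indic/mZ.
by apply: measurable_skel_law; exact: measurable_rat_cell.
Qed.

Let term_mass_ge0 m i om : 0 <= term_mass m i om.
Proof. by rewrite mule_ge0 ?lee_fin//; have /andP[] := skel_law_bounds om (rat_cell m i). Qed.

Lemma measurable_face_approx B m : measurable B -> measurable_fun setT (face_approx B m).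
Proof.
move=> mB; apply: (ge0_emeasurable_sum (h := fun i => term_face m i B) (P := xpredT)) => //.
by move=> i _; exact: measurable_term_face.
Qed.

Lemma measurable_mass_approx m : measurable_fun setT (mass_approx m).
Proof. exact: (ge0_emeasurable_sum (h := term_mass m) (P := xpredT)). Qed.

(* Conditioning on the tessellation, both sides are the expectation of
   [\sum_i face_law (B `&` hit m i) * skel_law (rat_cell m i)]. *)
Lemma integral_face_approx B m : measurable B ->
  \int[P]_om face_approx B m om = \int[P]_(om in Z @^-1` B) mass_approx m om.
Proof.
move=> mB.
rewrite (integral_nneseries P measurableT (fun i => measurable_term_face m i mB)
  (fun i om _ => term_face_ge0 m i B om)).
rewrite (integral_nneseries P (mZ mB) (fun i => measurable_funTS (measurable_term_mass m i))
  (fun i om _ => term_mass_ge0 m i om)).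
apply: eq_eseriesr => i _.
have mBh : measurable (B `&` hit m i) by exact: measurableI.
have mC := @measurable_rat_cell R d m i.
rewrite (integral_cond_law hv mC); last 3 first.
- by move=> om; exact: skel_law_bounds.
- by move=> om; have /andP[] := face_law_bounds om (B `&` hit m i).
- exact: (hZ.2 _ mBh).1.
transitivity (\int[P]_om (skel_law om (rat_cell m i) * face_law om (B `&` hit m i))).
  by apply: eq_integral => om _; exact: muleC.
rewrite -(integral_cond_law hZ mBh); last 3 first.
- by move=> om; exact: face_law_bounds.
- by move=> om; have /andP[] := skel_law_bounds om (rat_cell m i).
- exact: (hv.2 _ mC).1.
rewrite [RHS]integral_mkcond; apply: eq_integral => om _.
rewrite patchE preimage_setI !indicE in_setI muleC.
by case: ifPn => //= _; rewrite mul0e.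
Qed.

Lemma face_approx_bounds B m om : 0 <= face_approx B m om <= 1.
Proof.
have [i xi] := rat_cell_cover m (v om).
rewrite /face_approx (nneseries_rat_cell _ xi)//; first exact: face_law_bounds.
by move=> j; have /andP[] := face_law_bounds om (B `&` hit m j).
Qed.

(** At small scales the faces hit by the ball near [v] are those containing [v]. As [v] is in the
    relative interior of [W], this is [W] alone, one face out of N. *)
Lemma ae_face_approx_cvg B : {ae P, forall om,
  face_approx B m om @[m --> \oo] --> (\1_(W @^-1` B) om)%:E * (N%:R^-1)%:E}.
Proof.
have ae := ae_and (ae_general_position hd hkappa hS) (ae_and hW ae_counting_faces).
apply: filterS ae => om [[u [uE gp]] [[FW vW] NE]].
have /choice[i iP] : forall m, exists i, rat_cell m i (v om).
  by move=> m; exact: rat_cell_cover.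
have FE m : face_approx B m om = face_law om (B `&` hit m (i m)).
  rewrite /face_approx (nneseries_rat_cell _ (iP m))// => j.
  by have /andP[] := face_law_bounds om (B `&` hit m j).
have finF : finite_set (F om `&` B).
  by apply: sub_finite_set (@counting_finite R _ _ _); [exact: subIsetl|rewrite NE ltry].
have vWb : body (W om) (v om) by case: vW.
apply: cvg_near_cst; apply: filterS (hits_near_point finF iP) => m eqm.
have N0 : (N%:R : R) != 0%R by rewrite pnatr_eq0 -lt0n num_faces_gt0.
rewrite FE /face_law setIA eqm NE inver (negbTE N0); congr (_ * _).
rewrite indicE; case: (boolP (om \in _)) => [/set_mem BW|/negP BW].
  rewrite (_ : _ `&` _ = [set W om]).
    by rewrite /counting asboolT// fset_set1 cardfs1.
  apply/seteqP; split=> K; last by move=> ->.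
  move=> [[FK _] Kv]; apply/esym.
  exact: (relint_face_unique hn hk uE gp FW FK vW Kv).
rewrite (_ : _ `&` _ = set0); first by rewrite /counting asboolT// fset_set0.
apply/seteqP; split=> // K [[FK BK] Kv]; apply: BW; apply/mem_set.
by rewrite /= (relint_face_unique hn hk uE gp FW FK vW Kv).
Qed.

(* Almost surely the normalized volume of the typical face; truncated so as to be
   measurable and bounded everywhere. *)
Definition typical_weight (om : Om) : \bar R :=
  mine (maxe (limn_esup (mass_approx ^~ om)) 0) 1.

Lemma typical_weight_bounds om : 0 <= typical_weight om <= 1.
Proof.
rewrite /typical_weight ge_min lexx orbT andbT le_min lee01 andbT le_max lexx orbT//.
Qed.

Lemma typical_weight_fin_num om : typical_weight om \is a fin_num.
Proof.
have /andP[w0 w1] := typical_weight_bounds om.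
by rewrite ge0_fin_numE// (le_lt_trans w1)// ltry.
Qed.

Lemma measurable_typical_weight : measurable_fun setT typical_weight.
Proof.
apply: measurable_mine; last exact: measurable_cst.
apply: measurable_maxe; last exact: measurable_cst.
exact/measurable_fun_limn_esup/measurable_mass_approx.
Qed.

Section normalization.
Variable L : R.
Hypotheses (L0 : (0 < L)%R) (XL : {ae P, forall om, muH (X om) = L%:E}).

Lemma ae_mass_approx : {ae P, forall om, [/\ forall m, 0 <= mass_approx m om <= 1,
  mass_approx m om @[m --> \oo] --> typical_weight om &
  typical_weight om = muH (body (Z om)) * (L^-1)%:E]}.
Proof.
apply: filterS (ae_and XL ae_typical_face_sub_skel) => om [XE ZX].
have LV0 : (0 <= L^-1)%R by rewrite invr_ge0 ltW.
have approxE m : mass_approx m om = cover_mass k (X om) (Z om) m * (L^-1)%:E.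
  rewrite muleC /cover_mass -nneseriesZl; last first.
    by move=> i _; rewrite mule_ge0 ?lee_fin// hausdorff_measure_ge0.
  apply: eq_eseriesr => i _; rewrite /skel_law XE inver gt_eqF//.
  by rewrite muleA muleC.
have b01 m : 0 <= mass_approx m om <= 1.
  rewrite approxE; apply/andP; split.
    by rewrite mule_ge0 ?lee_fin// cover_massE hausdorff_measure_ge0.
  rewrite -[leRHS](_ : L%:E * (L^-1)%:E = 1); last by rewrite -EFinM mulfV ?gt_eqF.
  by rewrite lee_wpmul2r ?lee_fin// -XE cover_mass_le.
have Xfin : muH (X om) < +oo by rewrite XE ltry.
have cvgm : mass_approx m om @[m --> \oo] --> muH (body (Z om)) * (L^-1)%:E.
  under eq_cvg do rewrite approxE.
  apply: cvgeZr => //; have := @cover_mass_cvg _ _ k (X om) (Z om) Xfin.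
  by rewrite setIC (setIidl ZX).
have lim01 : 0 <= muH (body (Z om)) * (L^-1)%:E <= 1.
  apply/andP; split; first by rewrite mule_ge0 ?lee_fin// hausdorff_measure_ge0.
  rewrite -(cvg_lim _ cvgm)//; apply: lime_le; first by apply/cvg_ex; eexists; exact: cvgm.
  by apply: nearW => m; have /andP[] := b01 m.
have wE : typical_weight om = muH (body (Z om)) * (L^-1)%:E.
  rewrite /typical_weight (cvg_limn_einf_sup cvgm).2; have /andP[l0 l1] := lim01.
  by rewrite (max_idPl l0) (min_idPl l1).
by split=> //; rewrite wE.
Qed.

(** Both sides of [integral_face_approx] pass to the limit by dominated convergence with the
    constant 1. *)
Lemma probability_weighted B : measurable B ->
  \int[P]_(om in Z @^-1` B) typical_weight om = P (W @^-1` B) * (N%:R^-1)%:E.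
Proof.
move=> mB.
have int1 D : measurable D -> P.-integrable D (EFin \o cst 1%R : Om -> \bar R).
  move=> mD; apply: (integrableS measurableT mD (@subsetT _ _)).
  exact: finite_measure_integrable_cst.
have cvgZ : \int[P]_(om in Z @^-1` B) mass_approx m om @[m --> \oo] -->
    \int[P]_(om in Z @^-1` B) typical_weight om.
  have [||||//] := @dominated_convergence _ _ _ P _ (mZ mB) mass_approx typical_weight
    _ _ _ _ (int1 _ (mZ mB)).
  - by move=> m; apply: measurable_funTS; exact: measurable_mass_approx.
  - by apply: measurable_funTS; exact: measurable_typical_weight.
  - by apply: filterS ae_mass_approx => om [].
  - apply: filterS ae_mass_approx => om [b _ _] m _.
    by have /andP[b0 b1] := b m; rewrite gee0_abs.
have mI : measurable_fun setT
    (fun om : Om => (\1_(W @^-1` B) om)%:E * (N%:R^-1)%:E : \bar R).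
  apply: emeasurable_funM; last exact: measurable_cst.
  exact/measurable_EFinP/measurable_indic/mW.
have cvgW : \int[P]_om face_approx B m om @[m --> \oo] -->
    \int[P]_om ((\1_(W @^-1` B) om)%:E * (N%:R^-1)%:E).
  have [||||//] := @dominated_convergence _ _ _ P _ measurableT (face_approx B)
    (fun om => (\1_(W @^-1` B) om)%:E * (N%:R^-1)%:E) _ _ _ _ (int1 _ measurableT).
  - by move=> m; exact: measurable_face_approx.
  - exact: mI.
  - by apply: filterS (ae_face_approx_cvg B) => om.
  - apply: aeW => om m _.
    by have /andP[b0 b1] := face_approx_bounds B m om; rewrite gee0_abs.
have -> : P (W @^-1` B) * (N%:R^-1)%:E =
    \int[P]_om ((\1_(W @^-1` B) om)%:E * (N%:R^-1)%:E).
  rewrite ge0_integralZr//; last first.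
    exact/measurable_EFinP/measurable_indic/mW.
  by rewrite integral_indic ?setIT//; exact: mW.
have approxE : (fun m => \int[P]_om face_approx B m om) =
    (fun m => \int[P]_(om in Z @^-1` B) mass_approx m om).
  by apply/funext => m; exact: integral_face_approx.
move: cvgW; rewrite approxE => cvgW.
exact: cvg_unique cvgZ cvgW.
Qed.

Lemma integral_weighted_face (h : spherical_body R d -> R) :
  measurable_fun setT h -> (forall K, (0 <= h K)%R) ->
  \int[P]_om (h (W om))%:E =
  (\int[P]_om muH (body (Z om)))^-1 * \int[P]_om ((h (Z om))%:E * muH (body (Z om))).
Proof.
move=> mh h0; have mw := measurable_typical_weight.
have w0 om : 0 <= typical_weight om by have /andP[] := typical_weight_bounds om.
have N0 : (0 < N%:R :> R)%R by rewrite ltr0n num_faces_gt0.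
have NV0 : (N%:R : R) != 0%R by rewrite gt_eqF.
have mhZ : measurable_fun setT (fun om => (h (Z om))%:E).
  by apply/measurable_EFinP; apply: (measurableT_comp mh); exact: measurable_funPT.
have hZ0 om : 0 <= (h (Z om))%:E by rewrite lee_fin.
(* The case of the full set in [probability_weighted] gives the normalization. *)
have ZE : \int[P]_om muH (body (Z om)) = (L / N%:R)%:E.
  transitivity (\int[P]_om (L%:E * typical_weight om)).
    apply: ae_eq_integral_nonmeasurable.
    - by move=> om; exact: hausdorff_measure_ge0.
    - by move=> om; rewrite mule_ge0// lee_fin ltW.
    - by apply: emeasurable_funM => //; exact: measurable_cst.
    - apply: filterS ae_mass_approx => om [_ _ ->].
      by rewrite muleCA -EFinM mulfV ?mule1// gt_eqF.
  rewrite ge0_integralZl//; last by rewrite lee_fin ltW.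
  have := probability_weighted measurableT; rewrite !preimage_setT => ->.
  by rewrite probability_setT mul1e EFinM.
have hZE : \int[P]_om ((h (Z om))%:E * muH (body (Z om))) =
    L%:E * \int[P]_om ((h (Z om))%:E * typical_weight om).
  have mhw : measurable_fun setT (fun om => (h (Z om))%:E * typical_weight om).
    exact: emeasurable_funM.
  rewrite -ge0_integralZl//; [|by move=> om _; rewrite mule_ge0|by rewrite lee_fin ltW].
  apply: ae_eq_integral_nonmeasurable.
  - by move=> om; rewrite mule_ge0// hausdorff_measure_ge0.
  - by move=> om; rewrite !mule_ge0// lee_fin ltW.
  - by apply: emeasurable_funM => //; exact: measurable_cst.
  - apply: filterS ae_mass_approx => om [_ _ ->].
    rewrite muleCA; congr (_ * _); rewrite muleCA -EFinM mulfV ?mule1// gt_eqF//.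
(* The law of [W] is N times the law of [Z] weighted by [typical_weight]. *)
have WE : \int[P]_om ((h (W om))%:E * 1) =
    N%:R%:E * \int[P]_om ((h (Z om))%:E * typical_weight om).
  apply: (@eq_integral_comp _ _ _ P _ _ W Z (cst 1) typical_weight N%:R (EFin \o h)) => //.
  - exact: typical_weight_fin_num.
  - move=> B mB; rewrite probability_weighted// integral_cst; last exact: mW.
    by rewrite mul1e muleCA -EFinM mulfV// mule1.
  - exact/measurable_EFinP.
rewrite ZE hZE muleA inver mulf_eq0 invr_eq0 (negbTE NV0) gt_eqF//=.
rewrite -EFinM invf_div divfK ?gt_eqF// -WE.
by apply: eq_integral => om _; rewrite mule1.
Qed.

End normalization.

End TypicalFaces.

Unset Implicit Arguments.
Local Open Scope ereal_scope.

Theorem theorem3p5 (R : realType) (d k n : nat)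
  (hd : (1 <= d)%N) (hk : (k <= d)%N) (hn : (1 <= n)%N) (hnk : (d - k <= n)%N)
  (kappa : probability (spherical_body R d) R)
  (hkappa : nondegenerate_directional_distribution kappa)
  (dOm : measure_display) (Om : measurableType dOm) (P : probability Om R)
  (S : 'I_n -> {RV P >-> spherical_body R d})
  (hS : iid_great_hyperspheres kappa S)
  (Z : {RV P >-> spherical_body R d}) (hZ : typical_face S k Z)
  (W : {RV P >-> spherical_body R d}) (hW : weighted_typical_face S k W)
  (h : spherical_body R d -> R)
  (hh_meas : measurable_fun setT h) (hh_ge0 : forall K, (0 <= h K)%R) :
  \int[P]_om (h (W om))%:E =
  (\int[P]_om hausdorff_measure k (body (Z om)))^-1 *
  \int[P]_om ((h (Z om))%:E * hausdorff_measure k (body (Z om))).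
Proof.
have [v [hv hvW]] := hW.
have [L L0 XL] := ae_hausdorff_skel hd hk hn hnk hkappa hS hv.
exact: (integral_weighted_face hd hk hn hkappa hS hZ hv hvW L0 XL hh_meas hh_ge0).
Qed.
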